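(* Let $\Gamma$ be a finite simplicial complex and $1\le k\le\dim\Gamma$. Let $\underline C_{k-1}$ be a quotient-up-component in dimension $k-1$ that is not a leaf, and $\underline C_k=\{\underline\sigma\in\underline X_k:\underline\sigma\supset\underline\rho\text{ for some }\underline\rho\in\underline C_{k-1}\}$ its corresponding quotient-down-component. Assume $\underline C_{k-1}$ contains at least two $(k-1)$-faces and $\underline C_k$ at least two $k$-faces. Then \[ \frac{\max\big(\frac{(\underline h^{\mathrm{up}}_{C_{k-1}})^2}{k},\frac{(\underline h^{\mathrm{down}}_{C_k})^2}{d^{\mathrm{down}}_{C_k}}\big)}{2(k+1)}\le1-\lambda_{\max-1}\big(A^{\underline C_{k-1},\mathrm{up}}_{k-1}\big)=1-\lambda_{\max-1}\big(A^{\underline C_k,\mathrm{down}}_k\big)\le\frac{2\min(\underline h^{\mathrm{up}}_{C_{k-1}},\underline h^{\mathrm{down}}_{C_k})}{k+1}, \] and \[ \frac{\max\big(\frac{(h^{\mathrm{up}}_{C_{k-1}})^2}{k},\frac{(h^{\mathrm{down}}_{C_k})^2}{d^{\mathrm{down}}_{C_k}}\big)}{2(k+1)}\le1+\lambda_{\min}\big(A^{\mathcal O(\underline C_{k-1}),\mathrm{up}}_{k-1}\big)=1+\lambda_{\min}\big(A^{\mathcal O(\underline C_k),\mathrm{down}}_k\big)\le\frac{2\min(h^{\mathrm{up}}_{C_{k-1}},h^{\mathrm{down}}_{C_k})}{k+1}. \] If moreover these components are not coherent, then the convergence rate shared by the up-walk on $C_{k-1}$ and the down-walk on $C_k$ is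 at least $1-\frac{2\max\big(\min(\underline h^{\mathrm{up}}_{C_{k-1}},\underline h^{\mathrm{down}}_{C_k}),\min(h^{\mathrm{up}}_{C_{k-1}},h^{\mathrm{down}}_{C_k})\big)}{k+1}$ and at most \[ 1-\frac{\min\Big(\max\big(\frac{(\underline h^{\mathrm{up}}_{C_{k-1}})^2}{k},\frac{(\underline h^{\mathrm{down}}_{C_k})^2}{d^{\mathrm{down}}_{C_k}}\big),\max\big(\frac{(h^{\mathrm{up}}_{C_{k-1}})^2}{k},\frac{(h^{\mathrm{down}}_{C_k})^2}{d^{\mathrm{down}}_{C_k}}\big)\Big)}{2(k+1)}. \]
   Context: Simplicial complex: a set $\underline X$ of nonempty subsets (faces) of a finite set $V$ containing all singletons and closed under nonempty subsets; $k$-faces have $k+1$ elements, $\underline X_k$ their set. Oriented $k$-faces ($k\ge1$): orderings up to even permutation, $-\sigma$ the opposite; each vertex $x$ has oriented $0$-faces $\pm[x]$. An orientation $\mathcal O$ picks one oriented face over each face. For an oriented $(k+1)$-face $\tau=[x_0,\dots,x_{k+1}]$ and oriented $k$-face $\sigma$ with support $\underline\tau\setminus\{x_i\}$, $[\tau:\sigma]=+1$ iff $\sigma=[x_0,\dots,\widehat{x_i},\dots,x_{k+1}]$ ($i$ even), resp. its opposite ($i$ odd); else $-1$. $\underline\sigma\subset\underline\tau$ means $\underline\sigma$ is a $k$-face inside the $(k+1)$-face $\underline\tau$. A leaf is a face contained in no larger face; $\mathrm{LP}(\underline\sigma)=1$ on leaves and $\mathrm{LP}(\underline\sigma)=\sum_{\underline\tau\supset\underline\sigma}\mathrm{LP}(\underline\tau)$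 otherwise. Distinct $k$-faces are up-adjacent if their union is a $(k+1)$-face, down-adjacent if their intersection is a $(k-1)$-face. Quotient-up-(down-)components in dimension $k$: maximal sets of $k$-faces connected under up-(down-)adjacency; ''not a leaf'' means not a single leaf. A quotient-up-component $\underline C$ in dimension $j$ is coherent if it is not a single leaf and some orientation satisfies $[\tau:\mathcal O(\underline\sigma)]=[\tau:\mathcal O(\underline\sigma')]$ whenever $\underline\sigma,\underline\sigma'\in\underline C$, $\underline\sigma,\underline\sigma'\subset\underline\tau$; a quotient-down-component is coherent if it is not a single vertex and some orientation satisfies $[\mathcal O(\underline\sigma):\rho]=[\mathcal O(\underline\sigma'):\rho]$ whenever $\underline\sigma,\underline\sigma'\in\underline C$ share the $(j-1)$-face $\underline\rho$. Matrices (indexed by faces of the component; write $\sigma=\mathcal O(\underline\sigma)$): $A^{\underline C_{k-1},\mathrm{up}}_{k-1}$ has diagonal entries $\frac1{k+1}$ and off-diagonal entries $\frac1{k+1}\mathrm{LP}(\underline\sigma)^{-1/2}\mathrm{LP}(\underline\sigma')^{-1/2}\mathrm{LP}(\underline\sigma\cup\underline\sigma')$ for up-adjacent pairs, $0$ otherwise; $A^{\mathcal O(\underline C_{k-1}),\mathrm{up}}_{k-1}$ is the same with all entries multiplied by $-1$ and off-diagonal entries additionally multiplied by $s^{\mathrm{up}}(\sigma,\sigma')=[\tau:\sigma][\tau:\sigma']$ ($\tau$ any orientation of $\underline\sigma\cup\underline\sigma'$). $A^{\underline C_k,\mathrm{down}}_k$ has diagonal entries $\frac1{k+1}\mathrm{LP}(\underline\sigma)\sum_{\underline\rho\subset\underline\sigma}\mathrm{LP}(\underline\rho)^{-1}$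 and off-diagonal entries $\frac1{k+1}\mathrm{LP}(\underline\sigma)^{1/2}\mathrm{LP}(\underline\sigma')^{1/2}\mathrm{LP}(\underline\sigma\cap\underline\sigma')^{-1}$ for down-adjacent pairs, $0$ otherwise; $A^{\mathcal O(\underline C_k),\mathrm{down}}_k$ is the same with all entries negated and off-diagonal entries multiplied by $s^{\mathrm{down}}(\sigma,\sigma')=[\sigma:\rho][\sigma':\rho]$ ($\rho$ any orientation of $\underline\sigma\cap\underline\sigma'$). $\lambda_{\max-1}$ is the second largest eigenvalue (with multiplicity), $\lambda_{\min}$ the smallest. Cheeger constants: $\mu(\underline Y)=\sum_{\underline\sigma\in\underline Y}\mathrm{LP}(\underline\sigma)$; $\omega^{\mathrm{up}}_{\underline\sigma\underline\sigma'}=\mathrm{LP}(\underline\sigma\cup\underline\sigma')$ (up-adjacent), $\omega^{\mathrm{down}}_{\underline\sigma\underline\sigma'}=\mathrm{LP}(\underline\sigma)\mathrm{LP}(\underline\sigma')/\mathrm{LP}(\underline\sigma\cap\underline\sigma')$ (down-adjacent). For $\underline Y\subseteq\underline C$: $\omega(\underline Y,\underline C\setminus\underline Y)$ is the sum of weights over adjacent pairs with one face in $\underline Y$ and the other in $\underline C\setminus\underline Y$; $\omega_-(\underline Y,\mathcal O)$ is the sum of weights over ordered adjacent pairs in $\underline Y\times\underline Y$ with $s=-1$. Quotient constants: $\underline h^{\mathrm{up}}_{C_{k-1}}=\min_{\emptyset\ne\underline Y\subsetneq\underline C_{k-1}}\frac{\omega^{\mathrm{up}}(\underline Y,\underline C_{k-1}\setminus\underline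 Y)}{\min(\mu(\underline Y),\mu(\underline C_{k-1}\setminus\underline Y))}$, $\underline h^{\mathrm{down}}_{C_k}$ analogously on $\underline C_k$ with down-data. Signed constants: $h^{\mathrm{up}}_{C_{k-1}}=\min_{\emptyset\ne\underline Y\subseteq\underline C_{k-1},\mathcal O}\frac{\omega^{\mathrm{up}}(\underline Y,\underline C_{k-1}\setminus\underline Y)+\omega^{\mathrm{up}}_-(\underline Y,\mathcal O)}{\mu(\underline Y)}$, $h^{\mathrm{down}}_{C_k}$ analogously. $d^{\mathrm{down}}_{C_k}=k+1-\min_{\underline\sigma\in\underline C_k}\mathrm{LP}(\underline\sigma)\sum_{\underline\rho\subset\underline\sigma}\mathrm{LP}(\underline\rho)^{-1}$. Walks: $C_{k-1}$ (resp. $C_k$) is the set of oriented faces whose supports lie in $\underline C_{k-1}$ (resp. $\underline C_k$). The up-walk on oriented $(k-1)$-faces has transition probabilities: from $u$ with non-leaf support, $P(u,u')=\sum\frac{\mathrm{LP}(\underline v)}{(k+1)\mathrm{LP}(\underline u)}$ over oriented $k$-faces $v$ with $\underline u,\underline u'\subset\underline v$, $[v:u]=1$, $[v:u']=-1$; from $u$ with leaf support, $P(u,\pm u)=1/2$. The down-walk on oriented $k$-faces ($k\ge1$): $P(u,u')=\sum\frac{\mathrm{LP}(\underline u')}{(k+1)\mathrm{LP}(\underline t)}$ over oriented $(k-1)$-faces $t$ with $\underline t\subset\underline u,\underline u'$, $[u:t]=-1$, $[u':t]=1$. The convergence rate of such a chain on a set is the $\lambda\in(0,1)$ such that, for almost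 every initial distribution supported there, the total variation distance between the time-$t$ distribution and the stationary distribution is asymptotic, up to a constant, to $\lambda^t$. *)

(* Defs.v *)
From HB Require Import structures.
From mathcomp Require Import all_classical all_reals all_analysis.
From mathcomp Require Import all_boot all_order all_algebra perm.

Set Implicit Arguments.
Unset Strict Implicit.
Unset Printing Implicit Defensive.

Import Order.TTheory GRing.Theory Num.Theory.
Import numFieldNormedType.Exports.
Local Open Scope ring_scope.

(* Faces are indexed by their number of vertices: [nfaces X n] is the set of
   (n-1)-dimensional faces, so that (k-1)-faces and k-faces are [nfaces X k] and
   [nfaces X k.+1], without predecessors. *)

Section Complex.
Variable V : finType.
Implicit Types (X C Y : {set {set V}}) (s t : {set V}).

Definition simplicial_complex X : Prop :=
  [/\ set0 \notin X,
      forall x : V, [set x] \in X &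
      forall s t, t \in X -> s != set0 -> s \subset t -> s \in X].

Definition cdim X : nat := \max_(s in X) #|s|.-1.

Definition nfaces X (n : nat) : {set {set V}} := [set s in X | #|s| == n].

Definition leaf X s : bool :=
  (s \in X) && [forall t in X, ~~ (s \proper t)].

(* The fuel [#|V|] suffices for faces of a complex: see [LP_leaf], [LP_nonleaf]. *)
Fixpoint LP_rec (fuel : nat) X s : nat :=
  if fuel is fuel'.+1 then
    if leaf X s then 1%N
    else (\sum_(t in nfaces X #|s|.+1 | s \subset t) LP_rec fuel' X t)%N
  else 1%N.

Definition LP X s : nat := LP_rec #|V| X s.

Lemma LP_rec_fuel X s m n :
  (#|V| < m + #|s|)%N -> (#|V| < n + #|s|)%N -> LP_rec m X s = LP_rec n X s.
Proof.
have fuel0 s' : ((#|V| < 0 + #|s'|) = false)%N by rewrite ltnNge max_card.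
elim: m n s => [|m IHm] [|n] s; rewrite ?fuel0 //= => hm hn.
case: ifP => // _; apply: eq_bigr => t /andP[/setIdP[_ /eqP ct] _].
by apply: IHm; rewrite ct addnS -addSn.
Qed.

Lemma LP_leaf X s : simplicial_complex X -> leaf X s -> LP X s = 1%N.
Proof.
case=> X0 _ _ ls; have /andP[sX _] := ls.
have s0 : s != set0 by apply: contraNneq X0 => <-.
have: (0 < #|V|)%N by apply: leq_trans (max_card (mem s)); rewrite card_gt0.
by rewrite /LP; case: #|V| => //= n _; rewrite ls.
Qed.

Lemma LP_nonleaf X s : simplicial_complex X -> s \in X -> ~~ leaf X s ->
  LP X s = (\sum_(t in nfaces X #|s|.+1 | s \subset t) LP X t)%N.
Proof.
case=> X0 _ _ sX /negbTE ls.
have s0 : s != set0 by apply: contraNneq X0 => <-.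
have V0 : (0 < #|V|)%N by apply: leq_trans (max_card (mem s)); rewrite card_gt0.
rewrite {1}/LP (@LP_rec_fuel _ _ _ #|V|.+1) /= ?ls //.
- by rewrite -addn1 leq_add2l card_gt0.
- by rewrite addSn ltnS leq_addr.
Qed.

(* Adjacency of faces with n vertices through their union, and of faces with
   n.+1 vertices through their intersection. *)
Definition up_adj X (n : nat) : rel {set V} := [rel s s' |
  [&& s \in nfaces X n, s' \in nfaces X n, s != s' & s :|: s' \in nfaces X n.+1]].

Definition down_adj X (n : nat) : rel {set V} := [rel s s' |
  [&& s \in nfaces X n.+1, s' \in nfaces X n.+1, s != s' & s :&: s' \in nfaces X n]].

Definition adj_connected (adj : rel {set V}) C : bool :=
  (C != set0) &&
  [forall s in C, forall s' in C,
     connect [rel x y | [&& x \in C, y \in C & adj x y]] s s'].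

Definition up_component X (n : nat) C : bool :=
  maxset [pred C' : {set {set V}} | (C' \subset nfaces X n)
                                    && adj_connected (up_adj X n) C'] C.

Definition single_leaf X C : bool := [exists s, leaf X s && (C == [set s])].
Definition single_vertex C : bool := [exists x : V, C == [set [set x]]].

(* For C made of faces with n vertices. *)
Definition down_of X (n : nat) C : {set {set V}} :=
  [set t in nfaces X n.+1 | [exists r in C, r \subset t]].

(* [(b, (x_0, ..., x_(n-1)))] stands for the signed ordering
   (-1)^b [x_0, ..., x_(n-1)], and permuting the vertices by p multiplies the
   sign by that of p. For n >= 2 every class contains unsigned orderings
   (b = false), which form one class of orderings up to even permutation; for
   n = 1 the two classes over {x} are +[x] and -[x]. *)

Definition oface (n : nat) : finType := {set bool * n.-tuple V}.

Definition oclass n (bt : bool * n.-tuple V) : oface n :=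
  [set (bt.1 (+) odd_perm p, [tuple tnth bt.2 (p i) | i < n]) | p : 'S_n].

Definition supp n (u : oface n) : {set V} := [set x | [exists bt in u, x \in bt.2]].

Definition opp_oface n (u : oface n) : oface n := [set (~~ bt.1, bt.2) | bt in u].

(* The oriented faces whose support lies in C. *)
Definition ofaces n C : {set oface n} :=
  [set u : oface n | [exists bt : bool * n.-tuple V,
     [&& uniq bt.2, [set x in bt.2] \in C & u == oclass bt]]].

Definition del n (i : 'I_n.+1) (t : n.+1.-tuple V) : n.-tuple V :=
  [tuple tnth t (lift i j) | j < n].

(* [tau : sigma]; meaningful when supp sigma is a facet of supp tau. *)
Definition incidence n (tau : oface n.+1) (sigma : oface n) : int :=
  if [exists t : n.+1.-tuple V, exists i : 'I_n.+1,
        ((false, t) \in tau) && (sigma == oclass (odd i, del i t))]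
  then 1 else -1.

(* One oriented face over each face, in every dimension. *)
Definition face_choice := forall n : nat, {set V} -> oface n.

Definition orientation X (O : face_choice) : Prop :=
  forall n s, s \in nfaces X n -> O n s \in ofaces n [set s].

(* These signs do not depend on the orientation chosen for the union, resp. the
   intersection; the one given by O is used. *)
Definition s_up n (O : face_choice) s s' : int :=
  incidence (O n.+1 (s :|: s')) (O n s) * incidence (O n.+1 (s :|: s')) (O n s').

Definition s_down n (O : face_choice) s s' : int :=
  incidence (O n.+1 s) (O n (s :&: s')) * incidence (O n.+1 s') (O n (s :&: s')).

(* C is a quotient-up-component of faces with n vertices. *)
Definition up_coherent X (n : nat) C : Prop :=
  ~~ single_leaf X C /\
  exists2 O : face_choice, orientation X O &
    forall (tau : oface n.+1) s s', tau \in ofaces n.+1 (nfaces X n.+1) ->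
      s \in C -> s' \in C -> s \subset supp tau -> s' \subset supp tau ->
      incidence tau (O n s) = incidence tau (O n s').

(* C is a quotient-down-component of faces with n.+1 vertices. *)
Definition down_coherent X (n : nat) C : Prop :=
  ~~ single_vertex C /\
  exists2 O : face_choice, orientation X O &
    forall (rho : oface n) s s', rho \in ofaces n (nfaces X n) ->
      s \in C -> s' \in C -> supp rho \subset s -> supp rho \subset s' ->
      incidence (O n.+1 s) rho = incidence (O n.+1 s') rho.

End Complex.

Section Spectrum.
Variable R : realType.

(* The eigenvalues with multiplicity in decreasing order. The default [::] is
   only taken when the characteristic polynomial does not split over R, which
   never happens for a symmetric matrix. *)
Definition spectrum n (A : 'M[R]_n) : seq R :=
  xget [::] (fun e : seq R => sorted >=%R e /\
                     char_poly A = \prod_(a <- e) ('X - a%:P)).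

Definition lambda_max1 n (A : 'M[R]_n) : R := (spectrum A)`_1.
Definition lambda_min n (A : 'M[R]_n) : R := last 0 (spectrum A).

End Spectrum.

(* The parameter k is a dimension: up-objects live on (k-1)-faces (k vertices),
   down-objects on k-faces (k.+1 vertices). *)

Section Weights.
Variables (R : realType) (V : finType) (X : {set {set V}}) (k : nat).
Implicit Types (C Y : {set {set V}}) (s t : {set V}) (O : face_choice V).

Notation w s := ((LP X s)%:R : R).

Definition inv_facets s : R := \sum_(r in nfaces X k | r \subset s) (w r)^-1.

Definition up_off s s' : R :=
  if up_adj X k s s' then
    k.+1%:R^-1 * (Num.sqrt (w s))^-1 * (Num.sqrt (w s'))^-1 * w (s :|: s')
  else 0.

Definition down_off s s' : R :=
  if down_adj X k s s' then
    k.+1%:R^-1 * Num.sqrt (w s) * Num.sqrt (w s') * (w (s :&: s'))^-1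
  else 0.

Definition up_diag s : R := k.+1%:R^-1.
Definition down_diag s : R := k.+1%:R^-1 * w s * inv_facets s.

Definition quot_mx (diag : {set V} -> R) (off : {set V} -> {set V} -> R) C :
    'M[R]_#|C| :=
  \matrix_(i, j) if i == j then diag (enum_val i)
                 else off (enum_val i) (enum_val j).

Definition signed_mx (diag : {set V} -> R) (off : {set V} -> {set V} -> R)
    (sgn : {set V} -> {set V} -> int) C : 'M[R]_#|C| :=
  \matrix_(i, j) if i == j then - diag (enum_val i)
                 else - ((sgn (enum_val i) (enum_val j))%:~R
                         * off (enum_val i) (enum_val j)).

Definition A_up C := quot_mx up_diag up_off C.
Definition A_down C := quot_mx down_diag down_off C.
Definition A_up_signed O C := signed_mx up_diag up_off (s_up k O) C.
Definition A_down_signed O C := signed_mx down_diag down_off (s_down k O) C.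

Definition mu Y : R := \sum_(s in Y) w s.

Definition omega_up s s' : R := w (s :|: s').
Definition omega_down s s' : R := w s * w s' / w (s :&: s').

Definition cut_weight (adj : rel {set V}) (omega : {set V} -> {set V} -> R) C Y : R :=
  \sum_(s in Y) \sum_(s' in C :\: Y | adj s s') omega s s'.

Definition neg_weight (adj : rel {set V}) (omega : {set V} -> {set V} -> R)
    (sgn : {set V} -> {set V} -> int) Y : R :=
  \sum_(s in Y) \sum_(s' in Y | adj s s' && (sgn s s' == -1)) omega s s'.

(* The infima below range over finite sets of values, nonempty in the cases of
   interest: they are minima. *)
Definition cheeger_quot (adj : rel {set V}) (omega : {set V} -> {set V} -> R) C : R :=
  inf (fun x : R => exists Y, [/\ Y != set0, Y \proper C &
         x = cut_weight adj omega C Y / Num.min (mu Y) (mu (C :\: Y))]).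

Definition cheeger_signed (adj : rel {set V}) (omega : {set V} -> {set V} -> R)
    (sgn : face_choice V -> {set V} -> {set V} -> int) C : R :=
  inf (fun x : R => exists Y O, [/\ Y != set0, Y \subset C, orientation X O &
         x = (cut_weight adj omega C Y + neg_weight adj omega (sgn O) Y) / mu Y]).

Definition qh_up C := cheeger_quot (up_adj X k) omega_up C.
Definition qh_down C := cheeger_quot (down_adj X k) omega_down C.
Definition h_up C := cheeger_signed (up_adj X k) omega_up (s_up k) C.
Definition h_down C := cheeger_signed (down_adj X k) omega_down (s_down k) C.

Definition d_down C : R :=
  k.+1%:R - inf (fun x : R => exists2 s, s \in C & x = w s * inv_facets s).

Definition up_walk (u u' : oface V k) : R :=
  if leaf X (supp u) then
    if (u' == u) || (u' == opp_oface u) then 2^-1 else 0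
  else
    \sum_(v in ofaces k.+1 (nfaces X k.+1) |
          [&& supp u \subset supp v, supp u' \subset supp v,
              incidence v u == 1 & incidence v u' == -1])
       w (supp v) / (k.+1%:R * w (supp u)).

Definition down_walk (u u' : oface V k.+1) : R :=
  \sum_(t in ofaces k (nfaces X k) |
        [&& supp t \subset supp u, supp t \subset supp u',
            incidence u t == -1 & incidence u' t == 1])
     w (supp u') / (k.+1%:R * w (supp t)).

End Weights.

Section Rate.
Variable R : realType.

Definition distribution n (p : 'rV[R]_n) : Prop :=
  (forall i, 0 <= p 0 i) /\ \sum_i p 0 i = 1.

(* Lebesgue-null sets of the (n-1)-dimensional simplex of distributions on n
   points, by countable covers with balls (cubes, for the sup norm of 'rV_n) of
   arbitrarily small total (n-1)-dimensional volume. *)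
Definition simplex_null n (E : 'rV[R]_n -> Prop) : Prop :=
  forall eps : R, 0 < eps ->
    exists (c : nat -> 'rV[R]_n) (r : nat -> R),
      [/\ forall i, 0 <= r i,
          forall p, E p -> exists i, ball (c i) (r i) p &
          forall N, \sum_(i < N) r i ^+ n.-1 <= eps].

Definition almost_every_distribution n (Q : 'rV[R]_n -> Prop) : Prop :=
  simplex_null (fun p => distribution p /\ ~ Q p).

Definition tv_dist n (p q : 'rV[R]_n) : R := 2^-1 * \sum_i `|p 0 i - q 0 i|.

Definition stationary n (P : 'M[R]_n) (p : 'rV[R]_n) : Prop :=
  distribution p /\ p *m P = p.

(* Transition matrix of the chain on S (acting on row vectors). *)
Definition walk_mx (T : finType) (P : T -> T -> R) (S : {set T}) : 'M[R]_#|S| :=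
  \matrix_(i, j) P (enum_val i) (enum_val j).

Definition convergence_rate (T : finType) (P : T -> T -> R) (S : {set T})
    (lam : R) : Prop :=
  0 < lam < 1 /\
  exists2 pi, unique (stationary (walk_mx P S)) pi &
    almost_every_distribution (fun p =>
      exists2 c : R, 0 < c &
        ((fun t : nat => tv_dist (p *m walk_mx P S ^+ t) pi / lam ^+ t)
           @ \oo --> c)%classic).

End Rate.

(* Main.v *)
(* Let B be the matrix with rows indexed by the (k-1)-faces s of the component, columns
   indexed by the k-faces t, and entries sqrt (LP t / ((k+1) LP s)) for s inside t. Then
   the up matrix is B B^T and the down matrix is B^T B, and multiplying the entries of B
   by the incidence numbers [t : s] gives the opposites of the signed matrices. Hence up
   and down eigenvalues agree, and each gap is governed by Rayleigh quotients of the form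
   (sum over edges of omega (f s -+ f s')^2) / ((k+1) sum of LP f^2). Indicator functions
   give the upper Cheeger bounds; the lower ones follow from a coarea inequality for f^2
   and Cauchy-Schwarz, applied above and below a median in the quotient case, and in the
   signed case to |f|, after reorienting the faces where f is negative.

   A distribution on oriented faces splits into its even and odd parts under reversal of
   orientation, on which both walks act, up to conjugation by sqrt LP, as the quotient and
   the signed matrix. The rate is therefore max (lambda_(max-1), - lambda_min). If both
   values coincide, the odd part alternates in sign, but the total variation distance is
   a sum of terms |x + y| + |x - y|, in which the sign of the odd part y is irrelevant.
   The exceptional initial distributions lie on a hyperplane. *)

Require Import Defs.
From HB Require Import structures.
From mathcomp Require Import all_classical all_reals all_analysis.
From mathcomp Require Import all_boot all_order all_algebra.
From mathcomp Require Import fingroup perm complex.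
From mathcomp Require Import zify ring lra.

Set Implicit Arguments.
Unset Strict Implicit.
Unset Printing Implicit Defensive.

Import Order.TTheory GRing.Theory Num.Theory.
Import numFieldNormedType.Exports.
Local Open Scope ring_scope.

(** * Real symmetric matrices *)

(** Both eigenvalues in question are handled as the largest eigenvalue of a symmetric matrix on the
    orthogonal complement of a vector phi: phi = sqrt LP for the quotient matrix, phi = 0 for the
    opposite of the signed one. Such a maximum passes from B B^T to B^T B by taking g B as a test
    vector, so no multiplicities have to be compared. The constants k and d^down bound the weighted
    degrees divided by LP: each coface of s has k facets other than s, so the up-degree of s is
    exactly k LP s, while the down-degree of t is LP t times k + 1 - LP t (sum of 1 / LP over the
    facets of t). The Gram form also governs the long-time behaviour: the even part of the walk has
    nonnegative spectrum and the odd part nonpositive spectrum, so after division by the power of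
    the rate the only oscillation left is a global sign of the odd part. The rate is below 1 because
    zero energy forces constancy on a connected component in the even case and a coherent
    orientation in the odd case; it is positive because the signed up matrix has diagonal entries -
    1 / (k + 1). *)

Section DotProduct.
Variable R : realDomainType.

Definition dotv n (u v : 'rV[R]_n) : R := \sum_i u 0 i * v 0 i.

Lemma dotvE n (u v : 'rV[R]_n) : dotv u v = (u *m v^T) 0 0.
Proof. by rewrite !mxE; apply: eq_bigr => i _; rewrite mxE. Qed.

Lemma dotvC n (u v : 'rV[R]_n) : dotv u v = dotv v u.
Proof. by apply: eq_bigr => i _; rewrite mulrC. Qed.

Lemma dotvDl n (u u' v : 'rV[R]_n) : dotv (u + u') v = dotv u v + dotv u' v.
Proof. by rewrite -big_split; apply: eq_bigr => i _; rewrite mxE mulrDl. Qed.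

Lemma dotvZl n a (u v : 'rV[R]_n) : dotv (a *: u) v = a * dotv u v.
Proof. by rewrite mulr_sumr; apply: eq_bigr => i _; rewrite mxE mulrA. Qed.

Lemma dotvNl n (u v : 'rV[R]_n) : dotv (- u) v = - dotv u v.
Proof. by rewrite -scaleN1r dotvZl mulN1r. Qed.

Lemma dot0v n (v : 'rV[R]_n) : dotv 0 v = 0.
Proof. by rewrite -[0](scale0r v) dotvZl mul0r. Qed.

Lemma dotvDr n (u v v' : 'rV[R]_n) : dotv u (v + v') = dotv u v + dotv u v'.
Proof. by rewrite dotvC dotvDl !(dotvC _ u). Qed.

Lemma dotvZr n a (u v : 'rV[R]_n) : dotv u (a *: v) = a * dotv u v.
Proof. by rewrite dotvC dotvZl dotvC. Qed.

Lemma dotvNr n (u v : 'rV[R]_n) : dotv u (- v) = - dotv u v.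
Proof. by rewrite dotvC dotvNl dotvC. Qed.

Lemma dotv_mul m n (u : 'rV[R]_m) (A : 'M[R]_(m, n)) v :
  dotv (u *m A) v = dotv u (v *m A^T).
Proof. by rewrite !dotvE trmx_mul trmxK mulmxA. Qed.

Lemma dotvv_ge0 n (u : 'rV[R]_n) : 0 <= dotv u u.
Proof. by apply: sumr_ge0 => i _; rewrite -expr2 sqr_ge0. Qed.

Lemma dotvv_eq0 n (u : 'rV[R]_n) : (dotv u u == 0) = (u == 0).
Proof.
apply/eqP/eqP => [u0|->]; last exact: dot0v.
apply/rowP => i; apply/eqP; rewrite mxE -sqrf_eq0 expr2.
by move/eqP: u0; rewrite psumr_eq0 => [/allP/(_ i (mem_index_enum i))|j _];
  rewrite -?expr2 ?sqr_ge0.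
Qed.

Lemma dotvv_gt0 n (u : 'rV[R]_n) : (0 < dotv u u) = (u != 0).
Proof. by rewrite lt_def dotvv_ge0 andbT dotvv_eq0. Qed.

End DotProduct.

(** * Spectral theorem over a real closed field *)

Section RealSpectral.
Variable R : rcfType.

(* Over R[i] there is an eigenvector x + i y with eigenvalue a + i b, and
   x A . y = x . y A gives b (|x|^2 + |y|^2) = 0. *)
Lemma sym_eigenvector n (A : 'M[R]_n.+1) : A^T = A ->
  exists (a : R) (v : 'rV_n.+1), v != 0 /\ v *m A = a *: v.
Proof.
move=> As; pose toC := real_complex R.
have [z] := eigenvalue_closed (map_mx toC A) (ltn0Sn n); move=> /eigenvalueP[v vA v0].
case: z vA => a b vA.
pose x := map_mx (@complex.Re R) v; pose y := map_mx (@complex.Im R) v.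
have Re_sum (F : 'I_n.+1 -> R[i]) :
    complex.Re (\sum_i F i) = \sum_i complex.Re (F i).
  by elim/big_rec2: _ => // i y1 y2 _ <-; case: (F i) y2 => ? ? [].
have Im_sum (F : 'I_n.+1 -> R[i]) :
    complex.Im (\sum_i F i) = \sum_i complex.Im (F i).
  by elim/big_rec2: _ => // i y1 y2 _ <-; case: (F i) y2 => ? ? [].
have xA : x *m A = a *: x - b *: y.
  apply/rowP => j; move/rowP/(_ j)/(congr1 (@complex.Re R)): vA.
  rewrite !mxE Re_sum; case: (v 0 j) => p q /= <-.
  by apply: eq_bigr => i _; rewrite !mxE; case: (v 0 i) => ? ? /=; rewrite mulr0 subr0.
have yA : y *m A = a *: y + b *: x.
  apply/rowP => j; move/rowP/(_ j)/(congr1 (@complex.Im R)): vA.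
  rewrite !mxE Im_sum; case: (v 0 j) => p q /= <-.
  by apply: eq_bigr => i _; rewrite !mxE; case: (v 0 i) => ? ? /=; rewrite mulr0 add0r.
have b0 : b * (dotv x x + dotv y y) = 0.
  have := dotv_mul x A y; rewrite As xA yA !dotvDl !dotvDr dotvNl !dotvZl !dotvZr.
  by move=> h; lra.
have xy0 : (x != 0) || (y != 0).
  rewrite -negb_and; apply: contra v0 => /andP[/eqP x0 /eqP y0].
  apply/eqP/rowP => j; move/rowP/(_ j): x0; move/rowP/(_ j): y0; rewrite !mxE.
  by case: (v 0 j) => /= ? ? -> ->.
have {}b0 : b = 0.
  apply/eqP; move/eqP: b0; rewrite mulf_eq0 => /orP[//|].
  by rewrite paddr_eq0 ?dotvv_ge0// !dotvv_eq0; case: eqP xy0; case: eqP.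
rewrite b0 !scale0r subr0 in xA; rewrite b0 scale0r addr0 in yA.
by case/orP: xy0 => ?; [exists a, x|exists a, y].
Qed.

(** The reflection along u = v - e_0 exchanges the unit vectors e_0 and v, because u.u = 2 - 2 e_0.v
    = - 2 e_0.u. When v = e_0 there is no such reflection and the identity is taken. *)
Lemma householder n (v : 'rV[R]_n.+1) : dotv v v = 1 ->
  exists2 H : 'M[R]_n.+1, H *m H^T = 1%:M & delta_mx 0 0 *m H = v.
Proof.
move=> v1; pose e : 'rV[R]_n.+1 := delta_mx 0 0; rewrite -/e.
have ee : dotv e e = 1.
  rewrite /dotv (bigD1 0)//= !mxE eqxx mul1r big1 ?addr0// => i /negPf i0.
  by rewrite !mxE i0 mul0r.
have [->|] := eqVneq v e; first by exists 1%:M; rewrite ?trmx1 mulmx1.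
rewrite -subr_eq0; set u := v - e => u0.
have uu : dotv u u = 2 - 2 * dotv e v.
  by rewrite !(dotvDl, dotvDr, dotvNl, dotvNr) v1 ee (dotvC v e); lra.
have uu0 : dotv u u != 0 by rewrite dotvv_eq0.
pose c := 2 / dotv u u; pose H := 1%:M - c *: (u^T *m u).
have HT : H^T = H by rewrite /H linearB/= linearZ/= trmx1 trmx_mul trmxK.
have xH (x : 'rV[R]_n.+1) : x *m H = x - (c * dotv x u) *: u.
  rewrite mulmxBr mulmx1 -scalemxAr mulmxA [_ *m u^T]mx11_scalar mul_scalar_mx.
  by rewrite -dotvE scalerA.
have cu : c * dotv u u = 2 by rewrite /c divfK.
exists H.
  rewrite HT; apply/row_matrixP => i; rewrite row_mul row1 !rowE !xH.
  rewrite dotvDl dotvNl dotvZl mulrBr mulrCA cu -addrA -opprD -scalerDl.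
  by rewrite [X in X *: _](_ : _ = 0) ?scale0r ?subr0//; ring.
rewrite xH (_ : c * dotv e u = -1) ?scaleN1r ?opprK ?subrKC//.
have h : 2 * dotv e u = - dotv u u by rewrite {1}/u dotvDr dotvNr ee uu; ring.
by rewrite /c mulrAC h mulNr divff.
Qed.

(** Deflation: conjugating A by an orthogonal H whose first row is a unit eigenvector gives a matrix
    with first row (a, 0, ..., 0). By symmetry its first column is the same, and the induction
    applies to the remaining block. *)
Theorem sym_spectral n (A : 'M[R]_n) : A^T = A ->
  exists (Q : 'M[R]_n) (d : 'rV[R]_n),
    Q *m Q^T = 1%:M /\ A = Q^T *m diag_mx d *m Q.
Proof.
elim: n A => [|n IHn] A As.
  by exists 1%:M, 0; split; [rewrite trmx1 mulmx1|apply/matrixP => [[]]].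
have [a [v0 [nz0 v0A]]] := sym_eigenvector As.
pose v := (Num.sqrt (dotv v0 v0))^-1 *: v0.
have vA : v *m A = a *: v by rewrite -scalemxAl v0A !scalerA mulrC.
have v1 : dotv v v = 1.
  rewrite dotvZl dotvZr mulrA -invfM -expr2 sqr_sqrtr ?dotvv_ge0//.
  by rewrite mulVf ?dotvv_eq0.
have [H HH eH] := householder v1.
have HTH : H^T *m H = 1%:M by apply: mulmx1C.
move BdE : (H *m A *m H^T) => B.
have BT : B^T = B by rewrite -BdE !trmx_mul trmxK As mulmxA.
have eB : delta_mx 0 0 *m B = a *: (delta_mx 0 0 : 'rV[R]_n.+1).
  by rewrite -BdE !mulmxA eH vA -scalemxAl -eH -mulmxA HH mulmx1.
have B0 j : B 0 j = a *+ (j == 0).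
  move/rowP/(_ j): eB; rewrite -rowE mxE => ->; rewrite mxE mxE eqxx.
  by rewrite mulr_natr.
pose B1 : 'M[R]_n := drsubmx (B : 'M[R]_(1 + n)).
have B1T : B1^T = B1 by rewrite /B1 trmx_drsub BT.
have l0 : lshift n (0 : 'I_1) = (0 : 'I_n.+1) by apply: val_inj.
have BE : B = block_mx (a%:M : 'M[R]_1) 0 0 B1 :> 'M[R]_(1 + n).
  rewrite -[B in LHS](submxK (B : 'M[R]_(1 + n))); congr block_mx.
  - apply/matrixP => i j; rewrite !ord1 !mxE.
    by rewrite l0 B0.
  - apply/matrixP => i j; rewrite !ord1 !mxE.
    by rewrite l0 B0.
  - apply/matrixP => i j; rewrite !ord1 !mxE -BT mxE.
    by rewrite l0 B0.
have [Q [d [QQ B1E]]] := IHn _ B1T.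
pose Q' : 'M[R]_(1 + n) := block_mx 1%:M 0 0 Q.
exists (Q' *m H), (row_mx (a%:M : 'M[R]_1) d : 'rV_(1 + n)).
have Q'Q' : Q' *m Q'^T = 1%:M.
  rewrite /Q' tr_block_mx mulmx_block !trmx0 !(mulmx0, mul0mx) trmx1 mulmx1 QQ.
  by rewrite !(addr0, add0r) -scalar_mx_block.
split.
  by rewrite trmx_mul mulmxA -(mulmxA Q') HH mulmx1.
have -> : diag_mx (row_mx (a%:M : 'M[R]_1) d : 'rV_(1 + n)) = block_mx a%:M 0 0 (diag_mx d).
  rewrite diag_mx_row; congr block_mx.
  by apply/matrixP => i j; rewrite !ord1 !mxE.
rewrite trmx_mul mulmxA -(mulmxA H^T) -(mulmxA H^T).
have -> : Q'^T *m block_mx a%:M 0 0 (diag_mx d) *m Q' = B.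
  rewrite /Q' tr_block_mx !mulmx_block !trmx0 !(mulmx0, mul0mx) trmx1 mulmx1 mul1mx.
  by rewrite !(addr0, add0r) mulmx1 mul0mx -B1E -BE.
by rewrite -BdE !mulmxA HTH mul1mx -mulmxA HTH mulmx1.
Qed.

End RealSpectral.

(** * Extremal eigenvalues as maxima of Rayleigh quotients *)

Section TopEigenvalue.
Variable R : realType.

Lemma dotv_suml n (I : finType) (F : I -> 'rV[R]_n) v :
  dotv (\sum_i F i) v = \sum_i dotv (F i) v.
Proof. by elim/big_rec2: _ => [|i x y _ <-]; rewrite ?dot0v ?dotvDl. Qed.

(** The [d i] come in no particular order; the factorised characteristic polynomial is what ties
    them, with multiplicity, to [spectrum]. *)
Definition eigenbasis n (A : 'M[R]_n) (q : 'I_n -> 'rV[R]_n) (d : 'I_n -> R) :=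
  [/\ forall i j, dotv (q i) (q j) = (i == j)%:R,
      forall i, q i *m A = d i *: q i,
      forall x, x = \sum_i dotv x (q i) *: q i &
      char_poly A = \prod_i ('X - (d i)%:P)].

Lemma sym_eigenbasis n (A : 'M[R]_n) : A^T = A -> exists q d, eigenbasis A q d.
Proof.
move=> /sym_spectral[Q [d [QQ AE]]]; have QTQ := mulmx1C QQ.
have dot_row x i : dotv x (row i Q) = (x *m Q^T) 0 i.
  by rewrite mxE; apply: eq_bigr => j _; rewrite !mxE.
exists (fun i => row i Q), (fun i => d 0 i); split.
- by move=> i j; rewrite dot_row -row_mul QQ !mxE.
- move=> i; rewrite AE !mulmxA -row_mul QQ row1 -rowE row_diag_mx -scalemxAl.
  by rewrite -rowE.
- move=> x; rewrite -[LHS]mulmx1 -QTQ mulmxA mulmx_sum_row.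
  by apply: eq_bigr => i _; rewrite dot_row.
- transitivity (char_poly (diag_mx d)); last first.
    rewrite char_poly_trig ?diag_mx_is_trig//.
    by apply: eq_bigr => i _; rewrite mxE eqxx.
  rewrite /char_poly /char_poly_mx.
  have -> : 'X%:M - map_mx polyC A =
     map_mx polyC Q^T *m ('X%:M - map_mx polyC (diag_mx d)) *m map_mx polyC Q.
    rewrite mulmxBr mulmxBl AE !map_mxM/=; congr (_ - _).
    by rewrite scalar_mxC -mulmxA -map_mxM QTQ map_mx1 mulmx1.
  by rewrite !det_mulmx mulrC mulrA -det_mulmx -map_mxM QQ map_mx1 det1 mul1r.
Qed.

Lemma eigenbasis_dot n (A : 'M[R]_n) q d : eigenbasis A q d ->
  forall x y, dotv x y = \sum_i dotv x (q i) * dotv y (q i).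
Proof.
case=> _ _ qx _ x y; rewrite [in LHS](qx x) dotv_suml.
by apply: eq_bigr => i _; rewrite dotvZl (dotvC y).
Qed.

Lemma eigenbasis_mul n (A : 'M[R]_n) q d : A^T = A -> eigenbasis A q d ->
  forall x i, dotv (x *m A) (q i) = d i * dotv x (q i).
Proof. by move=> As [_ qA _ _] x i; rewrite dotv_mul As qA dotvZr. Qed.

Lemma eigenbasis_quad n (A : 'M[R]_n) q d : A^T = A -> eigenbasis A q d ->
  forall x, dotv (x *m A) x = \sum_i d i * dotv x (q i) ^+ 2.
Proof.
move=> As qP x; rewrite (eigenbasis_dot qP); apply: eq_bigr => i _.
by rewrite (eigenbasis_mul As qP) expr2 mulrA.
Qed.

Lemma eigenbasis_neq0 n (A : 'M[R]_n) q d i : eigenbasis A q d -> q i != 0.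
Proof. by case=> qq _ _ _; rewrite -dotvv_eq0 qq eqxx oner_eq0. Qed.

(** By unique factorisation, two decreasing lists with the same product of linear factors coincide.
    The sorted list of the [d i] also shows that the default value of [spectrum] is not taken. *)
Lemma spectrumE n (A : 'M[R]_n) q d : eigenbasis A q d ->
  spectrum A = sort >=%R [seq d i | i <- enum 'I_n].
Proof.
case=> _ _ _ cA.
have ge_total : total (>=%R : rel R) by move=> x y; apply: le_total.
have [se ce] : sorted >=%R (spectrum A) /\
    char_poly A = \prod_(a <- spectrum A) ('X - a%:P).
  apply: (@xgetPex _ [::] (fun e : seq R => sorted >=%R e /\
                     char_poly A = \prod_(a <- e) ('X - a%:P))).
  exists (sort >=%R [seq d i | i <- enum 'I_n]); split; first exact: sort_sorted.
  rewrite (perm_big [seq d i | i <- enum 'I_n]) ?perm_sort//= big_map cA.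
  by rewrite big_enum.
apply: (@sorted_eq _ >=%R) => //.
- by move=> x y z h1 h2; apply: le_trans h2 h1.
- by move=> x y; rewrite andbC => /le_anti.
- exact: sort_sorted.
- rewrite perm_sym perm_sort perm_sym; apply: prod_XsubC_eq.
  by rewrite -ce cA big_map big_enum.
Qed.

(* With [phi = 0] this is the largest eigenvalue of [A] on the whole space. *)
Definition top_on n (phi : 'rV[R]_n) (A : 'M[R]_n) (a : R) :=
  (exists2 g, g != 0 & dotv g phi = 0 /\ g *m A = a *: g) /\
  forall g, dotv g phi = 0 -> dotv (g *m A) g <= a * dotv g g.

(** For n > 0 the list is nonempty, so [last] does not return its default 0: its last entry is some
    [d i], and it bounds all the others from below. Passing to - A turns this minimum into a
    maximum. *)
Lemma top_on_lambda_min n (A : 'M[R]_n) : A^T = A -> (0 < n)%N ->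
  top_on 0 (- A) (- lambda_min A).
Proof.
move=> As n0; have [q [d qP]] := sym_eigenbasis As.
have [_ qA _ _] := qP.
pose s := sort >=%R [seq d i | i <- enum 'I_n].
have ss : size s = n by rewrite size_sort size_map size_enum_ord.
have lE : lambda_min A = nth 0 s n.-1.
  by rewrite /lambda_min (spectrumE qP) -/s -nth_last ss.
have mem_s a : (a \in s) = (a \in [seq d i | i <- enum 'I_n]) by rewrite mem_sort.
have [i li] : exists i, lambda_min A = d i.
  have : lambda_min A \in s by rewrite lE mem_nth// ss prednK.
  by rewrite mem_s => /mapP[i _ ->]; exists i.
have lmin j : lambda_min A <= d j.
  have : d j \in s by rewrite mem_s map_f// mem_enum.
  move=> /(nthP 0)[m]; rewrite ss => mn <-; rewrite lE.
  have ge_total : total (>=%R : rel R) by move=> x y; apply: le_total.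
  have ge_tr : transitive (>=%R : rel R) by move=> x y z h1 h2; apply: le_trans h2 h1.
  apply: (sorted_leq_nth ge_tr (@lexx _ _) 0 (sort_sorted ge_total _)) => //.
  - by rewrite inE/= -/s ss.
  - by rewrite inE/= -/s ss prednK.
  - by rewrite -ltnS prednK.
split.
  exists (q i); first exact: eigenbasis_neq0 qP.
  by rewrite dotvC dot0v mulmxN qA li scaleNr.
move=> g _; rewrite mulmxN dotvNl mulNr lerN2 (eigenbasis_quad As qP).
rewrite (eigenbasis_dot qP) mulr_sumr; apply: ler_sum => j _.
by rewrite -expr2 ler_wpM2r ?sqr_ge0.
Qed.

(** Let i0, i1 be the indices of the two largest eigenvalues. If [d i1] < 1, then phi, being
    orthogonal to every eigenvector with eigenvalue different from 1, is a multiple of [q i0], and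
    its complement is spanned by the other eigenvectors. If [d i1] = 1, then also [d i0] = 1, and
    some nonzero combination of [q i0] and [q i1] is orthogonal to phi. *)
Lemma top_on_lambda_max1 n (A : 'M[R]_n) (phi : 'rV[R]_n) : A^T = A -> (1 < n)%N ->
  phi != 0 -> phi *m A = phi -> (forall g, dotv (g *m A) g <= dotv g g) ->
  top_on phi A (lambda_max1 A).
Proof.
move=> As n1 phi0 phiA A1; have [q [d qP]] := sym_eigenbasis As.
have [qq qA qx _] := qP.
have ge_total : total (>=%R : rel R) by move=> x y; apply: le_total.
have ge_tr : transitive (>=%R : rel R) by move=> x y z h1 h2; apply: le_trans h2 h1.
pose es := sort (relpre d >=%R) (enum 'I_n).
have ses : size es = n by rewrite size_sort size_enum_ord.
have sd : sorted (relpre d >=%R) es by apply: sort_sorted => x y; apply: le_total.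
have es_all i : i \in es by rewrite mem_sort mem_enum.
have es_uniq : uniq es by rewrite sort_uniq enum_uniq.
rewrite -ses in n1; case esE : es n1 sd es_all es_uniq => [|i0 [|i1 r]]//.
move=> _ sd es_all /= /andP[]; rewrite inE negb_or => /andP[i01 _] _.
have lE : lambda_max1 A = d i1.
  rewrite /lambda_max1 (spectrumE qP).
  have -> : sort >=%R [seq d i | i <- enum 'I_n] = [seq d i | i <- es].
    by rewrite sort_map.
  by rewrite esE.
have d1 i : d i <= 1.
  by have := A1 (q i); rewrite qA dotvZl qq eqxx mulr1.
have d01 : d i1 <= d i0 by move: sd => /= /andP[].
have dle j : j != i0 -> d j <= d i1.
  move=> j0; have := es_all j; rewrite !inE (negPf j0)/= => /orP[/eqP->//|jr].
  have /= /andP[_ pr] := sd.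
  have tr : transitive (relpre d >=%R) by move=> x y z /= h1 h2; apply: le_trans h2 h1.
  by have /allP/(_ j jr) := order_path_min tr pr.
have phi_q i : d i != 1 -> dotv phi (q i) = 0.
  move=> di; have := eigenbasis_mul As qP phi i; rewrite phiA => /eqP.
  rewrite -[X in X == _]mul1r -subr_eq0 -mulrBl mulf_eq0 subr_eq0 eq_sym (negPf di).
  by move=> /= /eqP.
rewrite lE; have [d11|d1N] := eqVneq (d i1) 1.
  have d01' : d i0 = 1 by apply/eqP; rewrite eq_le d1 -{1}d11 d01.
  split; last by move=> g _; rewrite d11 mul1r A1.
  have [z1|nz1] := eqVneq (dotv (q i1) phi) 0.
    by exists (q i1); [exact: eigenbasis_neq0 qP|rewrite z1 qA].
  exists (dotv (q i1) phi *: q i0 - dotv (q i0) phi *: q i1).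
    apply: contra nz1 => /eqP /(congr1 (fun x => dotv x (q i0))).
    rewrite dotvDl dotvNl !dotvZl !qq eqxx (eq_sym i1) (negPf i01) dot0v.
    by rewrite mulr1 mulr0 subr0 => ->.
  rewrite dotvDl dotvNl !dotvZl mulrC subrr; split => //.
  by rewrite mulmxBl -!scalemxAl !qA d11 d01' !scale1r.
have phi_i0 i : i != i0 -> dotv phi (q i) = 0.
  move=> ii0; apply: phi_q; apply: contra d1N => /eqP di.
  by rewrite eq_le d1 -di dle.
have phiE : phi = dotv phi (q i0) *: q i0.
  by rewrite [LHS]qx (bigD1 i0)//= big1 ?addr0// => i /phi_i0->; rewrite scale0r.
split.
  exists (q i1); first exact: eigenbasis_neq0 qP.
  by rewrite qA dotvC phi_i0// eq_sym.
move=> g; rewrite phiE dotvZr => /eqP; rewrite mulf_eq0 => /orP[/eqP c0|/eqP g0].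
  by move: phi0; rewrite phiE c0 scale0r eqxx.
rewrite (eigenbasis_quad As qP) (eigenbasis_dot qP) mulr_sumr; apply: ler_sum => j _.
rewrite -expr2; have [->|j0] := eqVneq j i0; first by rewrite g0 expr0n !mulr0.
by rewrite ler_wpM2r ?sqr_ge0 ?dle.
Qed.

Lemma gram_psd m n (B : 'M[R]_(m, n)) g : 0 <= dotv (g *m (B *m B^T)) g.
Proof. by rewrite mulmxA dotv_mul trmxK dotvv_ge0. Qed.

Lemma gram_psdT m n (B : 'M[R]_(m, n)) g : 0 <= dotv (g *m (B^T *m B)) g.
Proof. by rewrite mulmxA dotv_mul dotvv_ge0. Qed.

(** The i-th basis vector is the test vector. This will bound the decay rate of the odd part away
    from 0. *)
Lemma top_on_diag n (M : 'M[R]_n) a i : top_on 0 M a -> M i i <= a.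
Proof.
move=> [_ /(_ (delta_mx 0 i))]; rewrite dotvC dot0v => /(_ erefl).
have dot_delta v : dotv v (delta_mx 0 i) = v 0 i.
  rewrite /dotv (bigD1 i)//= !mxE !eqxx mulr1 big1 ?addr0// => j /negPf ji.
  by rewrite !mxE ji andbF mulr0.
by rewrite !dot_delta -rowE !mxE !eqxx mulr1.
Qed.

(** For an eigenvector g with eigenvalue a > 0, the vector g B is nonzero, since its square norm is
    a times that of g, and its Rayleigh quotient for B^T B is again a. For a <= 0 it suffices that b
    >= 0. *)
Lemma top_on_gram_le m n (B : 'M[R]_(m, n)) phi psi a b :
  (forall g, dotv g phi = 0 -> dotv (g *m B) psi = 0) ->
  top_on phi (B *m B^T) a -> top_on psi (B^T *m B) b -> a <= b.
Proof.
move=> phipsi [[g g0 [gphi gA]] _] [[h h0 [_ hA]] bmax].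
have b0 : 0 <= b.
  rewrite -(pmulr_lge0 _ (_ : 0 < dotv h h)) ?dotvv_gt0// -dotvZl -hA.
  by rewrite mulmxA dotv_mul dotvv_ge0.
have [a0|a0] := leP a 0; first exact: le_trans b0.
have gBB : dotv (g *m B) (g *m B) = a * dotv g g.
  by rewrite dotv_mul -mulmxA gA dotvZr.
have := bmax (g *m B) (phipsi _ gphi).
rewrite mulmxA -(mulmxA g) gA -scalemxAl dotvZl gBB ler_pM2r//.
by rewrite mulr_gt0 ?dotvv_gt0.
Qed.

Lemma top_on_gram m n (B : 'M[R]_(m, n)) phi psi a b :
  (forall g, dotv g phi = 0 -> dotv (g *m B) psi = 0) ->
  (forall g, dotv g psi = 0 -> dotv (g *m B^T) phi = 0) ->
  top_on phi (B *m B^T) a -> top_on psi (B^T *m B) b -> a = b.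
Proof.
move=> h1 h2 t1 t2; apply/le_anti/andP; split; first exact: top_on_gram_le h1 t1 t2.
by have := top_on_gram_le h2; rewrite trmxK; apply.
Qed.

End TopEigenvalue.

(** * Powers of positive semidefinite matrices *)

Section PowerAsymptotics.
Variable R : realType.

Lemma cvgn_sum (I : finType) (P : pred I) (F : I -> nat -> R) (l : I -> R) :
  (forall i, P i -> (F i @ \oo --> l i)%classic) ->
  ((fun t => \sum_(i | P i) F i t) @ \oo --> \sum_(i | P i) l i)%classic.
Proof. by apply: cvg_big; apply: add_continuous. Qed.

Lemma eigenbasis_pow n (A : 'M[R]_n) q d : eigenbasis A q d ->
  forall z t, z *m A ^+ t = \sum_j (dotv z (q j) * d j ^+ t) *: q j.
Proof.
move=> [_ qA qx _] z; elim=> [|t IHt].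
  by rewrite expr0 mulmx1 [LHS]qx; apply: eq_bigr => j _; rewrite mulr1.
rewrite exprSr mulmxA IHt mulmx_suml; apply: eq_bigr => j _.
by rewrite -scalemxAl qA scalerA exprSr mulrA.
Qed.

Lemma cvg_geometric_ratio (d lam : R) : 0 <= d -> d <= lam -> 0 < lam ->
  ((fun t : nat => d ^+ t / lam ^+ t) @ \oo --> ((d == lam)%:R : R))%classic.
Proof.
move=> d0 dlam lam0.
have -> : (fun t : nat => d ^+ t / lam ^+ t) = (fun t => (d / lam) ^+ t).
  by apply/funext => t; rewrite expr_div_n.
have [->|dN] := eqVneq d lam.
  rewrite divff ?gt_eqF//.
  have -> : (fun t : nat => 1 ^+ t) = (fun=> 1 : R) by apply/funext => t; rewrite expr1n.
  exact: cvg_cst.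
apply: cvg_expr; rewrite ger0_norm; last by rewrite divr_ge0// ltW.
by rewrite ltr_pdivrMr ?mul1r// lt_neqAle dN.
Qed.

(** In an eigenbasis every eigenvalue that z meets lies in [0, [lam]], so each coefficient converges
    after division by [lam ^+ t], and the limit is the projection of z to the eigenspace of [lam].
    Allowing a < [lam], where the limit is 0, lets the even and the odd part of a walk be normalised
    by the same power. *)
Lemma power_asymptotics n (A : 'M[R]_n) phi a lam z :
  A^T = A -> (forall g, 0 <= dotv (g *m A) g) -> phi *m A = phi ->
  top_on phi A a -> a <= lam -> 0 < lam -> dotv z phi = 0 ->
  exists l : 'rV[R]_n,
    (forall i, ((fun t : nat => (z *m A ^+ t) 0 i / lam ^+ t) @ \oo --> l 0 i)%classic) /\
    (forall v, v *m A = lam *: v -> dotv z v != 0 -> l != 0).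
Proof.
move=> As A0 phiA [_ atop] alam lam0 zphi; have [q [d qP]] := sym_eigenbasis As.
have [qq qA qx _] := qP.
have d0 j : 0 <= d j by have := A0 (q j); rewrite qA dotvZl qq eqxx mulr1.
(* If z is not orthogonal to q j, the component of q j orthogonal to phi is an
   eigenvector for d j. *)
have dlam j : dotv z (q j) != 0 -> d j <= lam.
  move=> zq; apply: le_trans alam.
  pose c := dotv (q j) phi / dotv phi phi; pose g := q j - c *: phi.
  have gphi : dotv g phi = 0.
    (* The case phi = 0, in which c = 0 / 0 = 0, is the one used for the odd part. *)
    rewrite dotvDl dotvNl dotvZl /c; have [->|phi0] := eqVneq phi 0.
      by rewrite !(dotvC _ 0) !dot0v mulr0 subr0.
    by rewrite divfK ?subrr// dotvv_eq0.
  have zg : dotv z g = dotv z (q j) by rewrite dotvDr dotvNr dotvZr zphi mulr0 subr0.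
  have g0 : 0 < dotv g g.
    by rewrite dotvv_gt0; apply: contra zq => /eqP g0; rewrite -zg g0 dotvC dot0v.
  have gA : g *m A = d j *: g.
    rewrite mulmxBl -scalemxAl phiA qA scalerBr scalerA; congr (_ - _ *: _).
    have [->|dj1] := eqVneq (d j) 1; first by rewrite mul1r.
    suff -> : c = 0 by rewrite mulr0.
    have := dotv_mul (q j) A phi; rewrite As phiA qA dotvZl => /eqP.
    rewrite -subr_eq0 -[X in _ - X]mul1r -mulrBl mulf_eq0 subr_eq0 (negPf dj1) /c.
    by move=> /= /eqP->; rewrite mul0r.
  by have := atop g gphi; rewrite gA dotvZl ler_pM2r.
exists (\sum_(j | d j == lam) dotv z (q j) *: q j); split => [i|v vA zv].
  rewrite summxE.
  have -> : (fun t : nat => (z *m A ^+ t) 0 i / lam ^+ t) =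
            (fun t => \sum_j (dotv z (q j) * (d j ^+ t / lam ^+ t)) * q j 0 i).
    apply/funext => t; rewrite (eigenbasis_pow qP) summxE mulr_suml.
    by apply: eq_bigr => j _; rewrite mxE; ring.
  rewrite big_mkcond/=; apply: cvgn_sum => j _.
  have [zq|zq] := eqVneq (dotv z (q j)) 0.
    rewrite zq (_ : (fun=> _) = (fun=> 0)); last first.
      by apply/funext => t; rewrite !mul0r.
    by rewrite scale0r mxE if_same; apply: cvg_cst.
  rewrite (_ : (if _ then _ else _) = dotv z (q j) * (d j == lam)%:R * q j 0 i).
    apply: cvgMr_tmp; apply: cvgMl_tmp; apply: cvg_geometric_ratio => //; exact: dlam.
  by case: eqP; rewrite ?mxE ?mulr1 ?mulr0 ?mul0r.
(* As v lies in the eigenspace of [lam], pairing it with the limit gives [dotv z v]. *)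
apply: contra zv => /eqP /(congr1 (fun x => dotv x v)); rewrite dot0v.
rewrite big_mkcond dotv_suml => <-; rewrite (eigenbasis_dot qP); apply/eqP/eq_bigr => j _.
case: eqP => [_|dj]; first by rewrite dotvZl (dotvC v).
rewrite dot0v; have := eigenbasis_mul As qP v j; rewrite vA dotvZl => /eqP.
rewrite -subr_eq0 -mulrBl mulf_eq0 subr_eq0 => /orP[/eqP e|/eqP->]; last exact: mulr0.
by case: dj.
Qed.

End PowerAsymptotics.

(** * Null sets of distributions *)

Section NullSets.
Variable R : realType.

Lemma simplex_nullS n (E F : 'rV[R]_n -> Prop) :
  (forall p, E p -> F p) -> simplex_null F -> simplex_null E.
Proof.
move=> EF nF eps /nF[c [r [r0 Fc sr]]]; exists c, r; split => // p /EF; exact: Fc.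
Qed.

(** Rounding down works for x < 1. The grid stops at m / (m+1), which is still within one step of x
    = 1. *)
Lemma grid_approx m (x : R) : 0 <= x <= 1 ->
  exists g : 'I_m.+1, `|x - g%:R / m.+1%:R| <= m.+1%:R^-1.
Proof.
move=> /andP[x0 x1]; have m0 : 0 < m.+1%:R :> R by rewrite ltr0n.
have [x1'|x1'] := ltP x 1; last first.
  have -> : x = 1 by apply/le_anti/andP.
  exists ord_max => /=; rewrite ler_norml.
  have -> : 1 - m%:R / m.+1%:R = m.+1%:R^-1 :> R.
    by rewrite -[X in X - _](divff (lt0r_neq0 m0)) -mulrBl -natrB// subSnn mul1r.
  by rewrite lexx andbT ge0_cp// invr_ge0 ltW.
have xm0 : 0 <= x * m.+1%:R by rewrite mulr_ge0// ltW.
have /andP[t1 t2] := truncn_itv xm0.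
have tm : (Num.truncn (x * m.+1%:R) < m.+1)%N.
  by rewrite -(ltr_nat R) (le_lt_trans t1)// gtr_pMl.
exists (Ordinal tm) => /=.
have -> : x - (Num.truncn (x * m.+1%:R))%:R / m.+1%:R =
   (x * m.+1%:R - (Num.truncn (x * m.+1%:R))%:R) / m.+1%:R.
  by rewrite mulrBl mulfK ?lt0r_neq0.
have mi0 : 0 <= m.+1%:R^-1 :> R by rewrite invr_ge0 ltW.
rewrite normrM (ger0_norm mi0) ler_piMl//.
rewrite ger0_norm ?subr_ge0// lerBlDr; apply/ltW/(lt_le_trans t2).
by rewrite -natr1 addrC.
Qed.

(* An affine image of a cube of dimension n-2 is covered by m^(n-2) balls of
   radius K/m, and m^(n-2) (K/m)^(n-1) = K^(n-1)/m. *)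
Lemma affine_cube_null n (E : 'rV[R]_n -> Prop) (D : {set 'I_n}) (alpha : 'rV[R]_n)
    (B : 'M[R]_n) : (#|D|.+2 = n)%N ->
  (forall p, E p -> exists q : 'rV[R]_n,
     [/\ forall l, 0 <= q 0 l <= 1, forall l, l \notin D -> q 0 l = 0 &
         p = alpha + q *m B]) ->
  simplex_null E.
Proof.
move=> Dn EB eps eps0.
(* The summand 1 makes K positive and the estimates strict, as open balls require. *)
pose K : R := \sum_l \sum_a `|B l a| + 1.
have K0 : 0 < K.
  by rewrite ltr_wpDl// sumr_ge0// => l _; rewrite sumr_ge0.
have [m Km] : exists m : nat, K ^+ n.-1 / eps <= m.+1%:R.
  exists (Num.bound (K ^+ n.-1 / eps)); apply/ltW/(lt_trans (archi_boundP _)).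
    by rewrite divr_ge0 ?exprn_ge0 ?ltW.
  by rewrite ltr_nat.
have m0 : 0 < m.+1%:R :> R by rewrite ltr0n.
pose G : {set {ffun 'I_n -> 'I_m.+1}} := [set g in pffun_on ord0 (mem D) predT].
have cG : #|G| = (m.+1 ^ #|D|)%N.
  by rewrite cardsE card_pffun_on /= (eq_card (B := 'I_m.+1))// card_ord.
pose ctr (g : {ffun 'I_n -> 'I_m.+1}) : 'rV[R]_n :=
  alpha + (\row_l ((g l)%:R / m.+1%:R)) *m B.
pose c k := ctr (nth [ffun=> ord0] (enum G) k).
(* The finite cover is padded by balls of radius 0, which have no volume because n - 1 = #|D| + 1 is
   positive. *)
pose r k := if (k < #|G|)%N then K / m.+1%:R else 0.
have Km0 : 0 <= K / m.+1%:R by rewrite divr_ge0 ?ltW.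
exists c, r; split.
- by move=> k; rewrite /r; case: ifP.
- move=> p /EB[q [q01 qD ->]].
  have [g gq] : exists g : {ffun 'I_n -> 'I_m.+1}, (forall l, l \notin D -> g l = ord0) /\
      forall l, `|q 0 l - (g l)%:R / m.+1%:R| <= m.+1%:R^-1.
    have /fin_all_exists[g gq] : forall l, exists gl : 'I_m.+1,
        (l \notin D -> gl = ord0) /\ `|q 0 l - gl%:R / m.+1%:R| <= m.+1%:R^-1.
      move=> l; have [lD|lD] := boolP (l \in D).
        by have [gl] := grid_approx m (q01 l); exists gl.
      by exists ord0; rewrite qD// mul0r subrr normr0 invr_ge0 ltW.
    by exists (finfun g); split=> l; rewrite ffunE => *; apply gq.
  case: gq => gD gq.
  have gG : g \in G.
    rewrite inE; apply/pfamilyP; split=> //.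
    by apply/supportP => l lD; rewrite gD.
  exists (index g (enum G)).
  have -> : r (index g (enum G)) = K / m.+1%:R.
    by rewrite /r cardE index_mem mem_enum gG.
  have -> : c (index g (enum G)) = ctr g by rewrite /c nth_index// mem_enum.
  split=> [|i a]; first by rewrite divr_gt0.
  rewrite -ball_normE /ball_ /= (ord1 i) !mxE.
  rewrite opprD addrACA subrr add0r -sumrB.
  apply: (@le_lt_trans _ _ ((\sum_l `|B l a|) / m.+1%:R)).
    apply: le_trans (ler_norm_sum _ _ _) _; rewrite mulr_suml.
    apply: ler_sum => l _; rewrite mxE -mulrBl normrM mulrC ler_wpM2l//.
    by rewrite distrC.
  rewrite ltr_pM2r ?invr_gt0// /K exchange_big/=.
  rewrite [in X in _ < X](bigD1 a) => [|//]; rewrite /= -addrA ltrDl.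
  by rewrite ltr_wpDl// sumr_ge0// => b _; apply: sumr_ge0.
- move=> N; have KM0 : 0 <= (K / m.+1%:R) ^+ n.-1 by apply: exprn_ge0.
  have -> : \sum_(k < N) r k ^+ n.-1 = (K / m.+1%:R) ^+ n.-1 *+ minn N #|G|.
    have rS k : r k ^+ n.-1 = if (k < #|G|)%N then (K / m.+1%:R) ^+ n.-1 else 0.
      by rewrite /r; case: ifP => // _; rewrite -Dn expr0n.
    elim: N => [|N IHN]; first by rewrite big_ord0 min0n.
    rewrite big_ord_recr /= IHN rS; case: ltnP => h; rewrite ?addr0 -?mulrSr; congr (_ *+ _);
      by move: #|G| h => nG h; lia.
  apply: le_trans (ler_wpMn2l KM0 (geq_minr _ _)) _.
  rewrite -[_ *+ #|G|]mulr_natl cG natrX expr_div_n; have nD : (n.-1 = #|D|.+1)%N by rewrite -[in LHS]Dn.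
  move: Km; rewrite nD => Km.
  have -> : m.+1%:R ^+ #|D| * (K ^+ #|D|.+1 / m.+1%:R ^+ #|D|.+1) =
      K ^+ #|D|.+1 / m.+1%:R.
    by rewrite [m.+1%:R ^+ #|D|.+1]exprSr; field; rewrite ?expf_neq0 lt0r_neq0.
  by rewrite ler_pdivrMr// mulrC -ler_pdivrMr.
Qed.

(** Since v_i and v_j differ, the equations sum of p = 1 and p.v = 0 determine p_i and p_j as affine
    functions of the n - 2 other coordinates, which range over a cube. *)
Lemma hyperplane_null n (v : 'rV[R]_n) i j : v 0 i != v 0 j ->
  simplex_null (fun p : 'rV[R]_n => Defs.distribution p /\ dotv p v = 0).
Proof.
move=> vij; have ij : i != j by apply: contraNneq vij => ->.
pose D := ~: [set i; j].
have jD : j \notin D by rewrite !inE eqxx orbT.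
have iD : i \notin D by rewrite !inE eqxx.
(* Cramer's rule for this 2 x 2 system: for a = i, j, p_a is u_a times the sum over l in D of p_l
   (w_a - v_l), minus u_a w_a. *)
pose u a : R := if a == i then (v 0 i - v 0 j)^-1 else
  if a == j then (v 0 j - v 0 i)^-1 else 0.
pose w a : R := if a == i then v 0 j else v 0 i.
apply: (@affine_cube_null _ _ D (\row_a - (u a * w a))
  (\matrix_(l, a) (if a \in D then (l == a)%:R else u a * (w a - v 0 l)))).
  by apply/esym; rewrite -[LHS]card_ord -(cardsC [set i; j]) cards2 ij.
move=> p [[p0 p1] pv].
have ple1 l : p 0 l <= 1.
  by rewrite -p1 (bigD1 l)//= lerDl sumr_ge0.
exists (\row_l if l \in D then p 0 l else 0); split.
- by move=> l; rewrite mxE; case: ifP; rewrite ?p0 ?ple1// lexx ler01.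
- by move=> l lD; rewrite mxE (negPf lD).
apply/rowP => a; rewrite !mxE.
have splitij (F : 'I_n -> R) : \sum_l F l = F i + F j + \sum_(l in D) F l.
  rewrite (bigD1 i)//= (bigD1 j) 1?eq_sym//= addrA; congr (_ + _).
  by apply: eq_bigl => l; rewrite !inE negb_or.
have [aD|aD] := boolP (a \in D).
  have [ai aj] : a != i /\ a != j by move: aD; rewrite !inE negb_or => /andP[].
  rewrite /u (negPf ai) (negPf aj) mul0r oppr0 add0r (bigD1 a)//= !mxE aD eqxx mulr1.
  rewrite big1 ?addr0// => l la; by rewrite !mxE aD (negPf la) mulr0.
have pS := splitij (fun l => p 0 l); have pvS := splitij (fun l => p 0 l * v 0 l).
rewrite p1 in pS; rewrite [LHS]pv in pvS.
rewrite splitij !mxE (negPf iD) (negPf jD) !mul0r !add0r.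
rewrite (eq_bigr (fun l => u a * w a * p 0 l - u a * (p 0 l * v 0 l))); last first.
  by move=> l lD; rewrite !mxE lD (negPf aD); ring.
rewrite sumrB -!mulr_sumr.
have -> : \sum_(l in D) p 0 l = 1 - p 0 i - p 0 j by rewrite pS; ring.
have -> : \sum_(l in D) p 0 l * v 0 l = - (p 0 i * v 0 i + p 0 j * v 0 j).
  by apply/eqP; rewrite -subr_eq0 opprK addrC -pvS.
have vij' : v 0 i - v 0 j != 0 by rewrite subr_eq0.
have vji' : v 0 j - v 0 i != 0 by rewrite subr_eq0 eq_sym.
move: aD; rewrite !inE negbK => /orP[]/eqP->; rewrite /u /w eqxx.
  by field.
by rewrite eq_sym (negPf ij); field.
Qed.

End NullSets.

(** * Cheeger inequalities for signed weighted graphs *)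

Section Cheeger.
Variables (R : realFieldType) (T : finType) (C : {set T}).
Variables (w : T -> R) (om : T -> T -> R).
Hypothesis w_gt0 : forall s, s \in C -> 0 < w s.
Hypothesis om_ge0 : forall s s', 0 <= om s s'.
Hypothesis om_sym : forall s s', om s s' = om s' s.

Definition weight (Y : {set T}) : R := \sum_(s in Y) w s.
Definition cut (Y : {set T}) : R := \sum_(s in Y) \sum_(s' in C :\: Y) om s s'.
Definition negative (neg : rel T) (Y : {set T}) : R :=
  \sum_(s in Y) \sum_(s' in Y | neg s s') om s s'.

(* Each edge is counted twice. *)
Definition energy (neg : rel T) (f : T -> R) : R :=
  \sum_(s in C) \sum_(s' in C) om s s' * (f s - (-1) ^+ neg s s' * f s') ^+ 2.

Lemma weight_ge0 (Y : {set T}) : Y \subset C -> 0 <= weight Y.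
Proof. by move=> /subsetP YC; apply: sumr_ge0 => s /YC/w_gt0/ltW. Qed.

Lemma weight_le (Y Z : {set T}) : Y \subset Z -> Z \subset C -> weight Y <= weight Z.
Proof.
move=> YZ ZC; rewrite /weight (big_setID Y (A := Z))/= (setIidPr YZ) lerDl.
by apply: sumr_ge0 => s /setDP[sZ _]; apply/ltW/w_gt0/(subsetP ZC).
Qed.

Lemma weightD (Y : {set T}) : Y \subset C -> weight (C :\: Y) = weight C - weight Y.
Proof.
move=> YC; rewrite /weight [in RHS](big_setID Y)/= (setIidPr YC).
by rewrite addrAC subrr add0r.
Qed.

Lemma energy_ge0 neg f : 0 <= energy neg f.
Proof.
apply: sumr_ge0 => s _; apply: sumr_ge0 => s' _.
by rewrite mulr_ge0 ?sqr_ge0.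
Qed.

(** On indicators, a cut edge counts 1/2 in each of its two orders, as [cut] sees it once, while a
    negative pair inside Y counts fully, as [negative] runs over ordered pairs. *)
Let kappa (b : bool) (x y : R) := 2^-1 * `|x - y| + b%:R * Num.min x y.
Let variation neg (G : T -> R) :=
  \sum_(s in C) \sum_(s' in C) om s s' * kappa (neg s s') (G s) (G s').

Lemma variation_indicator neg (Y : {set T}) : Y \subset C ->
  variation neg (fun s => (s \in Y)%:R) = cut Y + negative neg Y.
Proof.
move=> YC; have cutE : \sum_(s in C) \sum_(s' in C)
    om s s' * ((s \in Y) && (s' \notin Y))%:R = cut Y.
  rewrite (big_setID Y)/= (setIidPr YC) [X in _ + X]big1 ?addr0; last first.
    move=> s /setDP[_ sY]; apply: big1 => s' _; by rewrite (negPf sY) mulr0.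
  apply: eq_bigr => s sY; rewrite (big_setID Y)/= big1 ?add0r; last first.
    by move=> s' /setIP[_ s'Y]; rewrite sY s'Y mulr0.
  by apply: eq_bigr => s' /setDP[_ s'Y]; rewrite sY s'Y mulr1.
have negE : \sum_(s in C) \sum_(s' in C)
    om s s' * ((s \in Y) && (s' \in Y) && neg s s')%:R = negative neg Y.
  rewrite (big_setID Y)/= (setIidPr YC) [X in _ + X]big1 ?addr0; last first.
    move=> s /setDP[_ sY]; apply: big1 => s' _; by rewrite (negPf sY) mulr0.
  apply: eq_bigr => s sY; rewrite (big_setID Y)/= (setIidPr YC) addrC big1 ?add0r; last first.
    by move=> s' /setDP[_ s'Y]; rewrite sY (negPf s'Y) mulr0.
  rewrite [RHS]big_mkcondr; apply: eq_bigr => s' s'Y; rewrite sY s'Y/=.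
  by case: neg; rewrite ?mulr1 ?mulr0.
rewrite -negE -[in RHS]cutE.
have -> : \sum_(s in C) \sum_(s' in C) om s s' * ((s \in Y) && (s' \notin Y))%:R =
    2^-1 * (\sum_(s in C) \sum_(s' in C) om s s' * ((s \in Y) && (s' \notin Y))%:R +
    \sum_(s in C) \sum_(s' in C) om s s' * ((s' \in Y) && (s \notin Y))%:R).
  rewrite [X in _ = _ * (_ + X)]exchange_big/=.
  rewrite [X in _ = _ * (_ + X)](eq_bigr (fun s => \sum_(s' in C)
     om s s' * ((s \in Y) && (s' \notin Y))%:R)); last first.
    by move=> s _; apply: eq_bigr => s' _; rewrite om_sym.
  by field.
rewrite -big_split mulr_sumr -big_split; apply: eq_bigr => s _ /=.
rewrite -big_split mulr_sumr -big_split; apply: eq_bigr => s' _ /=.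
rewrite /kappa; case: (s \in Y); case: (s' \in Y); case: (neg s s') => /=;
  rewrite ?subrr ?subr0 ?sub0r ?normr0 ?normrN ?normr1 ?minxx;
  rewrite ?(min_l (@ler01 R)) ?(min_r (@ler01 R)); by field.
Qed.

(** The factor 4 comes from a negative pair inside Y: it contributes (1 + 1)^2 to the energy and 1
    to [negative]. Without negative pairs the factor is 2, as the next lemma shows. *)
Lemma energy_indicator_le neg (Y : {set T}) : Y \subset C ->
  energy neg (fun s => (s \in Y)%:R) <= 4 * (cut Y + negative neg Y).
Proof.
move=> YC; rewrite -variation_indicator// mulr_sumr; apply: ler_sum => s _.
rewrite mulr_sumr; apply: ler_sum => s' _; rewrite [X in _ <= X]mulrCA ler_wpM2l//.
rewrite /kappa; case: (s \in Y); case: (s' \in Y); case: (neg s s') => /=;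
  rewrite ?subrr ?subr0 ?sub0r ?normr0 ?normrN ?normr1 ?minxx;
  rewrite ?(min_l (@ler01 R)) ?(min_r (@ler01 R)) ?expr0 ?expr1; lra.
Qed.

Lemma energy_indicator (Y : {set T}) : Y \subset C ->
  energy (fun _ _ => false) (fun s => (s \in Y)%:R) = 2 * cut Y.
Proof.
move=> YC; have := variation_indicator (fun _ _ => false) YC.
rewrite /negative [X in _ + X]big1 ?addr0; last first.
  by move=> s _; rewrite big_pred0// => s'; rewrite andbF.
move=> <-; rewrite mulr_sumr; apply: eq_bigr => s _.
rewrite mulr_sumr; apply: eq_bigr => s' _; rewrite [RHS]mulrCA; congr (_ * _).
rewrite /kappa; case: (s \in Y); case: (s' \in Y) => /=;
  rewrite ?subrr ?subr0 ?sub0r ?normr0 ?normrN ?normr1 ?mul1r ?expr0;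
  by field.
Qed.

(** Switching the signs of the edges and of f by the same e changes each difference only by the
    global sign of e s. Pairs of weight 0 are exempt, because signs are controlled only between
    adjacent faces. *)
Lemma energy_switch (neg neg' : rel T) (e : T -> bool) f :
  (forall s s', s \in C -> s' \in C -> om s s' != 0 ->
     neg' s s' = e s (+) e s' (+) neg s s') ->
  energy neg' (fun s => (-1) ^+ e s * f s) = energy neg f.
Proof.
move=> ne; apply: eq_bigr => s sC; apply: eq_bigr => s' s'C.
have [->|os] := eqVneq (om s s') 0; first by rewrite !mul0r.
rewrite ne//; congr (_ * _); case: (e s); case: (e s'); case: (neg s s');
  by rewrite /= ?expr0 ?expr1; ring.
Qed.

(* G is peeled layer by layer, subtracting the smallest positive value on its
   support. *)
Lemma coarea neg h (G : T -> R) :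
  (forall s, s \in C -> 0 <= G s) ->
  (forall Y : {set T}, Y != set0 -> Y \subset [set s in C | 0 < G s] ->
     h * weight Y <= cut Y + negative neg Y) ->
  h * (\sum_(s in C) w s * G s) <= variation neg G.
Proof.
have [n] := ubnP #|[set s in C | 0 < G s]|; elim: n G => // n IHn G.
rewrite ltnS; set Y := [set s in C | 0 < G s] => Yn G0 hY.
have YC : Y \subset C by apply/subsetP => s /setIdP[].
have kge0 b x y : 0 <= x -> 0 <= y -> 0 <= kappa b x y.
  by move=> x0 y0; rewrite addr_ge0 ?mulr_ge0 ?invr_ge0 ?le_min ?x0.
have [Y0|Yneq0] := eqVneq Y set0.
  rewrite big1 ?mulr0; last first.
    move=> s sC; suff -> : G s = 0 by rewrite mulr0.
    apply/le_anti; rewrite G0// andbT leNgt; apply/negP => Gs.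
    by have := in_set0 s; rewrite -Y0 inE sC Gs.
  by apply: sumr_ge0 => s sC; apply: sumr_ge0 => s' s'C; rewrite mulr_ge0 ?kge0 ?G0.
have /set0Pn[s1 s1Y] := Yneq0.
have [s0 s0Y Gmin] : exists2 s0, s0 \in Y & forall s, s \in Y -> G s0 <= G s.
  by case: (arg_minP G s1Y) => s0 ? ?; exists s0.
set m := G s0 in Gmin.
have m0 : 0 < m by have /setIdP[] := s0Y.
pose G' s := if s \in Y then G s - m else 0.
have G'0 s : s \in C -> 0 <= G' s.
  by move=> _; rewrite /G'; case: ifP => // /Gmin; rewrite subr_ge0.
have supp' : [set s in C | 0 < G' s] \proper Y.
  apply/properP; split.
    by apply/subsetP => s /setIdP[_]; rewrite /G'; case: ifP; rewrite ?ltxx.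
  by exists s0 => //; apply/negP => /setIdP[_]; rewrite /G' s0Y subrr ltxx.
have := IHn G' (leq_trans (proper_card supp') Yn) G'0.
have hY' : forall Y : {set T}, Y != set0 -> Y \subset [set s in C | 0 < G' s] ->
     h * weight Y <= cut Y + negative neg Y.
  by move=> Z Z0 ZG; apply: hY => //; apply: subset_trans ZG (proper_sub supp').
move=> /(_ hY') {}IHn.
have GE s : s \in C -> G s = m * (s \in Y)%:R + G' s.
  move=> sC; rewrite /G'; case: ifP => sY; first by rewrite mulr1 addrC subrK.
  rewrite mulr0 add0r; apply/le_anti; rewrite G0// andbT leNgt.
  by apply/negP => Gs; move: sY; rewrite inE sC Gs.
have -> : \sum_(s in C) w s * G s = m * weight Y + \sum_(s in C) w s * G' s.
  rewrite /weight [in RHS]big_mkcond mulr_sumr.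
  rewrite (eq_bigr (fun s => w s * (m * (s \in Y)%:R) + w s * G' s)); last first.
    by move=> s sC; rewrite GE// mulrDr.
  rewrite big_split; congr (_ + _); rewrite big_mkcond; apply: eq_bigr => s _.
  have [sC|sC] := boolP (s \in C); first by case: (s \in Y) => /=; ring.
  by rewrite (contraNF (subsetP YC s) sC) mulr0.
(* [kappa] is positively homogeneous, and additive here because the indicator of Y and G' never
   order a pair in opposite ways. *)
have -> : variation neg G = m * (cut Y + negative neg Y) + variation neg G'.
  rewrite -variation_indicator// /variation mulr_sumr -big_split.
  apply: eq_bigr => s sC; rewrite mulr_sumr -big_split; apply: eq_bigr => s' s'C /=.
  rewrite mulrCA -mulrDr; congr (_ * _).
  have hs t : t \in C -> t \in Y -> m <= G t by move=> _; apply: Gmin.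
  have hn t : t \in C -> t \notin Y -> G t = 0.
    by move=> tC tY; rewrite GE// /G' (negPf tY) mulr0 addr0.
  rewrite /kappa /G'; have [sY|sY] := boolP (s \in Y); have [s'Y|s'Y] := boolP (s' \in Y).
  - rewrite /= subrr normr0 mulr0 add0r minxx.
    have -> : G s - m - (G s' - m) = G s - G s' by ring.
    by have [?|?] := leP (G s) (G s'); have [?|?] := leP (G s - m) (G s' - m); rewrite /=; lra.
  - rewrite (hn _ s'C s'Y) /= !subr0 normr1 (min_r (@ler01 R)) !ger0_norm ?G0//;
      rewrite ?subr_ge0 ?hs// !min_r ?G0 ?subr_ge0 ?hs//; lra.
  - rewrite (hn _ sC sY) /= !sub0r !normrN normr1 (min_l (@ler01 R)) !ger0_norm ?G0//;
      rewrite ?subr_ge0 ?hs// !min_l ?G0 ?subr_ge0 ?hs//; lra.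
  - by rewrite (hn _ sC sY) (hn _ s'C s'Y) subrr normr0 minxx; lra.
by rewrite mulrDr mulrCA lerD// ler_pM2l// hY.
Qed.

Variable d : R.
Hypothesis d_gt0 : 0 < d.
Hypothesis deg_le : forall s, s \in C -> \sum_(s' in C) om s s' <= d * w s.

(** [coarea] for g^2 bounds h M by half the sum of om |g - s g'| (g + g'), where s is the sign of
    the pair. The parameter of the AM-GM inequality below is chosen so that the term with (g +
    g')^2, bounded through the degrees, becomes exactly h M / 2 and is absorbed on the left. *)
Lemma cheeger_core neg h (g : T -> R) : 0 <= h ->
  (forall s, s \in C -> 0 <= g s) ->
  (forall Y : {set T}, Y != set0 -> Y \subset [set s in C | 0 < g s] ->
     h * weight Y <= cut Y + negative neg Y) ->
  h ^+ 2 * (\sum_(s in C) w s * g s ^+ 2) <= d * energy neg g.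
Proof.
rewrite le_eqVlt => /orP[/eqP<-|h0] g0 hY.
  by rewrite expr0n mul0r mulr_ge0 ?energy_ge0 ?ltW.
set M := \sum_(s in C) _.
have hM : h * M <= variation neg (fun s => g s ^+ 2).
  apply: coarea => [s _|Y Y0 YG]; first exact: sqr_ge0.
  apply: hY => //; apply: subset_trans YG _; apply/subsetP => s; rewrite !inE.
  move=> /andP[sC gs]; rewrite sC lt_def g0// andbT.
  by apply: contraTneq gs => ->; rewrite expr0n ltxx.
(* AM-GM with t = 2 d / h: 2 |g - s g'| (g + g') <= t (g - s g')^2 + (g + g')^2 / t. *)
pose t := 2 * d / h; have t0 : 0 < t by rewrite divr_gt0 ?mulr_gt0.
have key : variation neg (fun s => g s ^+ 2) <=
    4^-1 * t * energy neg g + t^-1 * (d * M).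
  apply: (@le_trans _ _ (\sum_(s in C) \sum_(s' in C) (4^-1 * t *
      (om s s' * (g s - (-1) ^+ neg s s' * g s') ^+ 2) +
      2^-1 * t^-1 * (om s s' * g s ^+ 2 + om s s' * g s' ^+ 2)))).
    apply: ler_sum => s sC; apply: ler_sum => s' s'C.
    rewrite [X in _ <= X](_ : _ = om s s' * (4^-1 * t *
      (g s - (-1) ^+ neg s s' * g s') ^+ 2 + 2^-1 * t^-1 * (g s ^+ 2 + g s' ^+ 2))); last by ring.
    rewrite ler_wpM2l//.
    have gs := g0 _ sC; have gs' := g0 _ s'C; set x := g s in gs *; set y := g s' in gs' *.
    set z := x - _ * y.
    (* Equality for a positive pair, by x^2 - y^2 = (x - y) (x + y); for a negative pair [kappa] is
       (x^2 + y^2) / 2 and z = x + y. *)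
    have kz : kappa (neg s s') (x ^+ 2) (y ^+ 2) <= 2^-1 * (`|z| * (x + y)).
      rewrite /kappa /z; case: (neg s s') => /=; rewrite ?mul1r ?mul0r ?addr0.
        rewrite expr1 mulN1r opprK [`|x + y|]ger0_norm ?addr_ge0//.
        by case: (lerP (x ^+ 2) (y ^+ 2)) => xy; nra.
      by rewrite ?expr0 ?mul1r subr_sqr normrM [`|x + y|]ger0_norm ?addr_ge0.
    apply: le_trans kz _.
    have zz : z ^+ 2 = `|z| ^+ 2 by rewrite real_normK ?num_real.
    rewrite zz; set a := `|z|.
    have ag : 2 * (a * (x + y)) <= t * a ^+ 2 + t^-1 * (x + y) ^+ 2.
      have : 0 <= t^-1 * (t * a - (x + y)) ^+ 2 by rewrite mulr_ge0 ?sqr_ge0 ?invr_ge0 ?ltW.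
      have -> : t^-1 * (t * a - (x + y)) ^+ 2 =
          t * a ^+ 2 + t^-1 * (x + y) ^+ 2 - 2 * (a * (x + y)).
        by field; rewrite lt0r_neq0.
      by rewrite subr_ge0.
    have xy2 : t^-1 * (x + y) ^+ 2 <= t^-1 * (2 * (x ^+ 2 + y ^+ 2)).
      by rewrite ler_wpM2l ?invr_ge0 ?(ltW t0)//; have := sqr_ge0 (x - y); nra.
    by lra.
  rewrite (eq_bigr (fun s => 4^-1 * t * (\sum_(s' in C) om s s' *
    (g s - (-1) ^+ neg s s' * g s') ^+ 2) + 2^-1 * t^-1 * (\sum_(s' in C) om s s' * g s ^+ 2
     + \sum_(s' in C) om s s' * g s' ^+ 2))); last first.
    by move=> s _; rewrite big_split/= -!mulr_sumr -big_split.
  rewrite big_split/= -!mulr_sumr lerD2l -mulrA mulrCA ler_wpM2l ?invr_ge0 ?(ltW t0)//.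
  rewrite big_split/= [X in _ * (_ + X)]exchange_big/=.
  rewrite [X in _ * (_ + X)](eq_bigr (fun s => \sum_(s' in C) om s s' * g s ^+ 2)); last first.
    by move=> s _; apply: eq_bigr => s' _; rewrite om_sym.
  have : \sum_(s in C) \sum_(s' in C) om s s' * g s ^+ 2 <= d * M.
    rewrite mulr_sumr; apply: ler_sum => s sC; rewrite -mulr_suml mulrA.
    by rewrite ler_wpM2r ?sqr_ge0 ?deg_le.
  lra.
have := le_trans hM key.
have -> : t^-1 * (d * M) = 2^-1 * (h * M).
  by rewrite /t; field; rewrite !lt0r_neq0.
have -> : 4^-1 * t * energy neg g = 2^-1 * (d * energy neg g / h).
  by rewrite /t; field; rewrite lt0r_neq0.
move=> hh; have : h * M <= d * energy neg g / h by lra.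
by rewrite ler_pdivlMr// => ?; rewrite expr2 -mulrA mulrC.
Qed.

(** Take the least value f s0 above which lies at most half of the weight. If more than half lay
    below it, the largest value f s2 below f s0 would also qualify, since no value lies strictly
    between the two. *)
Lemma median_exists (f : T -> R) : C != set0 ->
  exists m, weight [set s in C | m < f s] <= 2^-1 * weight C /\
            weight [set s in C | f s < m] <= 2^-1 * weight C.
Proof.
move=> /set0Pn[c cC].
have subC (P : pred T) : [set s in C | P s] \subset C by apply/subsetP => s /setIdP[].
have wC : 0 <= 2^-1 * weight C by rewrite mulr_ge0 ?invr_ge0 ?weight_ge0.
pose P s := (s \in C) && (weight [set s' in C | f s < f s'] <= 2^-1 * weight C).
have max_in (A : {set T}) a : a \in A ->
    exists2 s, s \in A & forall s', s' \in A -> f s' <= f s.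
  by move=> aA; case: (arg_maxP f aA) => s ? ?; exists s.
have [smax smaxC fmax] := max_in _ _ cC.
have Pmax : P smax.
  rewrite /P smaxC (_ : [set _ in _ | _] = set0) ?/weight ?big_set0//.
  apply/setP => s; rewrite !inE; apply/negP => /andP[/fmax]; rewrite leNgt.
  by move=> /negPf->.
have [s0 /andP[s0C Ps0] fmin] : exists2 s, P s & forall s', P s' -> f s <= f s'.
  by case: (arg_minP f Pmax) => s ? ?; exists s.
exists (f s0); split=> //; rewrite leNgt; apply/negP => big.
have [s1 s1L] : exists s1, s1 \in [set s in C | f s < f s0].
  apply/set0Pn; apply: contraTneq big => ->.
  by rewrite /weight big_set0 -leNgt.
have [s2 s2L f2max] := max_in _ _ s1L.
have /setIdP[s2C fs2] := s2L.
suff /fmin : P s2 by rewrite leNgt fs2.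
rewrite /P s2C /=; apply: (@le_trans _ _ (weight (C :\: [set s in C | f s < f s0]))).
  apply: weight_le; last by apply/subsetP => s /setDP[].
  apply/subsetP => s /setIdP[sC fs]; rewrite !inE sC /= andbT -leNgt leNgt.
  apply/negP => fs0; have : s \in [set s in C | f s < f s0] by rewrite inE sC.
  by move=> /f2max; rewrite leNgt fs.
by rewrite weightD//; lra.
Qed.

(** Above or below a median the support has at most half of the weight, so the minimum in the
    quotient constant is the weight of Y itself. Subtracting the median m adds m^2 [weight C] to the
    square norm, as f has weighted mean 0, so nothing is lost on the left-hand side. *)
Lemma cheeger_quotient h (f : T -> R) : 0 <= h -> C != set0 ->
  (forall Y : {set T}, Y != set0 -> Y \proper C ->
     h * Num.min (weight Y) (weight (C :\: Y)) <= cut Y) ->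
  \sum_(s in C) w s * f s = 0 ->
  h ^+ 2 * (\sum_(s in C) w s * f s ^+ 2) <= d * energy (fun _ _ => false) f.
Proof.
move=> h0 C0 hY fw; have [m [mgt mlt]] := median_exists f C0.
have wC : 0 < weight C.
  have /set0Pn[c cC] := C0; rewrite /weight (bigD1 c)//= ltr_pwDl ?w_gt0//.
  by apply: sumr_ge0 => s /andP[/w_gt0/ltW].
have half (g : T -> R) : (forall s, s \in C -> 0 <= g s) ->
    weight [set s in C | 0 < g s] <= 2^-1 * weight C ->
    h ^+ 2 * (\sum_(s in C) w s * g s ^+ 2) <= d * energy (fun _ _ => false) g.
  move=> g0 gw; apply: cheeger_core => // Y Y0 YG.
  have GC : [set s in C | 0 < g s] \subset C by apply/subsetP => s /setIdP[].
  have YC := subset_trans YG GC.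
  have Yhalf := le_trans (weight_le YG GC) gw.
  have Yp : Y \proper C.
    rewrite properEneq YC andbT; apply: contraTneq Yhalf => ->.
    by rewrite -ltNge; lra.
  apply: le_trans (_ : cut Y <= _); last first.
    by rewrite lerDl; apply: sumr_ge0 => s _; apply: sumr_ge0.
  by apply: le_trans (hY Y Y0 Yp); rewrite min_l// weightD//; lra.
pose gp s := Num.max (f s - m) 0; pose gm s := Num.max (m - f s) 0.
have hp : h ^+ 2 * (\sum_(s in C) w s * gp s ^+ 2) <= d * energy (fun _ _ => false) gp.
  apply: half => [s _|]; first by rewrite le_max lexx orbT.
  rewrite (_ : [set _ in _ | _] = [set s in C | m < f s])//.
  by apply/setP => s; rewrite !inE lt_max ltxx orbF subr_gt0.
have hm : h ^+ 2 * (\sum_(s in C) w s * gm s ^+ 2) <= d * energy (fun _ _ => false) gm.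
  apply: half => [s _|]; first by rewrite le_max lexx orbT.
  rewrite (_ : [set _ in _ | _] = [set s in C | f s < m])//.
  by apply/setP => s; rewrite !inE lt_max ltxx orbF subr_gt0.
have fM : \sum_(s in C) w s * f s ^+ 2 <=
    \sum_(s in C) w s * gp s ^+ 2 + \sum_(s in C) w s * gm s ^+ 2.
  rewrite -big_split /= [X in _ <= X](eq_bigr (fun s =>
    w s * f s ^+ 2 - 2 * m * (w s * f s) + m ^+ 2 * w s)).
    rewrite big_split sumrB -!mulr_sumr fw mulr0 subr0 lerDl.
    by rewrite mulr_ge0 ?sqr_ge0 ?weight_ge0.
  move=> s _; rewrite /gp /gm.
  by have [?|?] := leP (f s - m) 0; have [?|?] := leP (m - f s) 0; try lra; try ring;
    (have -> : f s = m by lra); ring.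
(* With f - m = gp - gm, the cross term - 2 (gp s - gp s') (gm s - gm s') is nonnegative, since gp
   and gm vary in opposite directions. *)
have fE : energy (fun _ _ => false) gp + energy (fun _ _ => false) gm <=
    energy (fun _ _ => false) f.
  rewrite /energy -big_split; apply: ler_sum => s _ /=.
  rewrite -big_split; apply: ler_sum => s' _ /=.
  rewrite -mulrDr ler_wpM2l// !mul1r /gp /gm.
  by have [?|?] := leP (f s - m) 0; have [?|?] := leP (m - f s) 0;
    have [?|?] := leP (f s' - m) 0; have [?|?] := leP (m - f s') 0; nra.
apply: le_trans (ler_wpM2l (sqr_ge0 h) fM) _.
apply: le_trans (ler_wpM2l (ltW d_gt0) fE).
by rewrite !mulrDr lerD.
Qed.

End Cheeger.

(** * Functions on a component as row vectors *)

Section ComponentVectors.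
Variables (R : realType) (T : finType) (C : {set T}).

Definition vec (f : T -> R) : 'rV[R]_#|C| := \row_i f (enum_val i).

Lemma dotv_vec f f' : dotv (vec f) (vec f') = \sum_(s in C) f s * f' s.
Proof. by rewrite [RHS]big_enum_val; apply: eq_bigr => i _; rewrite !mxE. Qed.

Lemma vec_onto (g : 'rV[R]_#|C|) : C != set0 -> exists f, g = vec f.
Proof.
move=> /set0Pn[s0 s0C]; exists (fun s => g 0 (enum_rank_in s0C s)).
by apply/rowP => i; rewrite mxE enum_valK_in.
Qed.

Lemma eq_vec f f' : (forall s, s \in C -> f s = f' s) -> vec f = vec f'.
Proof. by move=> ff'; apply/rowP => i; rewrite !mxE ff' ?enum_valP. Qed.

End ComponentVectors.
Arguments vec {R T} C f.

(** * Matrices of the form identity minus a normalised signed Laplacian *)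

Section SignedGraph.
Variables (R : realType) (V : finType) (X : {set {set V}}) (k : nat).
Variables (C : {set {set V}}) (adj : rel {set V}) (omega : {set V} -> {set V} -> R).
Variables (diag : {set V} -> R) (off : {set V} -> {set V} -> R) (d : R).

Local Notation w := (fun s => (LP X s)%:R : R).
Local Notation N := (k.+1%:R : R).

Definition edge s s' : R := if adj s s' then omega s s' else 0.

Hypothesis C_neq0 : C != set0.
Hypothesis w_gt0 : forall s, s \in C -> 0 < w s.
Hypothesis adj_sym : symmetric adj.
Hypothesis adj_irr : irreflexive adj.
Hypothesis omega_sym : forall s s', omega s s' = omega s' s.
Hypothesis omega_ge0 : forall s s', 0 <= omega s s'.
Hypothesis d_ge0 : 0 <= d.
Hypothesis deg_le : forall s, s \in C -> \sum_(s' in C) edge s s' <= d * w s.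
Hypothesis diagE : forall s, s \in C ->
  diag s = 1 - (\sum_(s' in C) edge s s') / (N * w s).
Hypothesis offE : forall s s', s \in C -> s' \in C -> s != s' ->
  off s s' = edge s s' / (N * Num.sqrt (w s) * Num.sqrt (w s')).

Lemma edge_sym s s' : edge s s' = edge s' s.
Proof. by rewrite /edge adj_sym omega_sym. Qed.

Lemma edge_ge0 s s' : 0 <= edge s s'.
Proof. by rewrite /edge; case: ifP. Qed.

Lemma edge_irr s : edge s s = 0.
Proof. by rewrite /edge adj_irr. Qed.

Lemma cut_weightE (Y : {set {set V}}) : cut_weight adj omega C Y = cut C edge Y.
Proof. by apply: eq_bigr => s _; rewrite big_mkcondr. Qed.

Lemma neg_weightE (sgn : {set V} -> {set V} -> int) (Y : {set {set V}}) :
  neg_weight adj omega sgn Y = negative edge (fun s s' => sgn s s' == -1) Y.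
Proof.
apply: eq_bigr => s _; rewrite (eq_bigl (fun s' =>
  ((s' \in Y) && (sgn s s' == -1)) && adj s s')); last first.
  by move=> s'; rewrite -andbA [adj _ _ && _]andbC.
by rewrite big_mkcondr.
Qed.

Local Notation sqw := (fun s => Num.sqrt (w s)).

Let sqw_gt0 s : s \in C -> 0 < sqw s.
Proof. by move=> sC; rewrite sqrtr_gt0 w_gt0. Qed.

Let sqwM s : s \in C -> sqw s * sqw s = w s.
Proof. by move=> sC; rewrite -expr2 sqr_sqrtr// ltW ?w_gt0. Qed.

(** The substitution g = f sqrt LP turns the quadratic forms of the symmetric matrices into energies
    of f, with square norm weighted by LP. *)
Lemma vec_sqw_onto (g : 'rV[R]_#|C|) : exists f, g = vec C (fun s => f s * sqw s).
Proof.
have [f ->] := vec_onto g C_neq0; exists (fun s => f s / sqw s).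
by apply: eq_vec => s sC; rewrite divfK// lt0r_neq0// sqw_gt0.
Qed.

Lemma dotv_vec_sqw f : dotv (vec C (fun s => f s * sqw s)) (vec C (fun s => f s * sqw s)) =
  \sum_(s in C) w s * f s ^+ 2.
Proof.
by rewrite dotv_vec; apply: eq_bigr => s sC; rewrite mulrACA sqwM// mulrC expr2.
Qed.

Lemma signed_mx_sym sgn : (forall s s', sgn s s' = sgn s' s) ->
  (signed_mx diag off sgn C)^T = signed_mx diag off sgn C.
Proof.
move=> ssym; apply/matrixP => i j; rewrite !mxE eq_sym.
have [->//|ij] := eqVneq i j.
have eij : enum_val i != enum_val j by rewrite (inj_eq enum_val_inj).
rewrite ssym !offE ?enum_valP// 1?eq_sym// edge_sym.
by congr (- (_ * (_ * _^-1))); ring.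
Qed.

Lemma quot_mxE : quot_mx diag off C = - signed_mx diag off (fun _ _ => 1) C.
Proof.
by apply/matrixP => i j; rewrite !mxE; case: eqP; rewrite opprK ?mul1r.
Qed.

Lemma quot_mx_sym : (quot_mx diag off C)^T = quot_mx diag off C.
Proof. by rewrite quot_mxE linearN/= signed_mx_sym. Qed.

(** In the expanded energy the square terms give 2 f^2 deg, which matches the deficit deg / (N w) of
    the diagonal from 1, and the cross terms give the off-diagonal entries. The 2 in 2 N compensates
    for each edge being counted in both orders. *)
Lemma signed_mx_quad (neg : rel {set V}) sgn f :
  (forall s s', s \in C -> s' \in C -> adj s s' -> sgn s s' = (-1) ^+ neg s s') ->
  dotv (vec C (fun s => f s * sqw s) *m (- signed_mx diag off sgn C))
       (vec C (fun s => f s * sqw s)) =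
  \sum_(s in C) w s * f s ^+ 2 - (2 * N)^-1 * energy C edge neg f.
Proof.
move=> sgnE; have N0 : N != 0 by rewrite pnatr_eq0.
pose deg s := \sum_(s' in C) edge s s'.
have energyE : energy C edge neg f =
    2 * (\sum_(s in C) f s ^+ 2 * deg s) -
    2 * (\sum_(s in C) \sum_(s' in C) edge s' s * (-1) ^+ neg s' s * f s' * f s).
  rewrite [X in _ - 2 * X]exchange_big/=.
  have -> : \sum_(s in C) f s ^+ 2 * deg s =
      2^-1 * (\sum_(s in C) \sum_(s' in C) edge s s' * (f s ^+ 2 + f s' ^+ 2)).
    under [X in _ = _ * X]eq_bigr do (under eq_bigr do rewrite mulrDr; rewrite big_split/=).
    rewrite big_split/= [X in _ = _ * (_ + X)]exchange_big/=.
    rewrite [X in _ = _ * (_ + X)](eq_bigr (fun s => f s ^+ 2 * deg s)); last first.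
      by move=> s _; rewrite mulr_sumr; apply: eq_bigr => s' _; rewrite edge_sym mulrC.
    rewrite [X in _ = _ * (X + _)](eq_bigr (fun s => f s ^+ 2 * deg s)); last first.
      by move=> s _; rewrite mulr_sumr; apply: eq_bigr => s' _; rewrite mulrC.
    by field.
  rewrite mulVKf ?pnatr_eq0// mulr_sumr -sumrB; apply: eq_bigr => s _.
  rewrite mulr_sumr -sumrB; apply: eq_bigr => s' _.
  by rewrite sqrrB exprMn sqrr_sign; ring.
rewrite energyE {energyE}.
have -> : \sum_(s in C) w s * f s ^+ 2 - (2 * N)^-1 *
   (2 * (\sum_(s in C) f s ^+ 2 * deg s) -
    2 * (\sum_(s in C) \sum_(s' in C) edge s' s * (-1) ^+ neg s' s * f s' * f s)) =
   \sum_(s in C) (f s ^+ 2 * w s * diag s +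
      N^-1 * \sum_(s' in C) edge s' s * (-1) ^+ neg s' s * f s' * f s).
  rewrite [RHS](eq_bigr (fun s => w s * f s ^+ 2 - N^-1 * (f s ^+ 2 * deg s) +
     N^-1 * (\sum_(s' in C) edge s' s * (-1) ^+ neg s' s * f s' * f s))).
    by rewrite big_split sumrB/= -!mulr_sumr; field.
  move=> s sC; congr (_ + _); rewrite diagE// /deg; move: (N) N0 => n n0.
  by field; rewrite n0 lt0r_neq0 ?w_gt0.
rewrite [RHS]big_enum_val; apply: eq_bigr => i _.
rewrite ![vec _ _ 0 _]mxE mxE (bigD1 i)//= !mxE eqxx opprK mulrDl.
have iC := enum_valP i; set s := enum_val i in iC *.
congr (_ + _); first by rewrite -[in RHS]sqwM//; ring.
rewrite [in RHS]big_enum_val [in RHS](bigD1 i)//= -/s edge_irr !mul0r add0r.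
rewrite mulr_suml mulr_sumr; apply: eq_bigr => j ji.
have jC := enum_valP j; have sj : enum_val j != s by rewrite (inj_eq enum_val_inj).
rewrite !mxE (negPf ji) opprK -/s offE//; set t := enum_val j in jC sj *.
have [sE|/eqP sE] := eqVneq (edge t s) 0; first by rewrite sE !(mul0r, mulr0).
have st : adj t s by move: sE; rewrite /edge; case: ifP.
have -> : (sgn t s)%:~R = (-1) ^+ neg t s :> R.
  by rewrite sgnE// rmorphXn/= rmorphN1.
have qs := lt0r_neq0 (sqw_gt0 iC); have qt := lt0r_neq0 (sqw_gt0 jC).
move: (N) N0 (Num.sqrt (LP X s)%:R) qs (Num.sqrt (LP X t)%:R) qt => n n0 a a0 b b0.
by move: (edge t s) ((-1) ^+ _) (f s) (f t) => e c x y; field; rewrite n0 a0 b0.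
Qed.

Lemma top_on_le1 phi M a : (forall g : 'rV[R]_#|C|, dotv (g *m M) g <= dotv g g) ->
  top_on phi M a -> a <= 1.
Proof.
move=> M1 [[g g0 [_ gM]] _]; have := M1 g.
by rewrite gM dotvZl -[X in _ <= X]mul1r ler_pM2r ?dotvv_gt0.
Qed.

Lemma sum_w_neq0 f : vec C (fun s => f s * sqw s) != 0 ->
  0 < \sum_(s in C) w s * f s ^+ 2.
Proof. by rewrite -dotv_vec_sqw dotvv_gt0. Qed.

Section Sign.
Variables (neg : rel {set V}) (sgn : {set V} -> {set V} -> int).
Hypothesis sgnE : forall s s', s \in C -> s' \in C -> adj s s' ->
  sgn s s' = (-1) ^+ neg s s'.
Local Notation S := (signed_mx diag off sgn C).

Lemma signed_mx_le1 g : dotv (g *m (- S)) g <= dotv g g.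
Proof.
have [f ->] := vec_sqw_onto g.
rewrite (signed_mx_quad _ sgnE) dotv_vec_sqw gerBl mulr_ge0 ?invr_ge0 ?mulr_ge0//.
exact/energy_ge0/edge_ge0.
Qed.

Lemma eigen_energy a f : vec C (fun s => f s * sqw s) *m (- S) =
    a *: vec C (fun s => f s * sqw s) ->
  (1 - a) * (\sum_(s in C) w s * f s ^+ 2) = (2 * N)^-1 * energy C edge neg f.
Proof.
move=> fS; have := signed_mx_quad f sgnE; rewrite fS dotvZl dotv_vec_sqw mulrBl mul1r.
by move=> ->; rewrite opprB addrC subrK.
Qed.

Lemma energy_eq0 f : energy C edge neg f = 0 ->
  forall s s', s \in C -> s' \in C -> edge s s' != 0 -> f s = (-1) ^+ neg s s' * f s'.
Proof.
move=> /eqP; have te s s' : 0 <= edge s s' * (f s - (-1) ^+ neg s s' * f s') ^+ 2.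
  by rewrite mulr_ge0 ?sqr_ge0 ?edge_ge0.
rewrite psumr_eq0 => [/allP E s s' sC s'C ss'|s _]; last exact: sumr_ge0.
have := E s (mem_index_enum _); rewrite sC psumr_eq0 => [/allP/(_ s' (mem_index_enum _))|//].
by rewrite s'C mulf_eq0 (negPf ss')/= sqrf_eq0 subr_eq0 => /eqP.
Qed.

(** Eigenvalue 1 means zero energy, so the eigenfunction is transported along edges up to sign.
    Connectivity and incoherence will contradict this. *)
Lemma top_on_eq1 phi : top_on phi (- S) 1 -> exists f,
  [/\ dotv (vec C (fun s => f s * sqw s)) phi = 0, exists2 s, s \in C & f s != 0 &
   forall s s', s \in C -> s' \in C -> edge s s' != 0 -> f s = (-1) ^+ neg s s' * f s'].
Proof.
move=> [[g]]; have [f ->] := vec_sqw_onto g => f0 [fphi fS] _; exists f; split=> //.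
  apply/exists_inP; apply: contraNT f0; rewrite negb_exists_in => /forall_inP f0.
  apply/eqP/rowP => i; rewrite !mxE; have := f0 _ (enum_valP i).
  by rewrite negbK => /eqP->; rewrite mul0r.
apply: energy_eq0; apply/eqP; have := eigen_energy fS.
by rewrite subrr mul0r => /esym/eqP; rewrite mulf_eq0 invr_eq0 mulf_eq0 !pnatr_eq0.
Qed.

End Sign.

Lemma quot_mx_quad f :
  dotv (vec C (fun s => f s * sqw s) *m quot_mx diag off C)
       (vec C (fun s => f s * sqw s)) =
  \sum_(s in C) w s * f s ^+ 2 - (2 * N)^-1 * energy C edge (fun _ _ => false) f.
Proof. by rewrite quot_mxE (signed_mx_quad (neg := fun _ _ => false)). Qed.

Lemma quot_mx_le1 g : dotv (g *m quot_mx diag off C) g <= dotv g g.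
Proof. by rewrite quot_mxE (signed_mx_le1 (neg := fun _ _ => false)). Qed.

(** This is the constant function f = 1: the off-diagonal entries restore the degree subtracted on
    the diagonal. *)
Lemma quot_mx_sqw : vec C sqw *m quot_mx diag off C = vec C sqw.
Proof.
apply/rowP => i; rewrite mxE (bigD1 i)//= !mxE eqxx.
have iC := enum_valP i; set s := enum_val i in iC *.
rewrite diagE// mulrBr mulr1 -[RHS]addr0 -addrA; congr (_ + _).
have -> : \sum_(s' in C) edge s s' = \sum_(j < #|C| | j != i) edge s (enum_val j).
  by rewrite big_enum_val (bigD1 i)//= edge_irr add0r.
rewrite addrC mulr_suml mulr_sumr; apply/eqP; rewrite subr_eq0; apply/eqP.
apply: eq_bigr => j ji.
have jC := enum_valP j; have sj : enum_val j != s by rewrite (inj_eq enum_val_inj).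
rewrite !mxE (negPf ji) -/s offE//; set t := enum_val j in jC sj *.
have qs := lt0r_neq0 (sqw_gt0 iC); have qt := lt0r_neq0 (sqw_gt0 jC).
have N0 : N != 0 by rewrite pnatr_eq0.
rewrite -[X in _ / (N * X)]sqwM// edge_sym.
move: (N) N0 (Num.sqrt (LP X s)%:R) qs (Num.sqrt (LP X t)%:R) qt => n n0 a a0 b b0.
by move: (edge _ _) => e; field; rewrite n0 a0 ?b0.
Qed.

(* A vanishing [d] is harmless since the bound is then [h ^+ 2 / 0 = 0]. *)
Lemma lower_bound_of_energy neg h a f :
  a <= 1 -> 0 < \sum_(s in C) w s * f s ^+ 2 ->
  (0 < d -> h ^+ 2 * (\sum_(s in C) w s * f s ^+ 2) <= d * energy C edge neg f) ->
  (1 - a) * (\sum_(s in C) w s * f s ^+ 2) = (2 * N)^-1 * energy C edge neg f ->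
  h ^+ 2 / d / (2 * N) <= 1 - a.
Proof.
move=> a1 f0 dh af; have N0 : 0 < 2 * N by rewrite mulr_gt0 ?ltr0n.
have [d0|dN] := eqVneq d 0; first by rewrite d0 invr0 mulr0 mul0r subr_ge0.
have d0 : 0 < d by rewrite lt_def dN.
have hE : h ^+ 2 / d * (\sum_(s in C) w s * f s ^+ 2) <= energy C edge neg f.
  by rewrite mulrAC ler_pdivrMr// [X in _ <= X]mulrC dh.
by rewrite -(ler_pM2r f0) af mulrAC [X in _ <= X]mulrC ler_wpM2r ?invr_ge0 ?(ltW N0).
Qed.

Lemma cheeger_quot_le Y : Y != set0 -> Y \proper C ->
  cheeger_quot X adj omega C <= cut C edge Y / Num.min (weight w Y) (weight w (C :\: Y)).
Proof.
move=> Y0 YC; apply: ge_inf; last by exists Y; rewrite cut_weightE.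
exists 0 => _ [Z [Z0 ZC ->]]; rewrite cut_weightE divr_ge0 ?le_min//.
  by apply: sumr_ge0 => s _; apply: sumr_ge0 => s' _; apply: edge_ge0.
by rewrite !sumr_ge0.
Qed.

(** Orthogonality to sqrt LP says that the eigenfunction has weighted mean 0, as [cheeger_quotient]
    requires. For the upper bound, a centred indicator of Y has energy 2 cut(Y) and square norm w(Y)
    w(C - Y) / w(C), which is at least half of the smaller of the two weights; this half is the
    factor 2 in 2 h / N. *)
Lemma top_on_quot_bounds a : (1 < #|C|)%N ->
  top_on (vec C sqw) (quot_mx diag off C) a ->
  cheeger_quot X adj omega C ^+ 2 / d / (2 * N) <= 1 - a /\
  1 - a <= 2 * cheeger_quot X adj omega C / N.
Proof.
move=> C1 aP; have [[g g0 [gphi gA]] atop] := aP.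
have a1 : a <= 1 by apply: top_on_le1 aP; apply: quot_mx_le1.
have cut_ge0 Y : 0 <= cut C edge Y.
  by apply: sumr_ge0 => s _; apply: sumr_ge0 => s' _; apply: edge_ge0.
have wpos Y : Y != set0 -> Y \subset C -> 0 < weight w Y.
  move=> /set0Pn[s sY] /subsetP YC; rewrite /weight (bigD1 s)//= ltr_pwDl ?w_gt0 ?YC//.
  by apply: sumr_ge0 => t /andP[tY _]; rewrite ltW ?w_gt0 ?YC.
have minpos Y : Y != set0 -> Y \proper C ->
    0 < Num.min (weight w Y) (weight w (C :\: Y)).
  move=> Y0 YC; rewrite lt_min !wpos ?subsetDl//; last exact: proper_sub.
  by rewrite setD_eq0 properE in YC *; case/andP: YC.
have [s0 s0C] := set0Pn _ C_neq0.
have Y1 : [set s0] != set0 by rewrite -card_gt0 cards1.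
have Y1C : [set s0] \proper C by rewrite properEcard sub1set s0C cards1.
split.
  have [f gE] := vec_sqw_onto g; rewrite gE in g0 gphi gA.
  apply: (@lower_bound_of_energy (fun _ _ => false) _ _ f) => //.
  - exact: sum_w_neq0.
  - move=> d0; apply: (cheeger_quotient (w := w)) => //.
    + exact: edge_ge0.
    + exact: edge_sym.
    + apply: lb_le_inf; first by eexists; exists [set s0].
      move=> _ [Y [Y0 YC ->]]; rewrite cut_weightE divr_ge0// ltW//.
      exact: minpos.
    + move=> Y Y0 YC; rewrite -ler_pdivlMr; last exact: minpos.
      exact: cheeger_quot_le.
    + apply: etrans gphi; rewrite dotv_vec; apply: eq_bigr => s sC.
      by rewrite -mulrA sqwM// mulrC.
  - by apply: (@eigen_energy _ (fun _ _ => 1)) => //; rewrite -quot_mxE.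
have N0 : 0 < N by rewrite ltr0n.
rewrite ler_pdivlMr// -ler_pdivrMl//; apply: lb_le_inf; first by eexists; exists [set s0].
move=> _ [Y [Y0 YC ->]]; rewrite cut_weightE -/(weight w Y) -/(weight w (C :\: Y)).
have YC' := proper_sub YC; have mp := minpos _ Y0 YC.
rewrite ler_pdivlMr//.
(* c is the weighted mean of the indicator, so that f is orthogonal to sqrt LP. *)
pose c := weight w Y / weight w C; pose f s : R := (s \in Y)%:R - c.
have wC : 0 < weight w C by apply: wpos.
have wYE : \sum_(s in C) w s * (s \in Y)%:R = weight w Y.
  rewrite (big_setID Y)/= (setIidPr YC') [X in _ + X]big1 ?addr0.
    by apply: eq_bigr => s sY; rewrite sY mulr1.
  by move=> s /setDP[_ /negPf->]; rewrite mulr0.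
have := atop (vec C (fun s => f s * sqw s)); rewrite quot_mx_quad dotv_vec_sqw.
have fphi : dotv (vec C (fun s => f s * sqw s)) (vec C sqw) = 0.
  rewrite dotv_vec (eq_bigr (fun s => w s * (s \in Y)%:R - c * w s)); last first.
    by move=> s sC; rewrite -mulrA sqwM// /f; ring.
  by rewrite sumrB -mulr_sumr wYE /c divfK ?subrr// lt0r_neq0.
move=> /(_ fphi).
have -> : energy C edge (fun _ _ => false) f = 2 * cut C edge Y.
  rewrite -energy_indicator//; last exact: edge_sym.
  apply: eq_bigr => s _; apply: eq_bigr => s' _; rewrite /f expr0 !mul1r.
  by congr (_ * _ ^+ 2); ring.
have -> : \sum_(s in C) w s * f s ^+ 2 = weight w Y * weight w (C :\: Y) / weight w C.
  rewrite (eq_bigr (fun s => (1 - 2 * c) * (w s * (s \in Y)%:R) + c ^+ 2 * w s)).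
    rewrite big_split/= -!mulr_sumr wYE weightD// -/(weight w C) /c.
    by field; rewrite lt0r_neq0.
  by move=> s sC; rewrite /f; case: (s \in Y); rewrite /=; ring.
move=> H; set m := Num.min _ _ in mp *.
have mle : 2^-1 * m <= weight w Y * weight w (C :\: Y) / weight w C.
  rewrite ler_pdivlMr// weightD//; have wYC : 0 <= weight w (C :\: Y).
    by rewrite /weight sumr_ge0.
  have wY : 0 <= weight w Y by rewrite ltW ?wpos.
  rewrite /m weightD//; rewrite weightD// in wYC.
  move: (weight w Y) (weight w C) wY wYC => x y x0 yx0.
  by case: (leP x (y - x)) => h; nra.
have H2 : (1 - a) * (weight w Y * weight w (C :\: Y) / weight w C) <= N^-1 * cut C edge Y.
  move: H; have -> : (2 * N)^-1 * (2 * cut C edge Y) = N^-1 * cut C edge Y.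
    by rewrite invfM mulrACA mulVf ?mul1r// pnatr_eq0.
  rewrite mulrBl mul1r lerBlDr addrC -lerBlDr => H; exact: H.
have a0 : 0 <= 1 - a by rewrite subr_ge0.
have := le_trans (ler_wpM2l a0 mle) H2.
rewrite -(ler_pM2l N0) [X in _ <= X]mulrA divff ?lt0r_neq0// mul1r.
by apply: le_trans; rewrite le_eqVlt; apply/orP; left; apply/eqP; ring.
Qed.

Section Switching.
Variable sgn : face_choice V -> {set V} -> {set V} -> int.
Hypothesis sgnE : forall O s s', sgn O s s' = (-1) ^+ (sgn O s s' == -1).
Hypothesis sgn_orient : forall O Q, orientation X O -> orientation X Q ->
  exists e : {set V} -> bool, forall s s', s \in C -> s' \in C -> adj s s' ->
    (sgn Q s s' == -1) = e s (+) e s' (+) (sgn O s s' == -1).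
Hypothesis sgn_switch : forall O (e : {set V} -> bool), orientation X O ->
  exists2 Q, orientation X Q & forall s s', s \in C -> s' \in C -> adj s s' ->
    (sgn Q s s' == -1) = e s (+) e s' (+) (sgn O s s' == -1).

Local Notation h := (cheeger_signed X adj omega sgn C).

(** The constant h also minimises over orientations, while the matrix belongs to the given O;
    switching reconciles the two. For the lower bound the orientation is changed to turn the
    eigenfunction into its absolute value. For the upper bound the indicator of Y is switched from Q
    to O, and the factor 4 of [energy_indicator_le] over 2 N gives 2 / N. *)
Lemma top_on_signed_bounds O a : orientation X O ->
  top_on 0 (- signed_mx diag off (sgn O) C) a ->
  h ^+ 2 / d / (2 * N) <= 1 - a /\ 1 - a <= 2 * h / N.
Proof.
move=> XO aP; have [[g g0 [_ gA]] atop] := aP.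
pose neg O s s' := sgn O s s' == -1.
have negE Q s s' : s \in C -> s' \in C -> adj s s' -> sgn Q s s' = (-1) ^+ neg Q s s'.
  by move=> *; apply: sgnE.
have a1 : a <= 1 by apply: top_on_le1 aP; apply: signed_mx_le1 (negE O).
have num_ge0 Q Y : 0 <= cut C edge Y + negative edge (neg Q) Y.
  by rewrite addr_ge0// sumr_ge0// => s _; rewrite sumr_ge0// => s' _; apply: edge_ge0.
have wpos Y : Y != set0 -> Y \subset C -> 0 < weight w Y.
  move=> /set0Pn[s sY] /subsetP YC; rewrite /weight (bigD1 s)//= ltr_pwDl ?w_gt0 ?YC//.
  by apply: sumr_ge0 => t /andP[tY _]; rewrite ltW ?w_gt0 ?YC.
have edge_adj s s' : edge s s' != 0 -> adj s s' by rewrite /edge; case: ifP; rewrite ?eqxx.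
split.
  have [f gE] := vec_sqw_onto g; rewrite gE in g0 gA.
  apply: (@lower_bound_of_energy (neg O) _ _ f) => //.
  - exact: sum_w_neq0.
  - move=> d0; pose e s := f s < 0.
    have [Q XQ OQ] := sgn_switch e XO.
    have absE s : (-1) ^+ e s * f s = `|f s|.
      rewrite /e; have [f0|f0] := ltP (f s) 0; first by rewrite expr1 mulN1r ltr0_norm.
      by rewrite expr0 mul1r ger0_norm.
    rewrite -(@energy_switch _ _ _ _ (neg O) (neg Q) e); last first.
      by move=> s s' sC s'C /edge_adj; apply: OQ.
    rewrite (eq_bigr (fun s => w s * ((-1) ^+ e s * f s) ^+ 2)); last first.
      by move=> s _; rewrite exprMn sqrr_sign mul1r.
    apply: (cheeger_core (w := w)) => //.
    + exact: edge_ge0.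
    + exact: edge_sym.
    + apply: lb_le_inf.
        by eexists; exists C, O.
      move=> _ [Y [Q1 [Y0 YC _ ->]]]; rewrite cut_weightE neg_weightE.
      by rewrite divr_ge0 ?num_ge0// ltW// wpos.
    + by move=> s _; rewrite absE.
    + move=> Y Y0 YG.
      have YC : Y \subset C by apply: subset_trans YG _; apply/subsetP => s /setIdP[].
      rewrite -ler_pdivlMr ?wpos//; apply: ge_inf.
        exists 0 => _ [Z [Q1 [Z0 ZC _ ->]]]; rewrite cut_weightE neg_weightE.
        by rewrite divr_ge0 ?num_ge0// ltW// wpos.
      by exists Y, Q; rewrite cut_weightE neg_weightE.
  - by apply: (@eigen_energy (neg O) (sgn O)) => //; apply: negE.
have N0 : 0 < N by rewrite ltr0n.
rewrite ler_pdivlMr// -ler_pdivrMl//; apply: lb_le_inf; first by eexists; exists C, O.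
move=> _ [Y [Q [Y0 YC XQ ->]]]; rewrite cut_weightE neg_weightE -/(neg Q) -[mu R X Y]/(weight w Y).
rewrite ler_pdivlMr ?wpos//.
have [e OQ] := sgn_orient XQ XO.
(* Its energy for the signs of O is that of the indicator of Y for the signs of Q. *)
pose f s : R := (-1) ^+ e s * (s \in Y)%:R.
have := atop (vec C (fun s => f s * sqw s)); rewrite (signed_mx_quad _ (negE O)) dotv_vec_sqw.
rewrite dotvC dot0v => /(_ erefl).
rewrite (energy_switch (neg := neg Q)); last by move=> s s' sC s'C /edge_adj; apply: OQ.
have -> : \sum_(s in C) w s * f s ^+ 2 = weight w Y.
  rewrite (big_setID Y)/= (setIidPr YC) [X in _ + X]big1 ?addr0.
    by apply: eq_bigr => s sY; rewrite /f sY mulr1 sqrr_sign mulr1.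
  by move=> s /setDP[_ /negPf sY]; rewrite /f sY mulr0 expr0n mulr0.
have := energy_indicator_le edge_ge0 edge_sym (neg Q) YC.
move: (energy _ _ _ _) (cut _ _ _ + _) (weight w Y) => E c y Ec.
rewrite lerBlDr -lerBlDl => H.
have H2 : N * (y - a * y) <= 2 * c.
  apply: (@le_trans _ _ (2^-1 * E)); last by lra.
  apply: le_trans (ler_wpM2l (ltW N0) H) _.
  by rewrite mulrA invfM mulrCA mulfV ?mulr1// lt0r_neq0.
lra.
Qed.

End Switching.
End SignedGraph.

(** * Components of a simplicial complex *)

Section Faces.
Variables (V : finType) (X : {set {set V}}).
Hypothesis HX : simplicial_complex X.

Lemma nonleaf_coface s : s \in X -> ~~ leaf X s ->
  exists2 t, t \in nfaces X #|s|.+1 & s \subset t.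
Proof.
case: HX => X0 _ Xcl sX; rewrite /leaf sX /= negb_forall_in => /exists_inP[t tX].
rewrite negbK => /properP[st [x xt xs]]; exists (x |: s); last exact: subsetU1.
rewrite inE cardsU1 xs add1n eqxx andbT; apply: (Xcl _ t) => //.
  by apply/set0Pn; exists x; rewrite setU11.
by rewrite subUset sub1set xt.
Qed.

Lemma LP_gt0 s : s \in X -> (0 < LP X s)%N.
Proof.
rewrite /LP; elim: #|V| s => //= n IHn s sX; case: ifP => // /negbT sl.
have [t tX st] := nonleaf_coface sX sl.
rewrite (bigD1 t) ?tX//= addn_gt0 IHn//.
by case/setIdP: tX.
Qed.

(** The union of two distinct sets of n elements has more than n, so an (n+1)-set containing both
    equals it. Hence two faces have at most one common coface, and an off-diagonal entry of B B^T is
    a single term. The next lemma is the dual for B^T B. *)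
Lemma facet_union n s s' t : s \in nfaces X n -> s' \in nfaces X n ->
  t \in nfaces X n.+1 -> s != s' -> (s \subset t) && (s' \subset t) = (t == s :|: s').
Proof.
move=> /setIdP[_ /eqP cs] /setIdP[_ /eqP cs'] /setIdP[_ /eqP ct] ss'.
rewrite -subUset; apply/idP/eqP => [sst|->//]; apply/esym/eqP.
rewrite eqEcard sst ct -cs; apply: proper_card; rewrite properE subsetUl subUset subxx/=.
by apply: contra ss' => s's; rewrite eq_sym eqEcard s's cs cs' leqnn.
Qed.

Lemma coface_inter n t t' s : t \in nfaces X n.+1 -> t' \in nfaces X n.+1 ->
  s \in nfaces X n -> t != t' -> (s \subset t) && (s \subset t') = (s == t :&: t').
Proof.
move=> /setIdP[_ /eqP ct] /setIdP[_ /eqP ct'] /setIdP[_ /eqP cs] tt'.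
rewrite -subsetI; apply/idP/eqP => [sst|->//]; apply/eqP.
rewrite eqEcard sst cs -ltnS -ct; apply: proper_card; rewrite properE subsetIl subsetI subxx/=.
by apply: contra tt' => t't; rewrite eqEcard t't ct ct' leqnn.
Qed.

(** The facets are the sets [t :\ x] for x in t; n > 0 keeps them nonempty, hence faces. *)
Lemma card_facets n t : (0 < n)%N -> t \in nfaces X n.+1 ->
  #|[set s in nfaces X n | s \subset t]| = n.+1.
Proof.
case: HX => X0 _ Xcl n0 /setIdP[tX /eqP ct].
have -> : [set s in nfaces X n | s \subset t] = [set t :\ x | x in t].
  apply/setP => s; apply/setIdP/imsetP => [[/setIdP[sX /eqP cs] st]|[x xt ->]].
    have /properP[_ [x xt xs]] : s \proper t by rewrite properEcard st cs ct ltnSn.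
    exists x => //; apply/eqP; rewrite eqEcard subsetD1 st xs /= cs.
    by have := cardsD1 x t; rewrite ct xt add1n => -[<-].
  have cx : #|t :\ x| = n by move: ct; rewrite (cardsD1 x) xt add1n => -[].
  rewrite subD1set inE cx eqxx andbT; split=> //; apply: (Xcl _ t) => //.
    by rewrite -card_gt0 cx.
  exact: subD1set.
rewrite card_in_imset ?ct// => x y xt yt /setP/(_ x).
by rewrite !inE eqxx xt !andbT /= => /esym/negbFE/eqP.
Qed.

End Faces.

(** * A quotient-up-component and its cofaces *)

Section Component.
Variables (V : finType) (X : {set {set V}}) (k : nat) (C : {set {set V}}).
Hypothesis HX : simplicial_complex X.
Hypothesis k_gt0 : (0 < k)%N.
Hypothesis HC : up_component X k C.
Hypothesis C_ge2 : (2 <= #|C|)%N.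
Local Notation D := (down_of X k C).

Lemma component_sub : C \subset nfaces X k.
Proof. by have /maxsetp/andP[] := HC. Qed.

Lemma component_faces s : s \in C -> s \in nfaces X k.
Proof. exact/subsetP/component_sub. Qed.

Lemma component_connected s s' : s \in C -> s' \in C ->
  connect [rel x y | [&& x \in C, y \in C & up_adj X k x y]] s s'.
Proof.
move=> sC s'C; have /maxsetp/andP[_ /andP[_]] := HC.
by move=> /forall_inP/(_ s sC)/forall_inP/(_ s' s'C).
Qed.

Lemma up_adj_sym : symmetric (up_adj X k).
Proof.
by move=> s s'; rewrite /up_adj /= setUC eq_sym; case: (s \in _); case: (s' \in _).
Qed.

Lemma down_adj_sym : symmetric (down_adj X k).
Proof.
by move=> s s'; rewrite /down_adj /= setIC eq_sym; case: (s \in _); case: (s' \in _).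
Qed.

(** By maximality: in [s' |: C] every face still reaches s, so this set is connected and equals
    C. *)
Lemma component_closed s s' : s \in C -> up_adj X k s s' -> s' \in C.
Proof.
move=> sC ss'; pose e := [rel x y | [&& x \in s' |: C, y \in s' |: C & up_adj X k x y]].
have esym : connect_sym e.
  by apply: sym_connect_sym => x y; rewrite /e /= up_adj_sym; case: (x \in _); case: (y \in _).
have sub x y : x \in C -> y \in C -> connect e x y.
  move=> xC yC; apply: connect_sub (component_connected xC yC) => u v /and3P[uC vC uv].
  by apply: connect1; rewrite /e /= !inE uC vC uv !orbT.
have s's : connect e s' s.
  by apply: connect1; rewrite /e /= setU11 setU1r //= up_adj_sym.
have [_ maxC] := maxsetP HC.
rewrite -(maxC (s' |: C)); first exact: setU11; last exact: subsetU1.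
apply/andP; split.
  rewrite subUset component_sub andbT sub1set.
  by case/and4P: ss'.
apply/andP; split; first by apply/set0Pn; exists s'; rewrite setU11.
apply/forall_inP => x xC'; apply/forall_inP => y yC'.
have toS z : z \in s' |: C -> connect e z s.
  by case/setU1P => [->//|zC]; apply: sub.
by apply: connect_trans (toS x xC') _; rewrite esym toS.
Qed.

Lemma down_of_faces t : t \in D -> t \in nfaces X k.+1.
Proof. by case/setIdP. Qed.

Lemma mem_down_of s t : s \in C -> t \in nfaces X k.+1 -> s \subset t -> t \in D.
Proof. by move=> sC tX st; rewrite inE tX; apply/exists_inP; exists s. Qed.

(** Two distinct facets of t have union t and are thus up-adjacent. So all facets of a face of D lie
    in C, and sums over the facets of t may be taken over C. *)
Lemma facet_component s t : s \in nfaces X k -> t \in D -> s \subset t -> s \in C.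
Proof.
move=> sX tD st; have tX := down_of_faces tD.
move: tD; rewrite inE tX /= => /exists_inP[r rC rt].
have [<-//|rs] := eqVneq r s; apply: (component_closed rC).
have rX := component_faces rC; rewrite /up_adj /= rX sX rs /=.
by have := facet_union rX sX tX rs; rewrite rt st => /esym/eqP <-.
Qed.

Lemma component_neighbor s : s \in C -> exists2 s', s' \in C & up_adj X k s s'.
Proof.
move=> sC; have [s' s'C s's] : exists2 s', s' \in C & s' != s.
  have : (0 < #|C :\ s|)%N by move: C_ge2; rewrite (cardsD1 s) sC.
  by rewrite card_gt0 => /set0Pn[s' /setD1P[]]; exists s'.
have /connectP[p] := component_connected sC s'C.
case: p => [_ s'E|s1 p /= /andP[/and3P[_ s1C ss1] _] _].
  by move: s's; rewrite s'E eqxx.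
by exists s1.
Qed.

Lemma component_nonleaf s : s \in C -> ~~ leaf X s.
Proof.
move=> sC; have [s' s'C /and4P[sX s'X ss' uX]] := component_neighbor sC.
rewrite negb_and negb_forall_in; apply/orP; right; apply/exists_inP; exists (s :|: s').
  by case/setIdP: uX.
rewrite negbK properEcard subsetUl; case/setIdP: uX => _ /eqP->.
by case/setIdP: sX => _ /eqP->; rewrite ltnSn.
Qed.

Lemma LP_component s : s \in C -> LP X s = (\sum_(t in D | s \subset t) LP X t)%N.
Proof.
move=> sC; have /setIdP[sX /eqP cs] := component_faces sC.
rewrite LP_nonleaf ?component_nonleaf// cs; apply: eq_bigl => t.
apply/andP/andP => -[tX st]; split=> //; first exact: mem_down_of st.
exact: down_of_faces.
Qed.

Lemma LP_component_gt0 s : s \in C -> (0 < LP X s)%N.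
Proof. by move=> /component_faces/setIdP[sX _]; apply: LP_gt0. Qed.

Lemma LP_down_gt0 t : t \in D -> (0 < LP X t)%N.
Proof. by move=> /down_of_faces/setIdP[tX _]; apply: LP_gt0. Qed.

Section Sums.
Variable R : pzRingType.

Lemma sum_common_coface s s' (F : {set V} -> R) : s \in C -> s' \in C -> s != s' ->
  \sum_(t in D) (if (s \subset t) && (s' \subset t) then F t else 0) =
  if up_adj X k s s' then F (s :|: s') else 0.
Proof.
move=> sC s'C ss'; have sX := component_faces sC; have s'X := component_faces s'C.
have adjE : up_adj X k s s' = (s :|: s' \in nfaces X k.+1) by rewrite /up_adj /= sX s'X ss'.
rewrite adjE; case: ifP => uX.
  have uD : s :|: s' \in D := mem_down_of sC uX (subsetUl _ _).
  rewrite (bigD1 _ uD)/= !(subsetUl, subsetUr) big1 ?addr0// => t /andP[tD tu].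
  by rewrite (facet_union sX s'X (down_of_faces tD) ss') (negPf tu).
apply: big1 => t tD; have tX := down_of_faces tD.
rewrite (facet_union sX s'X tX ss'); case: eqP => // tE.
by rewrite -tE tX in uX.
Qed.

Lemma sum_common_facet t t' (F : {set V} -> R) : t \in D -> t' \in D -> t != t' ->
  \sum_(s in C) (if (s \subset t) && (s \subset t') then F s else 0) =
  if down_adj X k t t' then F (t :&: t') else 0.
Proof.
move=> tD t'D tt'; have tX := down_of_faces tD; have t'X := down_of_faces t'D.
have adjE : down_adj X k t t' = (t :&: t' \in nfaces X k) by rewrite /down_adj /= tX t'X tt'.
rewrite adjE; case: ifP => uX.
  have uC : t :&: t' \in C by apply: facet_component tD _; rewrite ?subsetIl.
  rewrite (bigD1 _ uC)/= !(subsetIl, subsetIr) big1 ?addr0// => s /andP[sC su].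
  by rewrite (coface_inter tX t'X (component_faces sC) tt') (negPf su).
apply: big1 => s sC; have sX := component_faces sC.
rewrite (coface_inter tX t'X sX tt'); case: eqP => // sE.
by rewrite -sE sX in uX.
Qed.

Lemma sum_facets t (a : R) : t \in D ->
  \sum_(s in C) (if s \subset t then a else 0) = k.+1%:R * a.
Proof.
move=> tD; rewrite -big_mkcondr /= sumr_const mulr_natl; congr (_ *+ _).
rewrite -(card_facets HX k_gt0 (down_of_faces tD)) cardsE; apply: eq_card => s.
rewrite [LHS]/in_mem/= [RHS]/in_mem/=; apply/andP/andP => -[sC st]; split=> //.
  exact: component_faces.
exact: facet_component tD st.
Qed.

Lemma sum_cofaces s : s \in C ->
  \sum_(t in D) (if s \subset t then (LP X t)%:R else 0) = (LP X s)%:R :> R.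
Proof. by move=> sC; rewrite (LP_component sC) natr_sum big_mkcondr. Qed.

End Sums.

End Component.

(** * Gram factorisation of the up and down matrices *)

Section Gram.
Variables (R : realType) (V : finType) (X : {set {set V}}) (k : nat) (C : {set {set V}}).
Hypothesis HX : simplicial_complex X.
Hypothesis k_gt0 : (0 < k)%N.
Hypothesis HC : up_component X k C.
Hypothesis C_ge2 : (2 <= #|C|)%N.
Local Notation D := (down_of X k C).
Local Notation w s := ((LP X s)%:R : R).
Local Notation sqw s := (Num.sqrt (w s)).
Local Notation N := (k.+1%:R : R).

Lemma wC_gt0 s : s \in C -> 0 < w s.
Proof. by move=> sC; rewrite ltr0n (LP_component_gt0 HX HC). Qed.

Lemma wD_gt0 t : t \in D -> 0 < w t.
Proof. by move=> tD; rewrite ltr0n (LP_down_gt0 HX tD). Qed.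

Let sqC s : s \in C -> sqw s * sqw s = w s.
Proof. by move=> sC; rewrite -expr2 sqr_sqrtr// ltW ?wC_gt0. Qed.

Let sqD s : s \in D -> sqw s * sqw s = w s.
Proof. by move=> sC; rewrite -expr2 sqr_sqrtr// ltW ?wD_gt0. Qed.

Let sqC0 s : s \in C -> sqw s != 0.
Proof. by move=> sC; rewrite lt0r_neq0// sqrtr_gt0 wC_gt0. Qed.

Let N0 : N != 0. Proof. by rewrite pnatr_eq0. Qed.

Lemma inv_facetsE t : t \in D ->
  inv_facets R X k t = \sum_(s in C) (if s \subset t then (w s)^-1 else 0).
Proof.
move=> tD; rewrite -big_mkcondr; apply: eq_bigl => s.
apply/andP/andP => -[sC st]; split=> //; last exact: (component_faces HC).
exact: (facet_component HC) tD st.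
Qed.

(** Double counting: a coface t of s has k + 1 facets, so summing LP t over all facets s' of all
    cofaces of s gives (k+1) LP s, from which the term s' = s removes LP s. This is the origin of
    the constant k. *)
Lemma up_deg s : s \in C ->
  \sum_(s' in C) edge (up_adj X k) (omega_up R X) s s' = k%:R * w s.
Proof.
move=> sC; rewrite (eq_bigr (fun s' : {set V} => \sum_(t in D) (if s \subset t then
    (if s' \subset t then w t else 0) else 0) - (if s' == s then w s else 0))); last first.
  move=> s' s'C; rewrite /edge; have [->|ss'] := eqVneq s' s.
    rewrite /up_adj /= eqxx !andbF; apply/esym/eqP; rewrite subr_eq0; apply/eqP.
    rewrite -(sum_cofaces HX HC C_ge2)//; apply: eq_bigr => t _.
    by case: (_ \subset _).
  rewrite subr0 -(sum_common_coface HC (fun t : {set V} => w t) sC s'C); last by rewrite eq_sym.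
  by apply: eq_bigr => t _; case: (s \subset t); case: (s' \subset t).
rewrite sumrB exchange_big /= (eq_bigr (fun t : {set V} => if s \subset t then N * w t else 0)).
  rewrite [X in _ - X](bigD1 s)//= eqxx [X in _ - (_ + X)]big1 ?addr0; last first.
    by move=> s' /andP[_ /negPf->].
  have -> : \sum_(t in D) (if s \subset t then N * w t else 0) = N * w s.
    rewrite -(sum_cofaces HX HC C_ge2)// mulr_sumr; apply: eq_bigr => t _.
    by case: ifP; rewrite ?mulr0.
  by rewrite -natr1 mulrDl mul1r addrK.
move=> t tD; case: ifP => st; last by apply: big1.
exact: (sum_facets HX k_gt0 HC).
Qed.

(** Summing LP t LP t' / LP s over the facets s of t and the cofaces t' of s gives LP t for each of
    the k + 1 facets; the term t' = t is then removed. The largest ratio of this degree to LP t is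
    [d_down]. *)
Lemma down_deg t : t \in D ->
  \sum_(t' in D) edge (down_adj X k) (omega_down R X) t t' =
  w t * (N - w t * inv_facets R X k t).
Proof.
move=> tD; pose F (s t' : {set V}) : R := if s \subset t then
    (if s \subset t' then w t * w t' / w s else 0) else 0.
rewrite (eq_bigr (fun t' : {set V} => \sum_(s in C) F s t' -
    (if t' == t then \sum_(s in C) F s t else 0))); last first.
  move=> t' t'D; rewrite /edge; have [->|tt'] := eqVneq t' t.
    by rewrite /down_adj /= eqxx !andbF subrr.
  rewrite subr0 /omega_down.
  rewrite -(sum_common_facet HC (fun s : {set V} => w t * w t' / w s) tD t'D);
    last by rewrite eq_sym.
  by apply: eq_bigr => s _; rewrite /F; case: (s \subset t); case: (s \subset t').
rewrite sumrB [X in _ - X](bigD1 t)//= eqxx [X in _ - (_ + X)]big1 ?addr0; last first.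
  by move=> t' /andP[_ /negPf->].
rewrite exchange_big/= -sumrB mulrBr [w t * N]mulrC.
rewrite -(sum_facets HX k_gt0 HC _ tD) (inv_facetsE tD) !mulr_sumr -sumrB.
apply: eq_bigr => s sC; rewrite /F; case: ifP => st; last by rewrite big1 // !mulr0 subrr.
rewrite mulrA; congr (_ - _); last by rewrite st.
rewrite (eq_bigr (fun t' : {set V} => w t / w s * (if s \subset t' then w t' else 0))); last first.
  by move=> t' _; case: ifP => _; rewrite ?mulr0// mulrAC.
by rewrite -mulr_sumr (sum_cofaces HX HC C_ge2)// divfK// lt0r_neq0 ?wC_gt0.
Qed.

Section Incidence.
Variable I : {set V} -> {set V} -> R.
Variables sgnU sgnD : {set V} -> {set V} -> int.
Hypothesis I_sqr : forall s t, s \in C -> t \in D -> I s t * I s t = (s \subset t)%:R.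
Hypothesis sgnUE : forall s s', s \in C -> s' \in C -> up_adj X k s s' ->
  (sgnU s s')%:~R = I s (s :|: s') * I s' (s :|: s').
Hypothesis sgnDE : forall t t', t \in D -> t' \in D -> down_adj X k t t' ->
  (sgnD t t')%:~R = I (t :&: t') t * I (t :&: t') t'.

(** I is the indicator of inclusion for the quotient matrices, with all signs 1, and the incidence
    number of chosen orientations for the signed ones; both share the Gram computations below. *)
Definition incidence_mx : 'M[R]_(#|C|, #|D|) :=
  \matrix_(i, j) (I (enum_val i) (enum_val j) * sqw (enum_val j) /
                  (sqw (enum_val i) * Num.sqrt N)).
Local Notation B := incidence_mx.

Let I0 s t : s \in C -> t \in D -> (s \subset t) = false -> I s t = 0.
Proof.
by move=> sC tD st; apply/eqP; rewrite -sqrf_eq0 expr2 I_sqr// st.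
Qed.

Let sqN : Num.sqrt N * Num.sqrt N = N.
Proof. by rewrite -expr2 sqr_sqrtr// ler0n. Qed.

(** A diagonal entry sums LP over all cofaces of s, which is LP s by its recursion. Off the diagonal
    only the union of the two faces can contribute. *)
Lemma gram_up : B *m B^T = - signed_mx (up_diag R k) (up_off R X k) sgnU C.
Proof.
apply/matrixP => i j; rewrite !mxE.
have sC := enum_valP i; have s'C := enum_valP j.
have -> : \sum_j0 B i j0 * B^T j0 j = (N * sqw (enum_val i) * sqw (enum_val j))^-1 *
    \sum_(t in D) I (enum_val i) t * I (enum_val j) t * w t.
  rewrite mulr_sumr [RHS]big_enum_val; apply: eq_bigr => l _; rewrite !mxE.
  have tD := enum_valP l; move: sC s'C tD; set s := enum_val i; set s' := enum_val j.
  set t := enum_val l => sC s'C tD; rewrite -[X in _ = _ * (_ * X)]sqD// -[X in (X * _ * _)^-1]sqN.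
  have := sqC0 sC; have := sqC0 s'C; have : Num.sqrt N != 0 by rewrite sqrtr_eq0 -ltNge ltr0n.
  move: (Num.sqrt N) (sqw s) (sqw s') (sqw t) (I s t) (I s' t) => n a b c x y n0 b0 a0.
  by field; rewrite n0 a0 b0.
have [<-|ij] := eqVneq i j.
  rewrite opprK (eq_bigr (fun t : {set V} => if enum_val i \subset t then w t else 0)); last first.
    by move=> t tD; rewrite I_sqr//; case: ifP; rewrite ?mul1r ?mul0r.
  rewrite (sum_cofaces HX HC C_ge2)// -mulrA sqC// invfM -mulrA mulVf ?mulr1//.
  by rewrite lt0r_neq0 ?wC_gt0.
have ss' : enum_val i != enum_val j by rewrite (inj_eq enum_val_inj).
rewrite opprK; move: sC s'C ss'; set s := enum_val i; set s' := enum_val j => sC s'C ss'.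
rewrite (eq_bigr (fun t : {set V} => if (s \subset t) && (s' \subset t) then
    I s t * I s' t * w t else 0)); last first.
  move=> t tD; case: (boolP (_ && _)) => //; rewrite negb_and => /orP[]/negPf h.
    by rewrite (I0 sC tD h) !mul0r.
  by rewrite (I0 s'C tD h) mulr0 mul0r.
rewrite (sum_common_coface HC _ sC s'C ss') /up_off.
case: ifP => uX; rewrite ?mulr0//; rewrite (sgnUE sC s'C uX) !invfM.
by move: (N^-1) (sqw s)^-1 (sqw s')^-1 (w _) (I s _) (I s' _) => *; ring.
Qed.

Lemma gram_down : B^T *m B = - signed_mx (down_diag R X k) (down_off R X k) sgnD D.
Proof.
apply/matrixP => i j; rewrite !mxE.
have tD := enum_valP i; have t'D := enum_valP j.
have -> : \sum_j0 B^T i j0 * B j0 j = N^-1 * sqw (enum_val i) * sqw (enum_val j) *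
    \sum_(s in C) I s (enum_val i) * I s (enum_val j) / w s.
  rewrite mulr_sumr [RHS]big_enum_val; apply: eq_bigr => l _; rewrite !mxE.
  have sC := enum_valP l; move: tD t'D sC; set t := enum_val i; set t' := enum_val j.
  set s := enum_val l => tD t'D sC; rewrite -[X in _ = _ * (_ / X)]sqC// -[X in X^-1 * _ * _]sqN.
  have := sqC0 sC; have : Num.sqrt N != 0 by rewrite sqrtr_eq0 -ltNge ltr0n.
  move: (Num.sqrt N) (sqw s) (sqw t') (sqw t) (I s t) (I s t') => n a b c x y n0 a0.
  by field; rewrite n0 a0.
have [<-|ij] := eqVneq i j.
  rewrite opprK /down_diag inv_facetsE// -[N^-1 * _ * _]mulrA sqD//; congr (_ * _).
  by apply: eq_bigr => s sC; rewrite I_sqr//; case: ifP; rewrite ?mul1r ?mul0r.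
have tt' : enum_val i != enum_val j by rewrite (inj_eq enum_val_inj).
rewrite opprK; move: tD t'D tt'; set t := enum_val i; set t' := enum_val j => tD t'D tt'.
rewrite (eq_bigr (fun s : {set V} => if (s \subset t) && (s \subset t') then
    I s t * I s t' / w s else 0)); last first.
  move=> s sC; case: (boolP (_ && _)) => //; rewrite negb_and => /orP[]/negPf h.
    by rewrite (I0 sC tD h) !mul0r.
  by rewrite (I0 sC t'D h) mulr0 mul0r.
rewrite (sum_common_facet HC _ tD t'D tt') /down_off.
case: ifP => uX; rewrite ?mulr0//; rewrite (sgnDE tD t'D uX).
by move: (N^-1) (sqw t) (sqw t') (w _)^-1 (I _ t) (I _ t') => *; ring.
Qed.

End Incidence.

Definition inclusion (s t : {set V}) : R := (s \subset t)%:R.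

Lemma gram_quot_up :
  incidence_mx inclusion *m (incidence_mx inclusion)^T =
  quot_mx (up_diag R k) (up_off R X k) C.
Proof.
rewrite quot_mxE; apply: gram_up => [s t _ _|s s' _ _ _]; rewrite /inclusion.
  by case: (_ \subset _); rewrite ?mulr1 ?mulr0.
by rewrite subsetUl subsetUr mulr1.
Qed.

Lemma gram_quot_down :
  (incidence_mx inclusion)^T *m incidence_mx inclusion =
  quot_mx (down_diag R X k) (down_off R X k) D.
Proof.
rewrite quot_mxE; apply: gram_down => [s t _ _|s s' _ _ _]; rewrite /inclusion.
  by case: (_ \subset _); rewrite ?mulr1 ?mulr0.
by rewrite subsetIl subsetIr mulr1.
Qed.

(** Together with the next lemma: B and its transpose exchange the vectors sqrt LP of the two
    components up to scalars, hence respect their orthogonal complements, as [top_on_gram]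
    demands. *)
Lemma incidence_mx_up : 
  vec D (fun s : {set V} => sqw s) *m (incidence_mx inclusion)^T =
  (Num.sqrt N)^-1 *: vec C (fun s : {set V} => sqw s).
Proof.
apply/rowP => i; rewrite !mxE; have sC := enum_valP i.
rewrite (eq_bigr (fun j : 'I_#|D| => (sqw (enum_val i) * Num.sqrt N)^-1 *
  (if enum_val i \subset enum_val j then w (enum_val j) else 0))); last first.
  move=> j _; rewrite !mxE /inclusion; case: (_ \subset _); rewrite ?mul0r ?mulr0// mul1r.
  by rewrite -[in RHS](sqD (enum_valP j)) mulrA mulrC.
have := sum_cofaces HX HC C_ge2 R sC; rewrite big_enum_val -mulr_sumr => ->.
rewrite -[X in _ * X]sqC// invfM.
by rewrite mulrAC mulrA mulVf ?mul1r ?sqC0// mulrC.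
Qed.

Lemma incidence_mx_down : 
  vec C (fun s : {set V} => sqw s) *m incidence_mx inclusion =
  (N / Num.sqrt N) *: vec D (fun s : {set V} => sqw s).
Proof.
apply/rowP => j; rewrite !mxE; have tD := enum_valP j.
rewrite (eq_bigr (fun i : 'I_#|C| => if enum_val i \subset enum_val j then
   sqw (enum_val j) / Num.sqrt N else 0)); last first.
  move=> i _; rewrite !mxE /inclusion; case: (_ \subset _); rewrite ?mul1r ?mul0r ?mulr0//.
  by rewrite invfM mulrA mulrACA mulfV ?mul1r// sqC0 ?enum_valP.
have := sum_facets HX k_gt0 HC (sqw (enum_val j) / Num.sqrt N) tD.
by rewrite big_enum_val => ->; rewrite mulrA mulrAC.
Qed.

End Gram.

(** * Oriented faces *)

Section OrientedFaces.
Variable V : finType.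
Implicit Types (C : {set {set V}}).

Definition perm_tuple n (t : n.-tuple V) (p : 'S_n) : n.-tuple V :=
  [tuple tnth t (p i) | i < n].

Lemma perm_tupleM n (t : n.-tuple V) (p q : 'S_n) :
  perm_tuple t (q * p)%g = perm_tuple (perm_tuple t p) q.
Proof. by apply: eq_from_tnth => i; rewrite !tnth_mktuple permM. Qed.

Lemma perm_tuple1 n (t : n.-tuple V) : perm_tuple t 1%g = t.
Proof. by apply: eq_from_tnth => i; rewrite tnth_mktuple perm1. Qed.

Lemma perm_tuple_set n (t : n.-tuple V) p : [set x in perm_tuple t p] = [set x in t].
Proof.
by apply/setP => x; rewrite !inE; apply: perm_mem; apply/tuple_permP; exists p.
Qed.

Lemma oclassP n b (t : n.-tuple V) b' t' :
  reflect (exists2 p : 'S_n, b' = b (+) odd_perm p & t' = perm_tuple t p)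
          ((b', t') \in oclass (b, t)).
Proof.
apply: (iffP imsetP) => [[p _ [-> ->]]|[p -> ->]]; first by exists p.
by exists p.
Qed.

Lemma oclass_perm n b (t : n.-tuple V) (p : 'S_n) :
  oclass (b, perm_tuple t p) = oclass (b (+) odd_perm p, t).
Proof.
apply/setP => -[c u]; apply/oclassP/oclassP => -[q -> ->].
  exists (q * p)%g; last by rewrite perm_tupleM.
  by rewrite odd_permM; case: b; case: (odd_perm p); case: (odd_perm q).
exists (q * p^-1)%g; last by rewrite -perm_tupleM mulgKV.
by rewrite odd_permM odd_permV; case: b; case: (odd_perm p); case: (odd_perm q).
Qed.

Lemma supp_oclass n b (t : n.-tuple V) : supp (oclass (b, t)) = [set x in t].
Proof.
apply/setP => x; rewrite !inE; apply/exists_inP/idP => [[[c u] /oclassP[p _ ->]] /=|xt].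
  by have := perm_tuple_set t p => /setP/(_ x); rewrite !inE => ->.
by exists (b, t) => //; apply/oclassP; exists 1%g; rewrite ?odd_perm1 ?addbF ?perm_tuple1.
Qed.

Lemma opp_oclass n b (t : n.-tuple V) : opp_oface (oclass (b, t)) = oclass (~~ b, t).
Proof.
apply/setP => -[c u]; apply/imsetP/oclassP => [[[c' u'] /oclassP[p -> ->]] [-> ->]|[p -> ->]].
  by exists p; rewrite ?addNb.
exists (b (+) odd_perm p, perm_tuple t p); first by apply/oclassP; exists p.
by rewrite /= addNb.
Qed.

(** Only the identity permutation fixes an ordering of distinct vertices, so the two signed classes
    over it are different. *)
Lemma oclass_inj n b b' (t : n.-tuple V) : uniq t ->
  oclass (b, t) = oclass (b', t) -> b = b'.
Proof.
move=> ut tt'; have : (b, t) \in oclass (b', t).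
  by rewrite -tt'; apply/oclassP; exists 1%g; rewrite ?odd_perm1 ?addbF ?perm_tuple1.
move=> /oclassP[p -> tE]; suff -> : p = 1%g by rewrite odd_perm1 addbF.
apply/permP => i; rewrite perm1; apply: (tuple_uniqP _ ut).
by rewrite [in RHS]tE tnth_mktuple.
Qed.

Lemma same_set_perm n (t t' : n.-tuple V) : uniq t -> uniq t' ->
  [set x in t] = [set x in t'] -> exists p, t' = perm_tuple t p.
Proof.
move=> ut ut' tt'; have /tuple_permP[p pE] : perm_eq t' t.
  by apply: uniq_perm => // x; have /setP/(_ x) := tt'; rewrite !inE.
by exists p; apply: val_inj.
Qed.

Lemma ofacesP n C (u : oface V n) :
  reflect (exists b (t : n.-tuple V), [/\ uniq t, [set x in t] \in C & u = oclass (b, t)])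
          (u \in ofaces n C).
Proof.
rewrite inE; apply: (iffP existsP) => [[[b t] /= /and3P[? ? /eqP ?]]|[b [t [? ? ?]]]].
  by exists b, t.
by exists (b, t); apply/and3P; split=> //; apply/eqP.
Qed.

Lemma ofaces_supp n C (u : oface V n) : u \in ofaces n C -> supp u \in C.
Proof. by move=> /ofacesP[b [t [_ tC ->]]]; rewrite supp_oclass. Qed.

Lemma ofaces_card n C (u : oface V n) : u \in ofaces n C -> #|supp u| = n.
Proof.
move=> /ofacesP[b [t [ut _ ->]]]; rewrite supp_oclass cardsE.
by rewrite (card_uniqP ut) size_tuple.
Qed.

Lemma ofaces_sub1 n C s (u : oface V n) : s \in C -> u \in ofaces n [set s] ->
  u \in ofaces n C.
Proof.
by move=> sC /ofacesP[b [t [ut /set1P ts ->]]]; apply/ofacesP; exists b, t; rewrite ts.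
Qed.

Lemma supp_opp n C (u : oface V n) : u \in ofaces n C -> supp (opp_oface u) = supp u.
Proof. by move=> /ofacesP[b [t [_ _ ->]]]; rewrite opp_oclass !supp_oclass. Qed.

Lemma opp_ofaces n C (u : oface V n) : u \in ofaces n C -> opp_oface u \in ofaces n C.
Proof.
by move=> /ofacesP[b [t [ut tC ->]]]; rewrite opp_oclass; apply/ofacesP; exists (~~ b), t.
Qed.

Lemma opp_neq n C (u : oface V n) : u \in ofaces n C -> opp_oface u != u.
Proof.
move=> /ofacesP[b [t [ut _ ->]]]; rewrite opp_oclass; apply/eqP => /(oclass_inj ut).
by case: b.
Qed.

Lemma ofaces_same_supp n C C' (u u' : oface V n) : u \in ofaces n C -> u' \in ofaces n C' ->
  supp u = supp u' -> u' = u \/ u' = opp_oface u.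
Proof.
move=> /ofacesP[b [t [ut _ ->]]] /ofacesP[b' [t' [ut' _ ->]]].
rewrite !supp_oclass => /(same_set_perm ut ut')[p ->]; rewrite oclass_perm opp_oclass.
by case: b; case: (_ (+) _); [left|right|right|left].
Qed.

Lemma oface_exists n (s : {set V}) : #|s| = n -> exists u : oface V n, u \in ofaces n [set s].
Proof.
move=> /eqP cs; have sz : size (enum s) == n by rewrite -cardE.
exists (oclass (false, Tuple sz)); apply/ofacesP; exists false, (Tuple sz).
split=> //; first exact: enum_uniq.
by apply/set1P/setP => x; rewrite inE mem_enum.
Qed.

Lemma orientation_exists (X : {set {set V}}) : exists O : face_choice V, orientation X O.
Proof.
pose O n s := xget (set0 : oface V n) (fun u => u \in ofaces n [set s]).
exists O => n s /setIdP[_ /eqP cs].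
exact: (@xgetPex _ _ (fun u => u \in ofaces n [set s])) (oface_exists cs).
Qed.

Lemma del_uniq n (t : n.+1.-tuple V) i : uniq t -> uniq (del i t).
Proof.
move=> /tuple_uniqP ut; apply/tuple_uniqP => j j'; rewrite !tnth_mktuple.
by move=> /ut /lift_inj.
Qed.

Lemma del_set n (t : n.+1.-tuple V) i : uniq t ->
  [set x in del i t] = [set x in t] :\ tnth t i.
Proof.
move=> /tuple_uniqP ut; apply/setP => x; rewrite !inE; apply/tnthP/andP.
  move=> [j ->]; rewrite tnth_mktuple mem_tnth; split=> //.
  by rewrite (inj_eq ut) eq_sym neq_lift.
move=> [xi /tnthP[j xj]]; move: xi; rewrite xj (inj_eq ut) eq_sym => ij.
by case: (unlift_some ij) => l -> _; exists l; rewrite tnth_mktuple.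
Qed.

(** Removing i from the source and p i from the target leaves a permutation of the other positions,
    read off with [unlift]. *)
Lemma lift_permP n (i : 'I_n.+1) (p : 'S_n.+1) : exists q : 'S_n, p = lift_perm i (p i) q.
Proof.
pose f j := odflt j (unlift (p i) (p (lift i j))).
have fE j : p (lift i j) = lift (p i) (f j).
  have : p i != p (lift i j) by rewrite (inj_eq perm_inj) neq_lift.
  by move=> /unlift_some[l lE ul]; rewrite /f ul.
have f_inj : injective f.
  move=> j j' ff; apply/(@lift_inj _ i)/(@perm_inj _ p); by rewrite !fE ff.
exists (perm f_inj); apply/permP => j; case: (unliftP i j) => [l ->|->].
  by rewrite lift_perm_lift permE fE.
by rewrite lift_perm_id.
Qed.

(** The induced orientation of a facet does not depend on the ordering of the coface: the parity of
    p is that of the permutation q of the remaining vertices plus the parities of i and p i. *)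
Lemma oclass_del_perm n (t : n.+1.-tuple V) (p : 'S_n.+1) (i : 'I_n.+1) :
  oclass (odd i, del i (perm_tuple t p)) = oclass (odd_perm p (+) odd (p i), del (p i) t).
Proof.
have [q pE] := lift_permP i p.
have -> : del i (perm_tuple t p) = perm_tuple (del (p i) t) q.
  apply: eq_from_tnth => j; rewrite !tnth_mktuple; congr (tnth t _).
  by rewrite [in LHS]pE lift_perm_lift.
rewrite oclass_perm [in RHS]pE odd_lift_perm lift_perm_id.
by congr (oclass (_, _)); case: (odd i); case: (odd (p i)); case: (odd_perm q).
Qed.

(** [incidence] looks for an ordering of tau with sign [false]. When b is [true] such an ordering is
    obtained by a transposition of two of the n + 1 positions, which exist because n > 0. In the
    other sign case, a successful search would identify the two opposite classes over the facet. *)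
Lemma incidence_oclass n b c (t : n.+1.-tuple V) (i : 'I_n.+1) : (0 < n)%N -> uniq t ->
  incidence (oclass (b, t)) (oclass (c, del i t)) = (-1) ^+ (c (+) b (+) odd i).
Proof.
move=> n0 ut; have pos : c (+) b (+) odd i = false ->
    incidence (oclass (b, t)) (oclass (c, del i t)) = 1.
  move=> cbi; have [p bp] : exists p : 'S_n.+1, odd_perm p = b.
    case: b {cbi}; last by exists 1%g; rewrite odd_perm1.
    exists (tperm ord0 ord_max); rewrite odd_tperm.
    by rewrite -val_eqE /= eq_sym -lt0n.
  rewrite /incidence ifT//; apply/existsP; exists (perm_tuple t p).
  apply/existsP; exists (p^-1 i)%g; apply/andP; split.
    by apply/oclassP; exists p; rewrite ?bp ?addbb.
  rewrite oclass_del_perm permKV bp; apply/eqP; congr (oclass (_, _)).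
  by move: cbi; case: c; case: b {bp}; case: (odd i).
case E: (_ (+) _); last by rewrite pos// expr0.
rewrite /incidence ifF ?expr1//; apply/negbTE/existsP => -[t' /existsP[j /andP[]]].
move=> /oclassP[p bp ->]; rewrite oclass_del_perm => /eqP eqc.
have ij : p j = i.
  have /(congr1 (@supp V n)) := eqc; rewrite !supp_oclass !del_set// => /setP/(_ (tnth t i)).
  rewrite !inE eqxx mem_tnth !andbT /= => /esym/negbFE/eqP.
  by move/(tuple_uniqP _ ut) => ->.
rewrite ij in eqc; have := oclass_inj (del_uniq i ut) eqc.
by move=> cE; move: E bp {pos eqc}; rewrite cE; case: (odd_perm p); case: b; case: (odd i).
Qed.

(** Normal form for incident oriented faces: the facet is reordered to match the ordering of the
    coface with one vertex deleted, and the parity of the reordering goes into c. Incidence numbers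
    are then given by [incidence_oclass]. *)
Lemma facet_form n C C' (v : oface V n.+1) (u : oface V n) :
  v \in ofaces n.+1 C -> u \in ofaces n C' -> supp u \subset supp v ->
  exists b c (t : n.+1.-tuple V) i,
    [/\ uniq t, v = oclass (b, t) & u = oclass (c, del i t)].
Proof.
move=> vC uC' uv; have cu := ofaces_card uC'; have cv := ofaces_card vC.
have /properP[_ [x xv xu]] : supp u \proper supp v by rewrite properEcard uv cu cv ltnSn.
move: vC xv cv uv => /ofacesP[b [t [ut _ ->]]]; rewrite supp_oclass inE => /tnthP[i xi] cv uv.
move: uC' xu cu uv => /ofacesP[c [t' [ut' _ ->]]]; rewrite supp_oclass => xu cu uv.
have [p t'E] : exists p, t' = perm_tuple (del i t) p.
  apply: same_set_perm => //; first exact: del_uniq.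
  rewrite del_set//; apply/esym/eqP; rewrite eqEcard subsetD1 uv -xi xu /= cu.
  have := cardsD1 x [set x in t]; rewrite cv !inE xi mem_tnth add1n => -[<-].
  by rewrite leqnn.
by exists b, (c (+) odd_perm p), t, i; rewrite t'E oclass_perm.
Qed.

Lemma incidence_oppl n C C' (v : oface V n.+1) (u : oface V n) : (0 < n)%N ->
  v \in ofaces n.+1 C -> u \in ofaces n C' -> supp u \subset supp v ->
  incidence (opp_oface v) u = - incidence v u.
Proof.
move=> n0 vC uC' /(facet_form vC uC')[b [c [t [i [ut -> ->]]]]].
by rewrite opp_oclass !incidence_oclass//; case: b; case: c; case: (odd i).
Qed.

Lemma incidence_oppr n C C' (v : oface V n.+1) (u : oface V n) : (0 < n)%N ->
  v \in ofaces n.+1 C -> u \in ofaces n C' -> supp u \subset supp v ->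
  incidence v (opp_oface u) = - incidence v u.
Proof.
move=> n0 vC uC' /(facet_form vC uC')[b [c [t [i [ut -> ->]]]]].
by rewrite opp_oclass !incidence_oclass//; case: b; case: c; case: (odd i).
Qed.

Lemma incidence_pm n (v : oface V n.+1) (u : oface V n) :
  incidence v u = (-1) ^+ (incidence v u == -1).
Proof. by rewrite /incidence; case: ifP. Qed.

End OrientedFaces.

(** * Change of orientation as switching of signs *)

Section Orientations.
Variables (V : finType) (X : {set {set V}}) (k : nat).
Hypothesis k_gt0 : (0 < k)%N.

Definition flip n (b : bool) (u : oface V n) : oface V n := if b then opp_oface u else u.

Lemma orient_supp O n s : orientation X O -> s \in nfaces X n -> supp (O n s) = s.
Proof. by move=> XO sX; apply/set1P/ofaces_supp/XO. Qed.

Lemma incidence_flip n C C' (v : oface V n.+1) (u : oface V n) b c : (0 < n)%N ->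
  v \in ofaces n.+1 C -> u \in ofaces n C' -> supp u \subset supp v ->
  incidence (flip b v) (flip c u) = (-1) ^+ b * (-1) ^+ c * incidence v u.
Proof.
move=> n0 vC uC' uv; have uv' : supp (opp_oface u) \subset supp v by rewrite (supp_opp uC').
case: b; case: c; rewrite /flip ?expr0 ?expr1 ?mul1r ?mulN1r ?mulr1 ?opprK//.
- by rewrite (incidence_oppl n0 vC (opp_ofaces uC'))// (incidence_oppr n0 vC uC')// opprK.
- by rewrite (incidence_oppl n0 vC uC').
- by rewrite (incidence_oppr n0 vC uC').
Qed.

Lemma incidence_face_sqr n (v : oface V n.+1) (u : oface V n) :
  incidence v u * incidence v u = 1.
Proof. by rewrite incidence_pm; case: (_ == _). Qed.

Lemma s_upE (O : face_choice V) s s' : s_up k O s s' = (-1) ^+ (s_up k O s s' == -1).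
Proof.
by rewrite /s_up (incidence_pm _ (O k s)) (incidence_pm _ (O k s')); do 2!case: (_ == _).
Qed.

Lemma s_downE (O : face_choice V) s s' : s_down k O s s' = (-1) ^+ (s_down k O s s' == -1).
Proof.
by rewrite /s_down (incidence_pm (O k.+1 s)) (incidence_pm (O k.+1 s')); do 2!case: (_ == _).
Qed.

Lemma s_upC (O : face_choice V) s s' : s_up k O s s' = s_up k O s' s.
Proof. by rewrite /s_up setUC mulrC. Qed.

Lemma s_downC (O : face_choice V) s s' : s_down k O s s' = s_down k O s' s.
Proof. by rewrite /s_down setIC mulrC. Qed.

Section TwoOrientations.
Variables (O Q : face_choice V) (e : nat -> {set V} -> bool).
Hypothesis XO : orientation X O.
Hypothesis Qe : forall n s, s \in nfaces X n -> Q n s = flip (e n s) (O n s).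

Lemma incidence_orient s t : s \in nfaces X k -> t \in nfaces X k.+1 -> s \subset t ->
  incidence (Q k.+1 t) (Q k s) = (-1) ^+ e k.+1 t * (-1) ^+ e k s * incidence (O k.+1 t) (O k s).
Proof.
move=> sX tX st; rewrite !Qe//; apply: (incidence_flip _ _ k_gt0 (XO tX) (XO sX)).
by rewrite !orient_supp.
Qed.

(** Reorienting the union changes both incidence numbers, so its sign cancels in the product and
    only those of s and s' remain. *)
Lemma s_up_flip s s' : up_adj X k s s' ->
  (s_up k Q s s' == -1) = e k s (+) e k s' (+) (s_up k O s s' == -1).
Proof.
move=> /and4P[sX s'X _ uX]; have : s_up k Q s s' = (-1) ^+ e k s * (-1) ^+ e k s' * s_up k O s s'.
  rewrite /s_up !incidence_orient ?subsetUl ?subsetUr//.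
  move: (incidence _ _) (incidence _ _) => x y.
  by case: (e k.+1 _); rewrite ?expr0 ?expr1; ring.
move=> ->; rewrite [in LHS]s_upE; case: (s_up k O s s' == -1); case: (e k s); by case: (e k s').
Qed.

Lemma s_down_flip s s' : down_adj X k s s' ->
  (s_down k Q s s' == -1) = e k.+1 s (+) e k.+1 s' (+) (s_down k O s s' == -1).
Proof.
move=> /and4P[sX s'X _ uX].
have : s_down k Q s s' = (-1) ^+ e k.+1 s * (-1) ^+ e k.+1 s' * s_down k O s s'.
  rewrite /s_down !incidence_orient ?subsetIl ?subsetIr//.
  move: (incidence _ _) (incidence _ _) => x y.
  by case: (e k (_ :&: _)); rewrite ?expr0 ?expr1; ring.
move=> ->; rewrite [in LHS]s_downE; case: (s_down k O s s' == -1); case: (e k.+1 s);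
  by case: (e k.+1 s').
Qed.

End TwoOrientations.

Lemma orientation_flip O Q : orientation X O -> orientation X Q ->
  forall n s, s \in nfaces X n -> Q n s = flip (Q n s != O n s) (O n s).
Proof.
move=> XO XQ n s sX; rewrite /flip; case: eqP => [//|] /= QO.
have h : supp (O n s) = supp (Q n s) by rewrite !orient_supp.
by case: (ofaces_same_supp (XO n s sX) (XQ n s sX) h).
Qed.

Definition reorient (O : face_choice V) (m : nat) (e : {set V} -> bool) : face_choice V :=
  fun n s => flip ((n == m) && e s) (O n s).

Lemma reorient_orientation O m e : orientation X O -> orientation X (reorient O m e).
Proof.
move=> XO n s sX; rewrite /reorient /flip; case: ifP => _; last exact: XO.
exact/opp_ofaces/XO.
Qed.

Lemma s_up_orient O Q : orientation X O -> orientation X Q ->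
  exists e : {set V} -> bool, forall s s', up_adj X k s s' ->
    (s_up k Q s s' == -1) = e s (+) e s' (+) (s_up k O s s' == -1).
Proof.
move=> XO XQ; exists (fun s => Q k s != O k s) => s s'.
exact: (s_up_flip XO (orientation_flip XO XQ)).
Qed.

Lemma s_down_orient O Q : orientation X O -> orientation X Q ->
  exists e : {set V} -> bool, forall s s', down_adj X k s s' ->
    (s_down k Q s s' == -1) = e s (+) e s' (+) (s_down k O s s' == -1).
Proof.
move=> XO XQ; exists (fun s => Q k.+1 s != O k.+1 s) => s s'.
exact: (s_down_flip XO (orientation_flip XO XQ)).
Qed.

Lemma s_up_reorient O e s s' : orientation X O -> up_adj X k s s' ->
  (s_up k (reorient O k e) s s' == -1) = e s (+) e s' (+) (s_up k O s s' == -1).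
Proof.
move=> XO ss'; rewrite (@s_up_flip O _ (fun n s => (n == k) && e s))//.
by rewrite eqxx.
Qed.

Lemma s_down_reorient O e s s' : orientation X O -> down_adj X k s s' ->
  (s_down k (reorient O k.+1 e) s s' == -1) = e s (+) e s' (+) (s_down k O s s' == -1).
Proof.
move=> XO ss'; rewrite (@s_down_flip O _ (fun n s => (n == k.+1) && e s))//.
by rewrite eqxx.
Qed.

End Orientations.

(** * Eigenvalues and Cheeger bounds of the up and down matrices *)

Section Spectra.
Variables (R : realType) (V : finType) (X : {set {set V}}) (k : nat) (C : {set {set V}}).
Hypothesis HX : simplicial_complex X.
Hypothesis k_gt0 : (0 < k)%N.
Hypothesis HC : up_component X k C.
Hypothesis C_ge2 : (2 <= #|C|)%N.
Hypothesis D_ge2 : (2 <= #|down_of X k C|)%N.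
Local Notation D := (down_of X k C).
Local Notation w s := ((LP X s)%:R : R).
Local Notation sqw s := (Num.sqrt (w s)).
Local Notation N := (k.+1%:R : R).
Local Notation d := (d_down R X k D).

Let C0 : C != set0. Proof. by rewrite -card_gt0 (ltn_trans _ C_ge2). Qed.
Let D0 : D != set0. Proof. by rewrite -card_gt0 (ltn_trans _ D_ge2). Qed.
Let wC s : s \in C -> 0 < w s. Proof. exact: (wC_gt0 R HX HC). Qed.
Let wD s : s \in D -> 0 < w s. Proof. exact: (wD_gt0 R HX). Qed.

Let up_irr : irreflexive (up_adj X k).
Proof. by move=> s; rewrite /up_adj /= eqxx !andbF. Qed.
Let down_irr : irreflexive (down_adj X k).
Proof. by move=> s; rewrite /down_adj /= eqxx !andbF. Qed.
Let up_om_sym s s' : omega_up R X s s' = omega_up R X s' s.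
Proof. by rewrite /omega_up setUC. Qed.
Let down_om_sym s s' : omega_down R X s s' = omega_down R X s' s.
Proof. by rewrite /omega_down setIC [w s * _]mulrC. Qed.
Let up_om_ge0 s s' : 0 <= omega_up R X s s'.
Proof. exact: ler0n. Qed.
Let down_om_ge0 s s' : 0 <= omega_down R X s s'.
Proof. by rewrite divr_ge0 ?mulr_ge0. Qed.

Let up_deg_le s : s \in C ->
  \sum_(s' in C) edge (up_adj X k) (omega_up R X) s s' <= k%:R * w s.
Proof. by move=> sC; rewrite (up_deg R HX k_gt0 HC C_ge2 sC). Qed.

Let down_deg_le t : t \in D ->
  \sum_(t' in D) edge (down_adj X k) (omega_down R X) t t' <= d * w t.
Proof.
move=> tD; rewrite (down_deg R HX k_gt0 HC C_ge2 tD) mulrC ler_wpM2r// lerD2l lerN2.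
apply: ge_inf; last by exists t.
by exists 0 => _ [s _ ->]; rewrite mulr_ge0// sumr_ge0// => r _; rewrite invr_ge0.
Qed.

Let d_ge0 : 0 <= d.
Proof.
have /set0Pn[t tD] := D0; rewrite -(pmulr_lge0 _ (wD tD)).
apply: le_trans (down_deg_le tD); apply: sumr_ge0 => t' _.
by rewrite /edge; case: ifP.
Qed.

Let up_diagE s : s \in C -> up_diag R k s =
  1 - (\sum_(s' in C) edge (up_adj X k) (omega_up R X) s s') / (N * w s).
Proof.
move=> sC; rewrite (up_deg R HX k_gt0 HC C_ge2 sC) /up_diag.
rewrite -mulf_div divff ?lt0r_neq0 ?wC// mulr1.
by rewrite -[X in X - _](divff (_ : N != 0)) ?pnatr_eq0// -mulrBl -natrB// subSnn mul1r.
Qed.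

Let down_diagE t : t \in D -> down_diag R X k t =
  1 - (\sum_(t' in D) edge (down_adj X k) (omega_down R X) t t') / (N * w t).
Proof.
move=> tD; rewrite (down_deg R HX k_gt0 HC C_ge2 tD) /down_diag.
have wt := lt0r_neq0 (wD tD); have N0 : N != 0 by rewrite pnatr_eq0.
by move: (N) N0 (w t) wt (inv_facets _ _ _ _) => n n0 x x0 y; field; rewrite n0 x0.
Qed.

Let up_offE s s' : s \in C -> s' \in C -> s != s' -> up_off R X k s s' =
  edge (up_adj X k) (omega_up R X) s s' / (N * sqw s * sqw s').
Proof.
move=> _ _ _; rewrite /up_off /edge; case: ifP => _; last by rewrite mul0r.
by rewrite !invfM mulrC.
Qed.

Let down_offE s s' : s \in D -> s' \in D -> s != s' -> down_off R X k s s' =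
  edge (down_adj X k) (omega_down R X) s s' / (N * sqw s * sqw s').
Proof.
move=> sD s'D _; rewrite /down_off /edge; case: ifP => _; last by rewrite mul0r.
have N0 : N != 0 by rewrite pnatr_eq0.
have a0 : sqw s != 0 by rewrite lt0r_neq0// sqrtr_gt0 wD.
have b0 : sqw s' != 0 by rewrite lt0r_neq0// sqrtr_gt0 wD.
have -> : omega_down R X s s' = sqw s ^+ 2 * sqw s' ^+ 2 / w (s :&: s').
  by rewrite /omega_down !sqr_sqrtr// ltW ?wD.
by move: (N) N0 (sqw s) a0 (sqw s') b0 (w _)^-1 => n n0 a a0 b b0 c; field; rewrite n0 a0 b0.
Qed.

Lemma A_up_sym : (A_up R X k C)^T = A_up R X k C.
Proof. exact: (quot_mx_sym _ (up_adj_sym X k) up_om_sym up_offE). Qed.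

Lemma A_down_sym : (A_down R X k D)^T = A_down R X k D.
Proof. exact: (quot_mx_sym _ (down_adj_sym X k) down_om_sym down_offE). Qed.

Lemma A_up_sqw : vec C (fun s => sqw s) *m A_up R X k C = vec C (fun s => sqw s).
Proof. exact: (quot_mx_sqw wC (up_adj_sym X k) up_irr up_om_sym up_diagE up_offE). Qed.

Lemma A_down_sqw : vec D (fun s => sqw s) *m A_down R X k D = vec D (fun s => sqw s).
Proof.
exact: (quot_mx_sqw wD (down_adj_sym X k) down_irr down_om_sym down_diagE down_offE).
Qed.

Lemma A_up_top : top_on (vec C (fun s => sqw s)) (A_up R X k C) (lambda_max1 (A_up R X k C)).
Proof.
apply: top_on_lambda_max1 => //.
- exact: A_up_sym.
- have /set0Pn[s sC] := C0; rewrite -dotvv_eq0 dotv_vec psumr_eq0; last first.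
    by move=> t _; rewrite mulr_ge0 ?sqrtr_ge0.
  apply/allPn; exists s; first exact: mem_index_enum.
  by rewrite sC /= mulf_neq0// lt0r_neq0// sqrtr_gt0 wC.
- exact: A_up_sqw.
- exact: (quot_mx_le1 C0 wC (up_adj_sym X k) up_irr up_om_sym up_om_ge0 up_diagE up_offE).
Qed.

Lemma A_down_top :
  top_on (vec D (fun s => sqw s)) (A_down R X k D) (lambda_max1 (A_down R X k D)).
Proof.
apply: top_on_lambda_max1 => //.
- exact: A_down_sym.
- have /set0Pn[s sC] := D0; rewrite -dotvv_eq0 dotv_vec psumr_eq0; last first.
    by move=> t _; rewrite mulr_ge0 ?sqrtr_ge0.
  apply/allPn; exists s; first exact: mem_index_enum.
  by rewrite sC /= mulf_neq0// lt0r_neq0// sqrtr_gt0 wD.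
- exact: A_down_sqw.
- exact: (quot_mx_le1 D0 wD (down_adj_sym X k) down_irr down_om_sym down_om_ge0
    down_diagE down_offE).
Qed.

Lemma lambda_max1_up_down : lambda_max1 (A_up R X k C) = lambda_max1 (A_down R X k D).
Proof.
move: (lambda_max1 _) A_up_top (lambda_max1 _) A_down_top => a upT b downT.
rewrite /A_up -(gram_quot_up R HX HC C_ge2) in upT.
rewrite /A_down -(gram_quot_down R HX HC) in downT.
apply: (top_on_gram _ _ upT downT) => g gphi.
  by rewrite dotv_mul (incidence_mx_up R HX HC C_ge2) dotvZr gphi mulr0.
by rewrite dotv_mul trmxK (incidence_mx_down R HX k_gt0 HC) dotvZr gphi mulr0.
Qed.

Lemma up_quot_bounds a : top_on (vec C (fun s => sqw s)) (A_up R X k C) a ->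
  qh_up R X k C ^+ 2 / k%:R / (2 * N) <= 1 - a /\ 1 - a <= 2 * qh_up R X k C / N.
Proof.
exact: (top_on_quot_bounds C0 wC (up_adj_sym X k) up_irr up_om_sym up_om_ge0
  (ler0n _ _) up_deg_le up_diagE up_offE).
Qed.

Lemma down_quot_bounds a : top_on (vec D (fun s => sqw s)) (A_down R X k D) a ->
  qh_down R X k D ^+ 2 / d / (2 * N) <= 1 - a /\ 1 - a <= 2 * qh_down R X k D / N.
Proof.
exact: (top_on_quot_bounds D0 wD (down_adj_sym X k) down_irr down_om_sym down_om_ge0
  d_ge0 down_deg_le down_diagE down_offE).
Qed.

Lemma A_up_signed_sym O : (A_up_signed R X k O C)^T = A_up_signed R X k O C.
Proof.
exact: (signed_mx_sym _ (up_adj_sym X k) up_om_sym up_offE (s_upC _ _)).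
Qed.

Lemma A_down_signed_sym O : (A_down_signed R X k O D)^T = A_down_signed R X k O D.
Proof.
exact: (signed_mx_sym _ (down_adj_sym X k) down_om_sym down_offE (s_downC _ _)).
Qed.

Lemma A_up_signed_top O :
  top_on 0 (- A_up_signed R X k O C) (- lambda_min (A_up_signed R X k O C)).
Proof. by apply: top_on_lambda_min (A_up_signed_sym O) _; rewrite card_gt0. Qed.

Lemma A_down_signed_top O :
  top_on 0 (- A_down_signed R X k O D) (- lambda_min (A_down_signed R X k O D)).
Proof. by apply: top_on_lambda_min (A_down_signed_sym O) _; rewrite card_gt0. Qed.

Definition signed_inclusion (O : face_choice V) (s t : {set V}) : R :=
  if s \subset t then (incidence (O k.+1 t) (O k s))%:~R else 0.

Let signed_inclusion_sqr O s t : s \in C -> t \in D ->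
  signed_inclusion O s t * signed_inclusion O s t = (s \subset t)%:R.
Proof.
move=> _ _; rewrite /signed_inclusion; case: ifP; rewrite ?mulr0// -intrM.
by rewrite incidence_face_sqr.
Qed.

Lemma gram_signed_up O : incidence_mx X k C (signed_inclusion O) *m
  (incidence_mx X k C (signed_inclusion O))^T = - A_up_signed R X k O C.
Proof.
apply: (gram_up HX HC C_ge2 (@signed_inclusion_sqr O)) => s s' _ _ _.
by rewrite /signed_inclusion subsetUl subsetUr intrM.
Qed.

Lemma gram_signed_down O : (incidence_mx X k C (signed_inclusion O))^T *m
  incidence_mx X k C (signed_inclusion O) = - A_down_signed R X k O D.
Proof.
apply: (gram_down HX HC (@signed_inclusion_sqr O)) => s s' _ _ _.
by rewrite /signed_inclusion subsetIl subsetIr intrM.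
Qed.

Lemma lambda_min_up_down O :
  lambda_min (A_up_signed R X k O C) = lambda_min (A_down_signed R X k O D).
Proof.
move: (lambda_min _) (A_up_signed_top O) (lambda_min _) (A_down_signed_top O).
move=> a upT b downT; rewrite -gram_signed_up in upT; rewrite -gram_signed_down in downT.
by apply/oppr_inj/(top_on_gram _ _ upT downT) => g _; rewrite dotvC dot0v.
Qed.

Lemma up_signed_bounds O : orientation X O ->
  h_up R X k C ^+ 2 / k%:R / (2 * N) <= 1 + lambda_min (A_up_signed R X k O C) /\
  1 + lambda_min (A_up_signed R X k O C) <= 2 * h_up R X k C / N.
Proof.
move=> XO; have := A_up_signed_top O; rewrite -[X in 1 + X]opprK.
apply: (top_on_signed_bounds C0 wC (up_adj_sym X k) up_irr up_om_sym up_om_ge0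
  (ler0n _ _) up_deg_le up_diagE up_offE (s_upE _)) => //.
- move=> P Q XP XQ; have [e he] := s_up_orient k_gt0 XP XQ.
  by exists e => s s' _ _; apply: he.
- move=> P e XP; exists (reorient P k e); first exact: reorient_orientation.
  by move=> s s' _ _; apply: s_up_reorient.
Qed.

Lemma down_signed_bounds O : orientation X O ->
  h_down R X k D ^+ 2 / d / (2 * N) <= 1 + lambda_min (A_down_signed R X k O D) /\
  1 + lambda_min (A_down_signed R X k O D) <= 2 * h_down R X k D / N.
Proof.
move=> XO; have := A_down_signed_top O; rewrite -[X in 1 + X]opprK.
apply: (top_on_signed_bounds D0 wD (down_adj_sym X k) down_irr down_om_sym down_om_ge0
  d_ge0 down_deg_le down_diagE down_offE (s_downE _)) => //.
- move=> P Q XP XQ; have [e he] := s_down_orient k_gt0 XP XQ.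
  by exists e => s s' _ _; apply: he.
- move=> P e XP; exists (reorient P k.+1 e); first exact: reorient_orientation.
  by move=> s s' _ _; apply: s_down_reorient.
Qed.

Lemma connected_ind (P : {set V} -> Prop) s s' : s \in C -> s' \in C ->
  (forall x y, x \in C -> y \in C -> up_adj X k x y -> P x -> P y) -> P s -> P s'.
Proof.
move=> sC s'C step; have /connectP[p] := component_connected HC sC s'C.
elim: p s {sC} => [s _ -> //|y p IHp s /= /andP[/and3P[sC yC sy] py] pE Ps].
exact: IHp py pE (step _ _ sC yC sy Ps).
Qed.

Lemma edge_up_neq0 s s' : up_adj X k s s' -> edge (up_adj X k) (omega_up R X) s s' != 0.
Proof.
move=> ss'; rewrite /edge ss' /omega_up pnatr_eq0 -lt0n LP_gt0//.
by case/and4P: ss' => _ _ _ /setIdP[].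
Qed.

(** An eigenfunction for 1 is constant by connectivity, and its orthogonality to sqrt LP would make
    the total weight 0. *)
Lemma lambda_max1_lt1 : lambda_max1 (A_up R X k C) < 1.
Proof.
have top := A_up_top; rewrite lt_neqAle; apply/andP; split; last first.
  apply: top_on_le1 top.
  exact: (quot_mx_le1 C0 wC (up_adj_sym X k) up_irr up_om_sym up_om_ge0 up_diagE up_offE).
apply/eqP => a1; rewrite a1 /A_up quot_mxE in top.
have [//|f [fphi [s0 s0C f0] fE]] := top_on_eq1 (neg := fun _ _ => false) C0 wC
  (up_adj_sym X k) up_irr up_om_sym up_om_ge0 up_diagE up_offE _ top.
have fc s : s \in C -> f s = f s0.
  move=> sC; apply: (@connected_ind (fun s => f s = f s0) s0) => // x y xC yC xy <-.
  by rewrite (fE x y)// ?mul1r// edge_up_neq0.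
move/eqP: fphi; rewrite dotv_vec (eq_bigr (fun s => f s0 * w s)); last first.
  by move=> s sC; rewrite fc// -mulrA -expr2 sqr_sqrtr.
rewrite -mulr_sumr mulf_eq0 (negPf f0) /= psumr_eq0// => /allP/(_ s0 (mem_index_enum _)).
by rewrite s0C /= gt_eqF// wC.
Qed.

(* An eigenvector for the eigenvalue -1 has constant absolute value, and reorienting
   the faces where it is negative makes the component coherent. *)
Lemma lambda_min_gtN1 O : orientation X O -> ~~ single_leaf X C -> ~ up_coherent X k C ->
  -1 < lambda_min (A_up_signed R X k O C).
Proof.
move=> XO Cl ncoh; have top := A_up_signed_top O.
have sE s s' : s \in C -> s' \in C -> up_adj X k s s' ->
  s_up k O s s' = (-1) ^+ (s_up k O s s' == -1) by move=> _ _ _; apply: s_upE.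
rewrite ltrNl lt_neqAle; apply/andP; split; last first.
  apply: top_on_le1 top.
  exact: (signed_mx_le1 C0 wC (up_adj_sym X k) up_irr up_om_sym up_om_ge0 up_diagE up_offE sE).
apply/eqP => a1; rewrite a1 in top; apply: ncoh; split=> //.
have [f [_ [s0 s0C f0] fE]] := top_on_eq1 C0 wC
  (up_adj_sym X k) up_irr up_om_sym up_om_ge0 up_diagE up_offE sE top.
have fn0 s : s \in C -> f s != 0.
  move=> sC; apply: (@connected_ind (fun s => is_true (f s != 0)) s0) => // x y xC yC xy.
  rewrite (fE x y)// ?edge_up_neq0//; apply: contra_neq => ->; exact: mulr0.
pose e s := f s < 0; exists (reorient O k e); first exact: reorient_orientation.
have XQ := reorient_orientation k e XO.
move=> tau s s' tauX sC s'C st s't; have [->//|ss'] := eqVneq s s'.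
have sX := component_faces HC sC; have s'X := component_faces HC s'C.
have tX := ofaces_supp tauX.
have tE : supp tau = s :|: s'.
  by apply/eqP; rewrite -(facet_union sX s'X tX ss') st s't.
have sadj : up_adj X k s s' by rewrite /up_adj /= sX s'X ss' -tE tX.
(* The relation f s = [s_up] f s' between nonzero values says that the old sign is the product of
   the signs of f, which the reorientation cancels. *)
have s1 : s_up k (reorient O k e) s s' = 1.
  rewrite s_upE (s_up_reorient k_gt0 _ XO sadj) /e.
  have := fE s s' sC s'C (edge_up_neq0 sadj); have := fn0 _ s'C.
  case: (s_up k O s s' == -1); rewrite ?expr0 ?expr1 ?mul1r ?mulN1r.
    by move=> s'0 ->; rewrite oppr_lt0; move: s'0; case: (ltgtP (f s') 0).
  by move=> _ ->; rewrite addbb.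
have uX : s :|: s' \in nfaces X k.+1 by rewrite -tE.
have incE : incidence (reorient O k e k.+1 (s :|: s')) (reorient O k e k s) =
            incidence (reorient O k e k.+1 (s :|: s')) (reorient O k e k s').
  move: s1; rewrite /s_up; set a := incidence _ _; set b := incidence _ _ => ab.
  by rewrite -[LHS]mulr1 -(incidence_face_sqr _ _ : b * b = 1) mulrA ab mul1r.
(* The given [tau] is the chosen orientation of its support or its opposite, and the opposite
   negates both incidence numbers. *)
have XQu := XQ _ _ uX; have supQ : supp (reorient O k e k.+1 (s :|: s')) = supp tau.
  by rewrite (orient_supp XQ uX) tE.
have [->//|->] := ofaces_same_supp XQu tauX supQ.
rewrite !(incidence_oppl k_gt0 XQu (XQ _ _ _)) ?incE//;
  by rewrite !(orient_supp XQ) ?tE// -tE.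
Qed.

End Spectra.

(** * Walks on oriented faces *)

Section TwoSheetedWalk.
Variables (R : realType) (T B : finType) (S : {set T}) (C : {set B}).
Variables (supp : T -> B) (O : B -> T) (opp : T -> T) (w : B -> R).
Variables (ae ao : B -> B -> R) (P : T -> T -> R).
Local Notation sqw s := (Num.sqrt (w s)).

Hypothesis O_in : forall s, s \in C -> O s \in S.
Hypothesis opp_in : forall s, s \in C -> opp (O s) \in S.
Hypothesis supp_O : forall s, s \in C -> supp (O s) = s.
Hypothesis supp_opp : forall s, s \in C -> supp (opp (O s)) = s.
Hypothesis supp_in : forall u, u \in S -> supp u \in C.
Hypothesis O_opp : forall s, s \in C -> opp (O s) != O s.
Hypothesis sheets : forall u, u \in S -> u = O (supp u) \/ u = opp (O (supp u)).
Hypothesis w_gt0 : forall s, s \in C -> 0 < w s.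

Definition sheet u : R := if u == O (supp u) then 1 else -1.

(** [ae] and [ao] are the parts of the transition probability that are even and odd under reversal
    of orientation, conjugated by sqrt w so as to become symmetric. *)
Hypothesis PE : forall u u', u \in S -> u' \in S ->
  P u u' = 2^-1 * (sqw (supp u') / sqw (supp u)) *
    (ae (supp u) (supp u') + sheet u * sheet u' * ao (supp u) (supp u')).

Lemma sum_sheets (F : T -> R) :
  \sum_(u in S) F u = \sum_(s in C) (F (O s) + F (opp (O s))).
Proof.
rewrite (partition_big supp (mem C)) /=; last exact: supp_in.
apply: eq_bigr => s sC; rewrite (bigD1 (O s)) /=; last by rewrite O_in// supp_O// eqxx.
rewrite (bigD1 (opp (O s))) /=; last by rewrite opp_in// supp_opp// eqxx O_opp.
rewrite big1 ?addr0// => u /andP[/andP[/andP[uS /eqP us] uO] uo].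
by case: (sheets uS) uO uo; rewrite us => ->; rewrite eqxx.
Qed.

Lemma sheet_O s : s \in C -> sheet (O s) = 1.
Proof. by move=> sC; rewrite /sheet supp_O// eqxx. Qed.

Lemma sheet_opp s : s \in C -> sheet (opp (O s)) = -1.
Proof. by move=> sC; rewrite /sheet supp_opp// (negPf (O_opp sC)). Qed.

Let w0 s : s \in C -> sqw s != 0.
Proof. by move=> sC; rewrite lt0r_neq0// sqrtr_gt0 w_gt0. Qed.

Let sqwM s : s \in C -> sqw s * sqw s = w s.
Proof. by move=> sC; rewrite -expr2 sqr_sqrtr// ltW// w_gt0. Qed.

(** Applied to a row vector, this adds the two values over s, and [odd_mx] subtracts them; the
    division by sqrt (w s) is the conjugation in [PE]. *)
Definition even_mx : 'M[R]_(#|S|, #|C|) :=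
  \matrix_(i, j) ((supp (enum_val i) == enum_val j)%:R / sqw (enum_val j)).
Definition odd_mx : 'M[R]_(#|S|, #|C|) :=
  \matrix_(i, j) (sheet (enum_val i) * (supp (enum_val i) == enum_val j)%:R
                  / sqw (enum_val j)).
Local Notation Ke := even_mx.
Local Notation Ko := odd_mx.
Local Notation W := (walk_mx P S).
Local Notation Me := (\matrix_(i, j) ae (enum_val i) (enum_val j) : 'M[R]_#|C|).
Local Notation Mo := (\matrix_(i, j) ao (enum_val i) (enum_val j) : 'M[R]_#|C|).

Let sum_supp (F : B -> R) s : s \in C ->
  \sum_(i < #|C|) (s == enum_val i)%:R * F (enum_val i) = F s.
Proof.
move=> sC; rewrite -(big_enum_val (fun t => (s == t)%:R * F t)) (bigD1 s)//=.
rewrite eqxx mul1r big1 ?addr0// => t /andP[_ ts].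
by rewrite eq_sym (negPf ts) mul0r.
Qed.

Lemma walk_even : W *m Ke = Ke *m Me.
Proof.
apply/matrixP => i j; rewrite !mxE.
have uS := enum_valP i; set u := enum_val i in uS *.
have s'C := enum_valP j; set s' := enum_val j in s'C *.
have sC := supp_in uS; set s := supp u in sC *.
transitivity (ae s s' / sqw s); last first.
  rewrite (eq_bigr (fun l : 'I_#|C| => (s == enum_val l)%:R *
      (ae (enum_val l) s' / sqw (enum_val l)))).
    by rewrite (sum_supp (fun t => ae t s' / sqw t)).
  by move=> l _; rewrite !mxE mulrAC -mulrA.
rewrite (eq_bigr (fun l : 'I_#|S| => P u (enum_val l) *
   ((supp (enum_val l) == s')%:R / sqw s'))); last by move=> l _; rewrite !mxE.
rewrite -(big_enum_val (fun v => P u v * ((supp v == s')%:R / sqw s'))) sum_sheets.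
rewrite (bigD1 s')//= [X in _ + X]big1 ?addr0; last first.
  by move=> t /andP[tC /negPf ts]; rewrite supp_O// supp_opp// ts !mul0r !mulr0 addr0.
rewrite !PE ?O_in ?opp_in// supp_O// supp_opp// sheet_O// sheet_opp// eqxx /= -/s.
have := w0 sC; have := w0 s'C; move: (sqw s) (sqw s') => a b b0 a0.
by field; rewrite a0 b0.
Qed.

Lemma walk_odd : W *m Ko = Ko *m Mo.
Proof.
apply/matrixP => i j; rewrite !mxE.
have uS := enum_valP i; set u := enum_val i in uS *.
have s'C := enum_valP j; set s' := enum_val j in s'C *.
have sC := supp_in uS; set s := supp u in sC *.
transitivity (sheet u * (ao s s' / sqw s)); last first.
  rewrite (eq_bigr (fun l : 'I_#|C| => (s == enum_val l)%:R *
      (sheet u * (ao (enum_val l) s' / sqw (enum_val l))))).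
    by rewrite (sum_supp (fun t => sheet u * (ao t s' / sqw t))).
  by move=> l _; rewrite !mxE; ring.
rewrite (eq_bigr (fun l : 'I_#|S| => P u (enum_val l) *
   (sheet (enum_val l) * (supp (enum_val l) == s')%:R / sqw s'))); last first.
  by move=> l _; rewrite !mxE.
rewrite -(big_enum_val (fun v => P u v * (sheet v * (supp v == s')%:R / sqw s'))).
rewrite sum_sheets.
rewrite (bigD1 s')//= [X in _ + X]big1 ?addr0; last first.
  by move=> t /andP[tC /negPf ts]; rewrite supp_O// supp_opp// ts !(mulr0, mul0r) addr0.
rewrite !PE ?O_in ?opp_in// supp_O// supp_opp// sheet_O// sheet_opp// eqxx /= -/s.
have := w0 sC; have := w0 s'C; move: (sqw s) (sqw s') => a b b0 a0.
by field; rewrite a0 b0.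
Qed.

Lemma walk_pow_even (p : 'rV[R]_#|S|) t : p *m W ^+ t *m Ke = p *m Ke *m Me ^+ t.
Proof.
elim: t => [|t IHt]; first by rewrite !expr0 !mulmx1.
by rewrite !exprSr !mulmxA -IHt -!mulmxA walk_even.
Qed.

(** The sign is split off because - Mo, not Mo, is positive semidefinite, and only its normalised
    powers converge. *)
Lemma walk_pow_odd (p : 'rV[R]_#|S|) t : p *m W ^+ t *m Ko = (-1) ^+ t *: (p *m Ko *m (- Mo) ^+ t).
Proof.
elim: t => [|t IHt]; first by rewrite !expr0 !mulmx1 scale1r.
rewrite !exprSr !mulmxA -(mulmxA _ W) walk_odd mulmxA IHt.
by rewrite mulrN1 scaleNr mulmxN scalerN opprK -scalemxAl.
Qed.

(** If x and y are the even and odd components at s, the two values over s are sqrt (w s) (x + y) /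
    2 and sqrt (w s) (x - y) / 2. *)
Lemma sum_norm_sheets (q : 'rV[R]_#|S|) : \sum_i `|q 0 i| =
  \sum_(j < #|C|) 2^-1 * sqw (enum_val j) *
     (`|(q *m Ke) 0 j + (q *m Ko) 0 j| + `|(q *m Ke) 0 j - (q *m Ko) 0 j|).
Proof.
have [Q qE] : exists Q : T -> R, forall i, q 0 i = Q (enum_val i).
  have [/set0Pn[u0 u0S]|/negbNE/eqP S0] := boolP (S != set0).
    by exists (fun u => q 0 (enum_rank_in u0S u)) => i; rewrite enum_valK_in.
  by exists (fun=> 0) => i; have /setP/(_ (enum_val i)) := S0; rewrite enum_valP inE.
rewrite (eq_bigr (fun i => `|Q (enum_val i)|)); last by move=> i _; rewrite qE.
rewrite -(big_enum_val (fun u => `|Q u|)) sum_sheets big_enum_val.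
apply: eq_bigr => j _; have sC := enum_valP j; set s := enum_val j in sC *.
have eE : (q *m Ke) 0 j = (Q (O s) + Q (opp (O s))) / sqw s.
  rewrite mxE (eq_bigr (fun i : 'I_#|S| => Q (enum_val i) *
    ((supp (enum_val i) == s)%:R / sqw s))); last by move=> i _; rewrite !mxE qE.
  rewrite -(big_enum_val (fun v => Q v * ((supp v == s)%:R / sqw s))) sum_sheets.
  rewrite (bigD1 s)//= [X in _ + X]big1 ?addr0; last first.
    by move=> t /andP[tC /negPf ts]; rewrite supp_O// supp_opp// ts !(mulr0, mul0r) addr0.
  by rewrite supp_O// supp_opp// eqxx -mulrDl mul1r.
have oE : (q *m Ko) 0 j = (Q (O s) - Q (opp (O s))) / sqw s.
  rewrite mxE (eq_bigr (fun i : 'I_#|S| => Q (enum_val i) *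
    (sheet (enum_val i) * (supp (enum_val i) == s)%:R / sqw s))); last first.
    by move=> i _; rewrite !mxE qE.
  rewrite -(big_enum_val (fun v => Q v * (sheet v * (supp v == s)%:R / sqw s))).
  rewrite sum_sheets (bigD1 s)//= [X in _ + X]big1 ?addr0; last first.
    by move=> t /andP[tC /negPf ts]; rewrite supp_O// supp_opp// ts !(mulr0, mul0r) addr0.
  by rewrite supp_O// supp_opp// sheet_O// sheet_opp// eqxx /=; ring.
have s0 := w0 sC; have sge0 : 0 <= sqw s by rewrite sqrtr_ge0.
rewrite eE oE -mulrDl -mulrBl !normrM !normfV (ger0_norm sge0).
have -> : Q (O s) + Q (opp (O s)) + (Q (O s) - Q (opp (O s))) = 2 * Q (O s) by ring.
have -> : Q (O s) + Q (opp (O s)) - (Q (O s) - Q (opp (O s))) = 2 * Q (opp (O s)) by ring.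
rewrite !normrM ger0_norm//; move: (sqw s) s0 => a a0; by field.
Qed.

Lemma even_odd_inj (q : 'rV[R]_#|S|) : q *m Ke = 0 -> q *m Ko = 0 -> q = 0.
Proof.
move=> qe qo; have := sum_norm_sheets q; rewrite qe qo.
rewrite [RHS]big1; last by move=> j _; rewrite !mxE addr0 subr0 normr0 addr0 mulr0.
move=> /eqP; rewrite psumr_eq0// => /allP q0; apply/rowP => i.
by have := q0 i (mem_index_enum _); rewrite /= normr_eq0 mxE => /eqP.
Qed.

Hypothesis C_neq0 : C != set0.
Hypothesis Me_sym : Me^T = Me.
Hypothesis Mo_sym : Mo^T = Mo.
Hypothesis Me_psd : forall g, 0 <= dotv (g *m Me) g.
Hypothesis Mo_nsd : forall g, 0 <= dotv (g *m (- Mo)) g.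
Local Notation phi := (vec C (fun s => sqw s)).
Hypothesis phi_Me : phi *m Me = phi.
Variables l1 l2 : R.
Hypothesis Me_top : top_on phi Me l1.
Hypothesis Mo_top : top_on 0 (- Mo) l2.
Hypothesis l1_lt1 : l1 < 1.
Hypothesis l2_lt1 : l2 < 1.
Hypothesis l2_gt0 : 0 < l2.

Let mu : R := \sum_(s in C) w s.
Let mu_gt0 : 0 < mu.
Proof.
have /set0Pn[s sC] := C_neq0; rewrite /mu (bigD1 s)//= ltr_pwDl ?w_gt0//.
by apply: sumr_ge0 => t /andP[tC _]; rewrite ltW ?w_gt0.
Qed.

Let equilibrium : 'rV[R]_#|S| := \row_i (w (supp (enum_val i)) / (2 * mu)).

Let equilibrium_even : equilibrium *m Ke = mu^-1 *: phi.
Proof.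
apply/rowP => j; rewrite !mxE; have sC := enum_valP j; set s := enum_val j in sC *.
rewrite (eq_bigr (fun i : 'I_#|S| => w (supp (enum_val i)) / (2 * mu) *
   ((supp (enum_val i) == s)%:R / sqw s))); last by move=> l _; rewrite !mxE.
rewrite -(big_enum_val (fun v => w (supp v) / (2 * mu) * ((supp v == s)%:R / sqw s))).
rewrite sum_sheets (bigD1 s)//= [X in _ + X]big1 ?addr0; last first.
  by move=> t /andP[tC /negPf ts]; rewrite supp_O// supp_opp// ts !(mulr0, mul0r) addr0.
rewrite supp_O// supp_opp// eqxx /=; have m0 := lt0r_neq0 mu_gt0.
move: (w0 sC) (sqwM sC); move: (sqw s) => a a0; move: (w s) (mu) m0 => ? b b0 <-.
by field; rewrite a0 b0.
Qed.

Let equilibrium_odd : equilibrium *m Ko = 0.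
Proof.
apply/rowP => j; rewrite !mxE; have sC := enum_valP j; set s := enum_val j in sC *.
rewrite (eq_bigr (fun i : 'I_#|S| => w (supp (enum_val i)) / (2 * mu) *
   (sheet (enum_val i) * (supp (enum_val i) == s)%:R / sqw s))); last by move=> l _; rewrite !mxE.
rewrite -(big_enum_val (fun v => w (supp v) / (2 * mu) *
  (sheet v * (supp v == s)%:R / sqw s))).
rewrite sum_sheets big1 // => t tC.
by rewrite supp_O// supp_opp// sheet_O// sheet_opp//=; ring.
Qed.

(** The factors sqrt w cancel, so pairing with phi gives the total mass. Hence the difference of two
    distributions has an even part orthogonal to phi. *)
Let even_phi (p : 'rV[R]_#|S|) : dotv (p *m Ke) phi = \sum_i p 0 i.
Proof.
rewrite dotv_mul; apply: eq_bigr => i _; rewrite mxE.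
have sC := supp_in (enum_valP i).
rewrite (eq_bigr (fun l : 'I_#|C| => (supp (enum_val i) == enum_val l)%:R * 1)).
  by rewrite (sum_supp (fun=> 1))// mulr1.
by move=> l _; rewrite !mxE mulrCA divff// w0// enum_valP.
Qed.

Let phi_dot : dotv phi phi = mu.
Proof. by rewrite dotv_vec; apply: eq_bigr => s sC; rewrite sqwM. Qed.

(** The even part of the difference of two stationary distributions is fixed by Me and orthogonal to
    phi, hence 0 as l1 < 1. The odd part is fixed by Mo, whose quadratic form is nonpositive, hence
    also 0. *)
Lemma equilibrium_unique : unique (stationary W) equilibrium.
Proof.
have centered (p : 'rV[R]_#|S|) : \sum_i p 0 i = 1 -> dotv ((p - equilibrium) *m Ke) phi = 0.
  move=> p1; rewrite mulmxBl equilibrium_even dotvDl dotvNl dotvZl even_phi p1 phi_dot.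
  by rewrite mulVf ?subrr// lt0r_neq0.
split; first split.
- split=> [i|].
    by rewrite mxE divr_ge0// ?mulr_ge0// ltW// w_gt0// supp_in// enum_valP.
  by rewrite -even_phi equilibrium_even dotvZl phi_dot mulVf// lt0r_neq0.
- apply/eqP; rewrite -subr_eq0; apply/eqP; apply: even_odd_inj.
    by rewrite mulmxBl -mulmxA walk_even mulmxA equilibrium_even -scalemxAl phi_Me subrr.
  by rewrite mulmxBl -mulmxA walk_odd mulmxA equilibrium_odd mul0mx subrr.
move=> p [[p0 p1] pW]; apply/esym/eqP; rewrite -subr_eq0; apply/eqP.
apply: even_odd_inj.
  have z0 := centered p p1; set z := _ *m Ke in z0 *.
  have zM : z *m Me = z.
    rewrite /z -mulmxA -walk_even mulmxA mulmxBl pW; congr ((_ - _) *m _).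
    apply/eqP; rewrite -subr_eq0; apply/eqP; apply: even_odd_inj.
      by rewrite mulmxBl -mulmxA walk_even mulmxA equilibrium_even -scalemxAl phi_Me subrr.
    by rewrite mulmxBl -mulmxA walk_odd mulmxA equilibrium_odd mul0mx subrr.
  have [_ /(_ z z0)] := Me_top; rewrite zM => zl.
  apply/eqP; rewrite -dotvv_eq0 eq_le dotvv_ge0 andbT.
  rewrite -(pmulr_rle0 _ (_ : 0 < 1 - l1)) ?subr_gt0//; lra.
rewrite mulmxBl equilibrium_odd subr0; set y := p *m Ko.
have yM : y *m Mo = y by rewrite /y -mulmxA -walk_odd mulmxA pW.
have := Mo_nsd y; rewrite mulmxN yM dotvNl oppr_ge0 => yl.
by apply/eqP; rewrite -dotvv_eq0 eq_le yl dotvv_ge0.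
Qed.

(** Even and odd parts, divided by the same power of [lam], both converge up to the alternating sign
    of the odd part. The limit of the distance is positive once the part attaining the maximum has a
    nonzero component along an eigenvector g1 or g2 for it. *)
Lemma two_sheeted_rate : convergence_rate P S (Num.max l1 l2).
Proof.
set lam := Num.max l1 l2.
have lam0 : 0 < lam by rewrite lt_max l2_gt0 orbT.
have l1lam : l1 <= lam by rewrite le_max lexx.
have l2lam : l2 <= lam by rewrite le_max lexx orbT.
split; first by rewrite lam0 gt_max l1_lt1.
exists equilibrium; first exact: equilibrium_unique.
have [[g1 g10 [g1phi g1M]] _] := Me_top; have [[g2 g20 [_ g2M]] _] := Mo_top.
pose z (p : 'rV[R]_#|S|) := p *m Ke - mu^-1 *: phi.
have good (p : 'rV[R]_#|S|) : \sum_i p 0 i = 1 ->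
    (lam = l1 /\ dotv (p *m Ke) g1 != 0) \/ (lam = l2 /\ dotv (p *m Ko) g2 != 0) ->
    exists2 c : R, 0 < c & ((fun t : nat =>
      tv_dist (p *m W ^+ t) equilibrium / lam ^+ t) @ \oo --> c)%classic.
  move=> p1 cond.
  have zphi : dotv (z p) phi = 0.
    by rewrite dotvDl dotvNl dotvZl even_phi p1 phi_dot mulVf ?subrr// lt0r_neq0.
  have [le [le_cvg le_neq0]] :=
    power_asymptotics Me_sym Me_psd phi_Me Me_top l1lam lam0 zphi.
  have NMo_sym : (- Mo)^T = - Mo by rewrite linearN/= Mo_sym.
  have [lo [lo_cvg lo_neq0]] :=
    power_asymptotics NMo_sym Mo_nsd (mul0mx _ _) Mo_top l2lam lam0
      (etrans (dotvC (p *m Ko) 0) (dot0v _)).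
  pose c := 2^-1 * \sum_(j < #|C|) 2^-1 * sqw (enum_val j) *
     (`|le 0 j + lo 0 j| + `|le 0 j - lo 0 j|).
  exists c.
    have term_ge0 (j : 'I_#|C|) : 0 <= 2^-1 * sqw (enum_val j) *
        (`|le 0 j + lo 0 j| + `|le 0 j - lo 0 j|).
      by rewrite mulr_ge0 ?addr_ge0// mulr_ge0 ?sqrtr_ge0.
    rewrite /c mulr_gt0 ?invr_gt0// lt_def sumr_ge0// andbT.
    (* If c were 0, then le + lo and le - lo would vanish, and with them le and lo. *)
    apply/negP; rewrite psumr_eq0// => /allP allz.
    have lz j : le 0 j = 0 /\ lo 0 j = 0.
      have := allz j (mem_index_enum _); rewrite mulf_eq0 mulf_eq0 invr_eq0 pnatr_eq0 /=.
      rewrite (negPf (w0 (enum_valP j))) /= paddr_eq0// !normr_eq0.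
      by move=> /andP[/eqP h1 /eqP h2]; split; lra.
    case: cond => -[lamE pg].
      have : le != 0.
        apply: (le_neq0 g1); first by rewrite g1M lamE.
        by rewrite dotvDl dotvNl dotvZl (dotvC phi) g1phi mulr0 subr0.
      by move/eqP; apply; apply/rowP => j; rewrite (lz j).1 mxE.
    have : lo != 0 by apply: (lo_neq0 g2) => //; rewrite g2M lamE.
    by move/eqP; apply; apply/rowP => j; rewrite (lz j).2 mxE.
  have -> : (fun t : nat => tv_dist (p *m W ^+ t) equilibrium / lam ^+ t) =
    (fun t => 2^-1 * \sum_(j < #|C|) 2^-1 * sqw (enum_val j) *
     (`|(z p *m Me ^+ t) 0 j / lam ^+ t + (p *m Ko *m (- Mo) ^+ t) 0 j / lam ^+ t| +
      `|(z p *m Me ^+ t) 0 j / lam ^+ t - (p *m Ko *m (- Mo) ^+ t) 0 j / lam ^+ t|)).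
    apply/funext => t; rewrite /tv_dist -mulrA; congr (_ * _).
    rewrite (eq_bigr (fun i => `|(p *m W ^+ t - equilibrium) 0 i|)); last first.
      by move=> i _; rewrite !mxE.
    rewrite sum_norm_sheets mulr_suml; apply: eq_bigr => j _.
    have phiM : phi *m Me ^+ t = phi.
      elim: t => [|t IHt]; first by rewrite expr0 mulmx1.
      by rewrite exprSr mulmxA IHt.
    have -> : (p *m W ^+ t - equilibrium) *m Ke = z p *m Me ^+ t.
      by rewrite !mulmxBl walk_pow_even equilibrium_even -scalemxAl phiM.
    have -> : (p *m W ^+ t - equilibrium) *m Ko = (-1) ^+ t *: (p *m Ko *m (- Mo) ^+ t).
      by rewrite mulmxBl walk_pow_odd equilibrium_odd subr0.
    move: (z p *m Me ^+ t) (p *m Ko *m (- Mo) ^+ t) => xv yv.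
    have -> : ((-1) ^+ t *: yv) 0 j = (-1) ^+ t * yv 0 j by rewrite mxE.
    move: (xv 0 j) (yv 0 j) => x y.
    rewrite -mulrDl -mulrBl !normrM !normfV (ger0_norm (exprn_ge0 t (ltW lam0))).
    rewrite -mulrDl [RHS]mulrA; congr (_ * _ / _); rewrite -signr_odd.
    (* For odd t the sign merely exchanges the two absolute values. *)
    case: (odd t); rewrite ?expr0 ?expr1 ?mul1r//.
    by rewrite mulN1r opprK addrC.
  apply: cvgMl_tmp; apply: cvgn_sum => j _; apply: cvgMl_tmp.
  by apply: cvgD; apply: cvg_norm; [apply: cvgD|apply: cvgB].
(* v is the pull-back of g1 or g2 to oriented faces; [hyperplane_null] asks for two different
   coordinates of it. *)
suff [v [i [j [vij vgood]]]] : exists (v : 'rV[R]_#|S|) i j, v 0 i != v 0 j /\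
    forall p : 'rV[R]_#|S|, dotv p v != 0 ->
    (lam = l1 /\ dotv (p *m Ke) g1 != 0) \/ (lam = l2 /\ dotv (p *m Ko) g2 != 0).
  apply: simplex_nullS (hyperplane_null vij) => p [pd np]; split=> //.
  apply/eqP; apply: contra_notT np => pv; apply: good; first by case: pd.
  exact: vgood.
have [lamE|lamE] : lam = l1 \/ lam = l2.
- by rewrite /lam; case: leP; [right|left].
- suff [i [j ij]] : exists i j, (g1 *m Ke^T) 0 i != (g1 *m Ke^T) 0 j.
    exists (g1 *m Ke^T), i, j; split=> // p; rewrite -dotv_mul => pg.
    by left.
  have vE s (sC : s \in C) : (g1 *m Ke^T) 0 (enum_rank_in (O_in sC) (O s)) =
      g1 0 (enum_rank_in sC s) / sqw s.
    rewrite mxE (bigD1 (enum_rank_in sC s))//= !mxE !enum_rankK_in ?O_in// supp_O// eqxx.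
    rewrite mul1r big1 ?addr0// => l ls; rewrite !mxE enum_rankK_in ?O_in// supp_O//.
    have -> : (s == enum_val l) = false; last by rewrite mul0r mulr0.
    apply: contraNF ls => /eqP sl; apply/eqP.
    by rewrite -[LHS](enum_valK_in sC) -sl.
  have /set0Pn[s0 s0C] := C_neq0; pose i0 := enum_rank_in (O_in s0C) (O s0).
  have [/existsP[i vi]|] := boolP [exists i, (g1 *m Ke^T) 0 i != (g1 *m Ke^T) 0 i0].
    by exists i, i0.
  (* A constant pull-back would make g1 a multiple of phi, to which it is orthogonal. *)
  rewrite negb_exists => /forallP vc; case/negP: g10.
  pose a := (g1 *m Ke^T) 0 i0.
  have g1E : g1 = a *: phi.
    apply/rowP => l; rewrite !mxE; have sC := enum_valP l.
    have := vc (enum_rank_in (O_in sC) (O (enum_val l))); rewrite negbK vE => /eqP.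
    rewrite enum_valK_in -/a => <-; by rewrite divfK// w0.
  have : dotv g1 phi == 0 by rewrite g1phi.
  rewrite {1}g1E dotvZl phi_dot mulf_eq0 (gt_eqF mu_gt0) orbF => /eqP a0.
  by rewrite g1E a0 scale0r.
- have [i gi] : exists i, g2 0 i != 0.
    apply/existsP; apply: contraNT g20; rewrite negb_exists => /forallP g0.
    by apply/eqP/rowP => i; rewrite mxE; apply/eqP; have := g0 i; rewrite negbK.
  have sC := enum_valP i; set s := enum_val i in sC.
  have vE u (uS : u \in S) : supp u = s ->
      (g2 *m Ko^T) 0 (enum_rank_in uS u) = sheet u * (g2 0 i / sqw s).
    move=> us; rewrite mxE (bigD1 i)//= !mxE enum_rankK_in// us eqxx.
    rewrite big1 ?addr0 => [|l li]; first by rewrite /=; ring.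
    rewrite !mxE enum_rankK_in// us (inj_eq enum_val_inj) eq_sym (negPf li).
    by rewrite !(mulr0, mul0r).
  exists (g2 *m Ko^T), (enum_rank_in (O_in sC) (O s)),
    (enum_rank_in (opp_in sC) (opp (O s))); split; last first.
    by move=> p; rewrite -dotv_mul => pg; right.
  (* The two orientations of a face where g2 does not vanish carry opposite nonzero values. *)
  rewrite !vE ?supp_O ?supp_opp// sheet_O// sheet_opp// mul1r mulN1r -subr_eq0 opprK.
  by rewrite -mulr2n mulrn_eq0 /= mulf_neq0// invr_neq0// w0.
Qed.

End TwoSheetedWalk.

(** * Oriented faces as two sheets over the faces *)

Section OrientedSheets.
Variables (R : realType) (V : finType) (X : {set {set V}}) (O : face_choice V).
Hypothesis XO : orientation X O.
Variables (n : nat) (K : {set {set V}}).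
Hypothesis KX : K \subset nfaces X n.

Lemma O_ofaces s : s \in K -> O n s \in ofaces n K.
Proof. by move=> sK; apply: ofaces_sub1 sK (XO (subsetP KX s sK)). Qed.

Lemma opp_O_ofaces s : s \in K -> opp_oface (O n s) \in ofaces n K.
Proof. by move=> sK; apply/opp_ofaces/O_ofaces. Qed.

Lemma supp_O_face s : s \in K -> supp (O n s) = s.
Proof. by move=> sK; apply: (orient_supp XO (subsetP KX s sK)). Qed.

Lemma supp_opp_O_face s : s \in K -> supp (opp_oface (O n s)) = s.
Proof. by move=> sK; rewrite (supp_opp (O_ofaces sK)) supp_O_face. Qed.

Lemma opp_O_neq s : s \in K -> opp_oface (O n s) != O n s.
Proof. by move=> sK; apply: opp_neq (O_ofaces sK). Qed.

Lemma ofaces_sheets u : u \in ofaces n K ->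
  u = O n (supp u) \/ u = opp_oface (O n (supp u)).
Proof.
move=> uK; have sK := ofaces_supp uK.
by apply: (ofaces_same_supp (O_ofaces sK) uK); rewrite supp_O_face.
Qed.

Lemma sum_ofaces (F : oface V n -> R) :
  \sum_(u in ofaces n K) F u = \sum_(s in K) (F (O n s) + F (opp_oface (O n s))).
Proof.
exact: (sum_sheets O_ofaces opp_O_ofaces supp_O_face supp_opp_O_face
  (@ofaces_supp _ _ _) opp_O_neq ofaces_sheets).
Qed.

Local Notation sheet := (sheet R (@supp V n) (O n)).

Lemma ofaces_flip u : u \in ofaces n K ->
  exists2 b, u = flip b (O n (supp u)) & sheet u = (-1) ^+ b.
Proof.
move=> uK; have sK := ofaces_supp uK; have [uO|uO] := ofaces_sheets uK.
  by exists false; rewrite // /sheet -uO eqxx.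
exists true; first exact: uO.
by rewrite /sheet ifF ?expr1// {1}uO; apply/negbTE/opp_O_neq.
Qed.

End OrientedSheets.

(** * Transition probabilities in terms of the quotient and signed matrices *)

Section WalkEntries.
Variables (R : realType) (V : finType) (X : {set {set V}}) (k : nat) (C : {set {set V}}).
Hypothesis HX : simplicial_complex X.
Hypothesis k_gt0 : (0 < k)%N.
Hypothesis HC : up_component X k C.
Hypothesis C_ge2 : (2 <= #|C|)%N.
Local Notation D := (down_of X k C).
Local Notation w s := ((LP X s)%:R : R).
Local Notation sqw s := (Num.sqrt (w s)).
Local Notation N := (k.+1%:R : R).
Variable O : face_choice V.
Hypothesis XO : orientation X O.
Local Notation sheetC := (sheet R (@supp V k) (O k)).
Local Notation sheetD := (sheet R (@supp V k.+1) (O k.+1)).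

Let CX : C \subset nfaces X k := component_sub HC.
Let DX : D \subset nfaces X k.+1.
Proof. by apply/subsetP => t; apply: down_of_faces. Qed.

Let wC s : s \in C -> 0 < w s. Proof. exact: (wC_gt0 R HX HC). Qed.
Let wD s : s \in D -> 0 < w s. Proof. exact: (wD_gt0 R HX). Qed.

Let N0 : N != 0. Proof. by rewrite pnatr_eq0. Qed.

Lemma incidence_sheet v u : v \in ofaces k.+1 D -> u \in ofaces k C -> supp u \subset supp v ->
  (incidence v u)%:~R = sheetD v * sheetC u *
    (incidence (O k.+1 (supp v)) (O k (supp u)))%:~R :> R.
Proof.
move=> vD uC uv; have [b vE sv] := ofaces_flip R XO DX vD.
have [c uE su] := ofaces_flip R XO CX uC; rewrite sv su {1}vE {1}uE.
have vD' := ofaces_supp vD; have uC' := ofaces_supp uC.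
rewrite (incidence_flip _ _ k_gt0 (O_ofaces XO DX vD') (O_ofaces XO CX uC')).
  by rewrite !intrM !rmorphXn/= !rmorphN1.
by rewrite (supp_O_face XO DX)// (supp_O_face XO CX).
Qed.

(* Of the two orientations of a common (co)face exactly one contributes, and only
   if the two incidence numbers have opposite signs. *)
Lemma opposite_signs_sum (a b : int) (x : R) : a = (-1) ^+ (a == -1) -> b = (-1) ^+ (b == -1) ->
  (if (a == 1) && (b == -1) then x else 0) +
  (if (- a == 1) && (- b == -1) then x else 0) = x * (1 - a%:~R * b%:~R) / 2.
Proof.
have E1 : (1 == -1 :> int) = false by [].
have E2 : (-1 == 1 :> int) = false by [].
move=> -> ->; case: (a == -1); case: (b == -1);
  by rewrite ?expr0 ?expr1 ?opprK ?eqxx ?E1 ?E2 /= ?intrN; field.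
Qed.

(** All cofaces of the support of u lie in D, so the sum may be restricted to D. The two
    orientations of a coface together contribute the weight times (1 - a b) / 2, where a and b are
    the two incidence numbers. *)
Lemma up_walkE u u' : u \in ofaces k C -> u' \in ofaces k C ->
  up_walk R X u u' = \sum_(t in D) (if (supp u \subset t) && (supp u' \subset t) then
    w t / (N * w (supp u)) * (1 - sheetC u * sheetC u' *
      ((incidence (O k.+1 t) (O k (supp u)))%:~R *
       (incidence (O k.+1 t) (O k (supp u')))%:~R)) / 2 else 0).
Proof.
move=> uC u'C; have sC := ofaces_supp uC; have s'C := ofaces_supp u'C.
rewrite /up_walk (negPf (component_nonleaf HC C_ge2 sC)) big_mkcondr /=.
rewrite (sum_ofaces XO (subxx _)) (bigID (mem D)) /= [X in _ + X]big1 ?addr0; last first.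
  move=> t /andP[tX tD]; rewrite (supp_opp_O_face XO (subxx _) tX) (supp_O_face XO (subxx _) tX).
  have -> : (supp u \subset t) = false by apply: contraNF tD => /(mem_down_of sC tX).
  by rewrite /= addr0.
rewrite (eq_bigl (mem D)); last first.
  move=> t /=; apply/andP/idP => [[]//|tD]; split=> //; exact: down_of_faces tD.
apply: eq_bigr => t tD; have tX := down_of_faces tD.
rewrite (supp_opp_O_face XO (subxx _) tX) (supp_O_face XO (subxx _) tX).
have [st|] := boolP (supp u \subset t) => /=; last by rewrite addr0.
have [s't|] := boolP (supp u' \subset t) => /=; last by rewrite addr0.
have OD := O_ofaces XO DX tD; have Ot := supp_O_face XO DX tD.
rewrite (incidence_oppl k_gt0 OD uC) ?Ot// (incidence_oppl k_gt0 OD u'C) ?Ot//.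
rewrite opposite_signs_sum; [|exact: incidence_pm|exact: incidence_pm].
rewrite (incidence_sheet OD uC) ?Ot// (incidence_sheet OD u'C) ?Ot//.
have -> : sheetD (O k.+1 t) = 1.
  by rewrite /sheet Ot eqxx.
by congr (_ * _ / _); ring.
Qed.

Lemma down_walkE u u' : u \in ofaces k.+1 D -> u' \in ofaces k.+1 D ->
  down_walk R X u u' = \sum_(s in C) (if (s \subset supp u) && (s \subset supp u') then
    w (supp u') / (N * w s) * (1 - sheetD u * sheetD u' *
      ((incidence (O k.+1 (supp u)) (O k s))%:~R *
       (incidence (O k.+1 (supp u')) (O k s))%:~R)) / 2 else 0).
Proof.
move=> uD u'D; have tD := ofaces_supp uD; have t'D := ofaces_supp u'D.
rewrite /down_walk big_mkcondr /=.
rewrite (sum_ofaces XO (subxx _)) (bigID (mem C)) /= [X in _ + X]big1 ?addr0; last first.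
  move=> s /andP[sX sC]; rewrite (supp_opp_O_face XO (subxx _) sX) (supp_O_face XO (subxx _) sX).
  have -> : (s \subset supp u) = false by apply: contraNF sC => /(facet_component HC sX tD).
  by rewrite /= addr0.
rewrite (eq_bigl (mem C)); last first.
  move=> s /=; apply/andP/idP => [[]//|sC]; split=> //; exact: component_faces sC.
apply: eq_bigr => s sC; have sX := component_faces HC sC.
rewrite (supp_opp_O_face XO (subxx _) sX) (supp_O_face XO (subxx _) sX).
have [st|] := boolP (s \subset supp u) => /=; last by rewrite addr0.
have [s't|] := boolP (s \subset supp u') => /=; last by rewrite addr0.
have OC := O_ofaces XO CX sC; have Os := supp_O_face XO CX sC.
rewrite (incidence_oppr k_gt0 uD OC) ?Os// (incidence_oppr k_gt0 u'D OC) ?Os//.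
(* The down-walk asks for -1 at u and 1 at u', the reverse of the up-walk. *)
rewrite ![(incidence u (O k s) == -1) && _]andbC.
rewrite [((- incidence u (O k s)) == -1) && _]andbC.
rewrite opposite_signs_sum; [|exact: incidence_pm|exact: incidence_pm].
rewrite (incidence_sheet uD OC) ?Os// (incidence_sheet u'D OC) ?Os//.
have -> : sheetC (O k s) = 1.
  by rewrite /sheet Os eqxx.
by congr (_ * _ / _); ring.
Qed.

Definition quot_entry (diag : {set V} -> R) (off : {set V} -> {set V} -> R) s s' :=
  if s == s' then diag s else off s s'.
Definition signed_entry (diag : {set V} -> R) (off : {set V} -> {set V} -> R)
    (sgn : {set V} -> {set V} -> int) s s' :=
  if s == s' then - diag s else - ((sgn s s')%:~R * off s s').

(** In each factor 1 - a b the constant 1 yields the quotient matrix and the product of incidence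
    numbers yields the signed one. *)
Lemma up_walk_entry u u' : u \in ofaces k C -> u' \in ofaces k C ->
  up_walk R X u u' = 2^-1 * (sqw (supp u') / sqw (supp u)) *
    (quot_entry (up_diag R k) (up_off R X k) (supp u) (supp u') +
     sheetC u * sheetC u' *
     signed_entry (up_diag R k) (up_off R X k) (s_up k O) (supp u) (supp u')).
Proof.
move=> uC u'C; rewrite up_walkE//; have sC := ofaces_supp uC; have s'C := ofaces_supp u'C.
move: (sheetC u * sheetC u') => e; move: (supp u) (supp u') sC s'C => s s' sC s'C.
have a0 : sqw s != 0 by rewrite lt0r_neq0// sqrtr_gt0 wC.
have b0 : sqw s' != 0 by rewrite lt0r_neq0// sqrtr_gt0 wC.
have ws : sqw s * sqw s = w s by rewrite -expr2 sqr_sqrtr// ltW// wC.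
rewrite /quot_entry /signed_entry; have [<-|ss'] := eqVneq s s'.
  rewrite (eq_bigr (fun t : {set V} => (N * w s)^-1 * (1 - e) / 2 *
    (if s \subset t then w t else 0))); last first.
    move=> t _; rewrite andbb; case: ifP => _; rewrite ?mulr0//.
    by rewrite -intrM incidence_face_sqr mulr1; ring.
  rewrite -mulr_sumr (sum_cofaces HX HC C_ge2)// divff// mulr1 /up_diag.
  move: ws a0; move: (sqw s) => a; move: (w s) (N) N0 => ? n n0 <- a0.
  by field; rewrite n0 a0.
rewrite (sum_common_coface HC _ sC s'C ss') /up_off; case: ifP => _; last first.
  by rewrite mulr0 oppr0 mulr0 addr0 mulr0.
rewrite /s_up intrM; set x := (incidence _ (O k s))%:~R; set y := (incidence _ (O k s'))%:~R.
move: ws a0; move: (sqw s) => a; move: (sqw s') b0 (w (_ :|: _)) => b b0 z.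
move: (w s) (N) N0 => ? n n0 <- a0; by field; rewrite n0 a0 b0.
Qed.

Lemma down_walk_entry u u' : u \in ofaces k.+1 D -> u' \in ofaces k.+1 D ->
  down_walk R X u u' = 2^-1 * (sqw (supp u') / sqw (supp u)) *
    (quot_entry (down_diag R X k) (down_off R X k) (supp u) (supp u') +
     sheetD u * sheetD u' *
     signed_entry (down_diag R X k) (down_off R X k) (s_down k O) (supp u) (supp u')).
Proof.
move=> uD u'D; rewrite down_walkE//; have tD := ofaces_supp uD; have t'D := ofaces_supp u'D.
move: (sheetD u * sheetD u') => e; move: (supp u) (supp u') tD t'D => t t' tD t'D.
have a0 : sqw t != 0 by rewrite lt0r_neq0// sqrtr_gt0 wD.
have b0 : sqw t' != 0 by rewrite lt0r_neq0// sqrtr_gt0 wD.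
have wt' : sqw t' * sqw t' = w t' by rewrite -expr2 sqr_sqrtr// ltW// wD.
rewrite /quot_entry /signed_entry; have [<-|tt'] := eqVneq t t'.
  rewrite (eq_bigr (fun s : {set V} => N^-1 * w t * (1 - e) / 2 *
    (if s \subset t then (w s)^-1 else 0))); last first.
    move=> s _; rewrite andbb; case: ifP => _; rewrite ?mulr0//.
    by rewrite -intrM incidence_face_sqr mulr1 invfM; ring.
  rewrite -mulr_sumr -(inv_facetsE R HC tD) divff// mulr1 /down_diag; by ring.
rewrite (sum_common_facet HC _ tD t'D tt') /down_off; case: ifP => _; last first.
  by rewrite mulr0 oppr0 mulr0 addr0 mulr0.
rewrite /s_down intrM invfM; set x := (incidence (O k.+1 t) _)%:~R.
set y := (incidence (O k.+1 t') _)%:~R.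
move: wt' b0; move: (sqw t') => b; move: (sqw t) a0 (w (_ :&: _))^-1 => a a0 z.
move: (w t') (N) N0 => ? n n0 <- b0; by field; rewrite n0 a0.
Qed.

End WalkEntries.

(** * Convergence rates of the two walks and the final bounds *)

Section Rates.
Variables (R : realType) (V : finType) (X : {set {set V}}) (k : nat) (C : {set {set V}}).
Hypothesis HX : simplicial_complex X.
Hypothesis k_gt0 : (0 < k)%N.
Hypothesis HC : up_component X k C.
Hypothesis C_ge2 : (2 <= #|C|)%N.
Hypothesis D_ge2 : (2 <= #|down_of X k C|)%N.
Local Notation D := (down_of X k C).
Variable O : face_choice V.
Hypothesis XO : orientation X O.

Lemma quot_entry_mx diag off (K : {set {set V}}) :
  \matrix_(i, j) quot_entry diag off (enum_val i) (enum_val j) = quot_mx diag off K :> 'M[R]_#|K|.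
Proof. by apply/matrixP => i j; rewrite !mxE /quot_entry (inj_eq enum_val_inj). Qed.

Lemma signed_entry_mx diag off sgn (K : {set {set V}}) :
  \matrix_(i, j) signed_entry diag off sgn (enum_val i) (enum_val j) =
  signed_mx diag off sgn K :> 'M[R]_#|K|.
Proof. by apply/matrixP => i j; rewrite !mxE /signed_entry (inj_eq enum_val_inj). Qed.

Local Notation l1 := (lambda_max1 (A_up R X k C)).
Local Notation l2 := (- lambda_min (A_up_signed R X k O C)).

(** The opposite of the signed up matrix has diagonal entries 1 / (k+1), which bound its largest
    eigenvalue from below. *)
Lemma signed_top_gt0 : 0 < l2.
Proof.
have := top_on_diag (Ordinal (ltnW C_ge2)) (A_up_signed_top R X k C_ge2 O); apply: lt_le_trans.
by rewrite !mxE eqxx opprK invr_gt0 ltr0n.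
Qed.

Lemma up_rate : l1 < 1 -> l2 < 1 ->
  convergence_rate (@up_walk R V X k) (ofaces k C) (Num.max l1 l2).
Proof.
move=> l1_lt1 l2_lt1; have CX := component_sub HC.
have C0 : C != set0 by rewrite -card_gt0 (ltn_trans _ C_ge2).
have top := A_up_top R HX k_gt0 HC C_ge2.
apply: (two_sheeted_rate (O_ofaces XO CX) (opp_O_ofaces XO CX) (supp_O_face XO CX)
  (supp_opp_O_face XO CX) (@ofaces_supp _ _ _) (opp_O_neq XO CX) (ofaces_sheets XO CX)
  (wC_gt0 R HX HC) (up_walk_entry R HX k_gt0 HC C_ge2 XO)) => //;
  rewrite ?quot_entry_mx ?signed_entry_mx.
- exact: A_up_sym.
- exact: A_up_signed_sym.
- by move=> g; rewrite -(gram_quot_up R HX HC C_ge2) gram_psd.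
- move=> g; rewrite -[signed_mx _ _ _ _]/(A_up_signed R X k O C).
  by rewrite -(gram_signed_up R HX HC C_ge2 O) gram_psd.
- exact: A_up_sqw.
- exact: top.
- exact: A_up_signed_top.
- exact: signed_top_gt0.
Qed.

(** The rate is literally the same number: both eigenvalues are rewritten by the equalities between
    up and down spectra. *)
Lemma down_rate : l1 < 1 -> l2 < 1 ->
  convergence_rate (@down_walk R V X k) (ofaces k.+1 D) (Num.max l1 l2).
Proof.
move=> l1_lt1 l2_lt1; have l2_gt0 := signed_top_gt0.
rewrite (lambda_max1_up_down R HX k_gt0 HC C_ge2 D_ge2) in l1_lt1 *.
rewrite (lambda_min_up_down R HX HC C_ge2 D_ge2) in l2_lt1 l2_gt0 *.
have DX : D \subset nfaces X k.+1 by apply/subsetP => t; apply: down_of_faces.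
have D0 : D != set0 by rewrite -card_gt0 (ltn_trans _ D_ge2).
apply: (two_sheeted_rate (O_ofaces XO DX) (opp_O_ofaces XO DX) (supp_O_face XO DX)
  (supp_opp_O_face XO DX) (@ofaces_supp _ _ _) (opp_O_neq XO DX) (ofaces_sheets XO DX)
  (wD_gt0 R HX) (down_walk_entry R HX k_gt0 HC XO)) => //;
  rewrite ?quot_entry_mx ?signed_entry_mx.
- exact: A_down_sym.
- exact: A_down_signed_sym.
- by move=> g; rewrite -(gram_quot_down R HX HC) gram_psdT.
- move=> g; rewrite -[signed_mx _ _ _ _]/(A_down_signed R X k O D).
  by rewrite -(gram_signed_down R HX HC O) gram_psdT.
- exact: A_down_sqw.
- exact: A_down_top.
- exact: A_down_signed_top.
Qed.

End Rates.

Theorem theorem2p19 (R : realType) (V : finType) (X : {set {set V}}) (k : nat)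
    (C : {set {set V}})
    (HX : simplicial_complex X)
    (Hk : (1 <= k <= cdim X)%N)
    (HC : up_component X k C)
    (Hleaf : ~~ single_leaf X C)
    (HC2 : (2 <= #|C|)%N)
    (HD2 : (2 <= #|down_of X k C|)%N) :
  let D := down_of X k C in
  let d := d_down R X k D in
  let lower_quot :=
    Num.max (qh_up R X k C ^+ 2 / k%:R) (qh_down R X k D ^+ 2 / d) in
  let upper_quot := Num.min (qh_up R X k C) (qh_down R X k D) in
  let lower_signed :=
    Num.max (h_up R X k C ^+ 2 / k%:R) (h_down R X k D ^+ 2 / d) in
  let upper_signed := Num.min (h_up R X k C) (h_down R X k D) in
  [/\ [/\ lower_quot / (2 * k.+1%:R) <= 1 - lambda_max1 (A_up R X k C),
          1 - lambda_max1 (A_up R X k C) = 1 - lambda_max1 (A_down R X k D) &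
          1 - lambda_max1 (A_down R X k D) <= 2 * upper_quot / k.+1%:R],
      forall O : face_choice V, orientation X O ->
      [/\ lower_signed / (2 * k.+1%:R) <= 1 + lambda_min (A_up_signed R X k O C),
          1 + lambda_min (A_up_signed R X k O C)
            = 1 + lambda_min (A_down_signed R X k O D) &
          1 + lambda_min (A_down_signed R X k O D) <= 2 * upper_signed / k.+1%:R] &
      ~ up_coherent X k C -> ~ down_coherent X k D ->
      exists lam : R,
        [/\ convergence_rate (@up_walk R V X k) (ofaces k C) lam,
            convergence_rate (@down_walk R V X k) (ofaces k.+1 D) lam,
            1 - 2 * Num.max upper_quot upper_signed / k.+1%:R <= lam &
            lam <= 1 - Num.min lower_quot lower_signed / (2 * k.+1%:R)]].
Proof.
move=> D d lower_quot upper_quot lower_signed upper_signed.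
have /andP[k_gt0 _] := Hk.
have N0 : 0 < k.+1%:R :> R by rewrite ltr0n.
have N2 : 0 < 2 * k.+1%:R :> R by rewrite mulr_gt0.
have max_le (x y z : R) : x / (2 * k.+1%:R) <= z -> y / (2 * k.+1%:R) <= z ->
    Num.max x y / (2 * k.+1%:R) <= z.
  by move=> xz yz; case: (leP x y).
have le_min (x y z : R) : z <= 2 * x / k.+1%:R -> z <= 2 * y / k.+1%:R ->
    z <= 2 * Num.min x y / k.+1%:R.
  by move=> xz yz; case: (leP x y).
have quotE := lambda_max1_up_down R HX k_gt0 HC HC2 HD2.
have [qu_lo qu_up] := up_quot_bounds HX k_gt0 HC HC2 (A_up_top R HX k_gt0 HC HC2).
have [qd_lo qd_up] := down_quot_bounds HX k_gt0 HC HC2 HD2 (A_down_top R HX k_gt0 HC HC2 HD2).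
rewrite -quotE in qd_lo qd_up.
have quot_lo : lower_quot / (2 * k.+1%:R) <= 1 - lambda_max1 (A_up R X k C).
  exact: max_le.
have quot_up : 1 - lambda_max1 (A_up R X k C) <= 2 * upper_quot / k.+1%:R.
  exact: le_min.
have signed O : orientation X O ->
    lower_signed / (2 * k.+1%:R) <= 1 + lambda_min (A_up_signed R X k O C) /\
    1 + lambda_min (A_up_signed R X k O C) <= 2 * upper_signed / k.+1%:R.
  move=> XO; have [su_lo su_up] := up_signed_bounds R HX k_gt0 HC HC2 XO.
  have [sd_lo sd_up] := down_signed_bounds R HX k_gt0 HC HC2 HD2 XO.
  rewrite -(lambda_min_up_down R HX HC HC2 HD2) in sd_lo sd_up.
  by split; [apply: max_le|apply: le_min].
split.
- by split; rewrite -?quotE.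
- move=> O XO; have [lo up] := signed O XO.
  by split; rewrite -?(lambda_min_up_down R HX HC HC2 HD2).
(* The walks involve no orientation; an arbitrary one is fixed to express the odd eigenvalue. *)
move=> ncoh _; case: (orientation_exists X) => O XO; have [lo up] := signed O XO.
have l1_lt1 := lambda_max1_lt1 R HX k_gt0 HC HC2.
have l2_lt1 : - lambda_min (A_up_signed R X k O C) < 1.
  by rewrite ltrNl; apply: (lambda_min_gtN1 R HX k_gt0 HC HC2 XO Hleaf ncoh).
exists (Num.max (lambda_max1 (A_up R X k C)) (- lambda_min (A_up_signed R X k O C))).
split.
- exact: up_rate.
- exact: down_rate.
(* Already the quotient eigenvalue satisfies this bound, since the constant subtracted is at least
   the one in its own upper bound. *)
- rewrite le_max lerBlDr -lerBlDl; apply/orP; left; apply: le_trans quot_up _.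
  by rewrite ler_pM2r ?invr_gt0// ler_pM2l// le_max lexx.
- have mono (x y : R) : x <= y -> x / (2 * k.+1%:R) <= y / (2 * k.+1%:R).
    by rewrite ler_pM2r ?invr_gt0.
  rewrite ge_max !lerBrDr -!lerBrDl !opprK; apply/andP; split.
    by apply: le_trans quot_lo; apply: mono; rewrite ge_min lexx.
  by apply: le_trans lo; apply: mono; rewrite ge_min lexx orbT.
Qed.
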